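(* Let $(A,\Delta)$ be a co-amenable algebraic quantum group of compact type with Haar state $\varphi$, GNS pair $(H,\Lambda)$, associated representation $\pi:A\to B(H)$, and modular functionals $(f_z)_{z\in\mathbf C}$. For all $t\in\mathbf R$, set $F_t=(\tilde f_{it}\otimes\iota)(W)$ and $E_t=(\tilde f_{it}\otimes\iota)(W_{\mathrm{op}})$. Then $F_t\Lambda(a)=\Lambda(a*f_{-it})$ and $E_t\Lambda(a)=\Lambda(f_{-it}*a)$ for all $a\in A$, from which it follows that $F_tE_t=E_tF_t$ for all $t\in\mathbf R$. Moreover, there exist self-adjoint operators $F$ and $E$ in $H$ such that $F_t=\exp(itF)$ and $E_t=\exp(itE)$ for all $t\in\mathbf R$. For all $t\in\mathbf R$, set $V_t=F_tE_t$, so that $V_t=\exp(it(E+F))$. Then $\sigma_t(x)=V_txV_t^*$ for all $x\in A_{\mathrm r}$. Here $\sigma_t$ is the unique automorphism of $A_{\mathrm r}$ for which $\sigma_t(\pi(a))=\pi(f_{-it}*a*f_{-it})$ for all $a\in A$. The Haar state $\varphi_{\mathrm r}$ on $A_{\mathrm r}$ satisfies the KMS condition for $(\sigma_t)_{t\in\mathbf R}$ at inverse temperature $\beta=1$.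
   Context: An algebraic quantum group of compact type is a pair $(A,\Delta)$ where $A$ is a unital $*$-algebra over $\mathbf C$ and $\Delta:A\to A\otimes A$ (algebraic tensor product) is a unital $*$-homomorphism with $(\Delta\otimes\iota)\Delta=(\iota\otimes\Delta)\Delta$, such that $a\otimes b\mapsto\Delta(a)(b\otimes1)$ and $a\otimes b\mapsto\Delta(a)(1\otimes b)$ define linear bijections of $A\otimes A$, and such that there is a non-zero positive linear functional $\varphi$ on $A$ with $(\iota\otimes\varphi)\Delta(a)=\varphi(a)1$ for all $a$. Here $\iota$ denotes the identity map. Then $\varphi$ is faithful, also right invariant, and normalized by $\varphi(1)=1$ it is unique (the Haar state). The co-unit $\varepsilon:A\to\mathbf C$ is the unique non-zero $*$-homomorphism with $(\varepsilon\otimes\iota)\Delta=(\iota\otimes\varepsilon)\Delta=\iota$; $S$ is the antipode ($m(S\otimes\iota)\Delta(a)=m(\iota\otimes S)\Delta(a)=\varepsilon(a)1$, with $m$ the multiplication map $A\otimes A\to A$). GNS pair: a Hilbert space $H$ and a linear map $\Lambda:A\to H$ with dense range with $(\Lambda(a),\Lambda(b))=\varphi(b^*a)$. $\pi:A\to B(H)$ is the faithful $*$-homomorphism with $\pi(a)\Lambda(b)=\Lambda(ab)$; $A_{\mathrm r}=\overline{\pi(A)}$ (norm closure); $\varphi_{\mathrm r}$ is the restriction to $A_{\mathrm r}$ of the vector state $x\mapsto(x\Lambda(1),\Lambda(1))$. $(A,\Delta)$ is co-amenable if $\varepsilon$ is bounded for the norm $\|a\|=\|\pi(a)\|$ on $A$.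 $W$ is the unique unitary on $H\otimes H$ with $W((\Lambda\otimes\Lambda)(\Delta(b)(a\otimes1)))=\Lambda(a)\otimes\Lambda(b)$ for all $a,b\in A$. With $\chi$ the flip on $A\otimes A$ and $\Delta_{\mathrm{op}}=\chi\Delta$, $(A,\Delta_{\mathrm{op}})$ is again an algebraic quantum group of compact type with the same Haar state, and $W_{\mathrm{op}}$ is the unitary defined in the same way with $\Delta_{\mathrm{op}}$ in place of $\Delta$ (same $H,\Lambda$). Both $W$ and $W_{\mathrm{op}}$ lie in the multiplier algebra $M(A_{\mathrm r}\otimes B_0(H))$, where $B_0(H)$ denotes the compact operators and $\otimes$ is here the minimal C*-tensor product. For linear functionals $\tau,\tau'$ on $A$ and $a\in A$: $\tau*a=(\iota\otimes\tau)\Delta(a)$, $a*\tau'=(\tau'\otimes\iota)\Delta(a)$, $\tau*a*\tau'=(\tau'\otimes\iota\otimes\tau)(\Delta\otimes\iota)\Delta(a)$. The modular functionals $(f_z)_{z\in\mathbf C}$ are the unique family of unital multiplicative linear functionals on $A$ such that: (1) for each $a$, $z\mapsto f_z(a)$ is entire and of exponential growth on the right half plane (there are real $C>0$ and $r$ with $|f_z(a)|\le Ce^{r\,\mathrm{Re}\,z}$ when $\mathrm{Re}\,z\ge0$); (2) $f_0=\varepsilon$ and $f_{z+w}=(f_z\otimes f_w)\Delta$; (3) $f_z(S(a))=f_{-z}(a)$ and $\overline{f_z(a^* )}=f_{-\bar z}(a)$; (4) $S^2(a)=f_{-1}*a*f_1$; (5) $\varphi(ab)=\varphi(b\,(f_1*a*f_1))$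 for all $a,b\in A$. (Existence and uniqueness are due to Woronowicz.) For $t\in\mathbf R$, $f_{it}$ is a unital $*$-homomorphism $A\to\mathbf C$; when $(A,\Delta)$ is co-amenable it is bounded, and $\tilde f_{it}$ denotes the unique $*$-homomorphism $A_{\mathrm r}\to\mathbf C$ with $\tilde f_{it}\circ\pi=f_{it}$. $\tilde f_{it}\otimes\iota$ denotes the unique extension to a $*$-homomorphism $M(A_{\mathrm r}\otimes B_0(H))\to M(B_0(H))=B(H)$ of the non-degenerate $*$-homomorphism $A_{\mathrm r}\otimes B_0(H)\to B_0(H)$, $x\otimes y\mapsto\tilde f_{it}(x)y$. KMS condition at inverse temperature $\beta$ for $(\sigma_t)$: $\varphi_{\mathrm r}(xy)=\varphi_{\mathrm r}(y\,\sigma_{i\beta}(x))$ for $x,y\in A_{\mathrm r}$ with $x$ in the domain of the analytic extension $\sigma_{i\beta}$. *)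

(* Defs.v *)
From HB Require Import structures.
From mathcomp Require Import all_boot all_order all_algebra generic_quotient.
From mathcomp Require Import complex.
From mathcomp Require Import all_classical all_reals all_analysis.

Set Implicit Arguments.
Unset Strict Implicit.
Unset Printing Implicit Defensive.

Import Order.TTheory GRing.Theory Num.Theory.
Import numFieldNormedType.Exports.

Local Open Scope classical_set_scope.
Local Open Scope complex_scope.
Local Open Scope ring_scope.
Local Open Scope quotient_scope.

(* [tensor U V], the algebraic tensor product, is the set of formal sums of
   pairs, two sums being identified when every bilinear map takes the same
   value on them. *)

Section Tensor.
Variables (K : fieldType) (U V : lmodType K).

Definition is_bilinear (W : lmodType K) (B : U -> V -> W) : Prop :=
  (forall v, linear (B^~ v)) /\ (forall u, linear (B u)).

Definition tsum (W : nmodType) (B : U -> V -> W) (s : seq (U * V)) : W :=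
  \sum_(p <- s) B p.1 p.2.

Definition tequiv (s1 s2 : seq (U * V)) : bool :=
  `[< forall (W : lmodType K) (B : U -> V -> W),
        is_bilinear B -> tsum B s1 = tsum B s2 >].

Lemma tequiv_refl : reflexive tequiv.
Proof. by move=> s; apply/asboolP. Qed.

Lemma tequiv_sym : symmetric tequiv.
Proof.
by move=> s1 s2; apply/asboolP/asboolP => h W B bB; rewrite (h W B bB).
Qed.

Lemma tequiv_trans : transitive tequiv.
Proof.
move=> s2 s1 s3 /asboolP h12 /asboolP h23; apply/asboolP => W B bB.
by rewrite h12 ?h23.
Qed.

Canonical tequiv_equiv := EquivRel tequiv tequiv_refl tequiv_sym tequiv_trans.

Definition tensor := {eq_quot tequiv_equiv}.

HB.instance Definition _ := Choice.on tensor.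
HB.instance Definition _ := EqQuotient.on tensor.

Definition tens (u : U) (v : V) : tensor := \pi_tensor [:: (u, v)].

(* The map induced on the tensor product by a map [B] of two variables; it is
   meant for [B] bilinear (see [tlift_pi]), or bilinear up to complex
   conjugation (see [tstar_tens]). *)
Definition tlift (W : nmodType) (B : U -> V -> W) (x : tensor) : W :=
  tsum B (repr x).

Lemma tlift_pi (W : lmodType K) (B : U -> V -> W) s :
  is_bilinear B -> tlift B (\pi_tensor s) = tsum B s.
Proof.
move=> bB; rewrite /tlift; have /eqmodP/asboolP h := reprK (\pi_tensor s).
exact: h.
Qed.

Lemma tensor_ext (x y : tensor) :
  (forall (W : lmodType K) (B : U -> V -> W),
     is_bilinear B -> tlift B x = tlift B y) -> x = y.
Proof.
by move=> h; rewrite -[x]reprK -[y]reprK; apply/eqmodP/asboolP.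
Qed.

Definition tzero : tensor := \pi_tensor [::].
Definition tadd (x y : tensor) : tensor := \pi_tensor (repr x ++ repr y).
Definition tscale (c : K) (x : tensor) : tensor :=
  \pi_tensor [seq (c *: p.1, p.2) | p <- repr x].
Definition topp (x : tensor) : tensor := tscale (-1) x.

Section LiftOps.
Variables (W : lmodType K) (B : U -> V -> W).
Hypothesis bB : is_bilinear B.

Lemma tlift0_subproof : tlift B tzero = 0.
Proof. by rewrite tlift_pi // /tsum big_nil. Qed.

Lemma tliftD_subproof x y : tlift B (tadd x y) = tlift B x + tlift B y.
Proof. by rewrite tlift_pi // /tsum big_cat. Qed.

Lemma tliftZ_subproof c x : tlift B (tscale c x) = c *: tlift B x.
Proof.
rewrite tlift_pi // /tlift /tsum big_map scaler_sumr; apply: eq_bigr => p _ /=.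
have h0 : B 0 p.2 = 0.
  by have /= := bB.1 p.2 (-1) 0 0; rewrite scaler0 addr0 scaleN1r addNr.
by have /= := bB.1 p.2 c p.1 0; rewrite !addr0 h0 addr0.
Qed.

End LiftOps.

Lemma taddA : associative tadd.
Proof. by move=> x y z; apply: tensor_ext => W B bB; rewrite !tliftD_subproof // addrA. Qed.

Lemma taddC : commutative tadd.
Proof. by move=> x y; apply: tensor_ext => W B bB; rewrite !tliftD_subproof // addrC. Qed.

Lemma tadd0 : left_id tzero tadd.
Proof.
by move=> x; apply: tensor_ext => W B bB; rewrite tliftD_subproof // tlift0_subproof // add0r.
Qed.

Lemma taddN : left_inverse tzero topp tadd.
Proof.
move=> x; apply: tensor_ext => W B bB.
by rewrite tliftD_subproof // tlift0_subproof // tliftZ_subproof // scaleN1r addNr.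
Qed.

HB.instance Definition _ := GRing.isZmodule.Build tensor taddA taddC tadd0 taddN.

Lemma tscaleA a b (x : tensor) : tscale a (tscale b x) = tscale (a * b) x.
Proof. by apply: tensor_ext => W B bB; rewrite !tliftZ_subproof // scalerA. Qed.

Lemma tscale1 : left_id 1 tscale.
Proof. by move=> x; apply: tensor_ext => W B bB; rewrite tliftZ_subproof // scale1r. Qed.

Lemma tscaleDr : right_distributive tscale +%R.
Proof.
move=> c x y; apply: tensor_ext => W B bB.
by rewrite tliftZ_subproof // !tliftD_subproof // !tliftZ_subproof // scalerDr.
Qed.

Lemma tscaleDl (x : tensor) : {morph tscale^~ x : a b / a + b}.
Proof.
move=> a b; apply: tensor_ext => W B bB.
by rewrite tliftD_subproof // !tliftZ_subproof // scalerDl.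
Qed.

HB.instance Definition _ := GRing.Zmodule_isLmodule.Build K tensor
  tscaleA tscale1 tscaleDr tscaleDl.

Lemma tlift_linear (W : lmodType K) (B : U -> V -> W) :
  is_bilinear B -> linear (tlift B).
Proof.
by move=> bB c x y; rewrite tliftD_subproof // tliftZ_subproof.
Qed.

Lemma tlift_tens (W : lmodType K) (B : U -> V -> W) u v :
  is_bilinear B -> tlift B (tens u v) = B u v.
Proof. by move=> bB; rewrite tlift_pi // /tsum big_seq1. Qed.

Lemma tens_bilinear : is_bilinear tens.
Proof.
split=> [v|u] c x y; apply: tensor_ext => W B bB;
  rewrite tliftD_subproof // tliftZ_subproof // !tlift_tens //.
- exact: bB.1.
- exact: bB.2.
Qed.

Lemma tensE (x : tensor) : x = \sum_(p <- repr x) tens p.1 p.2.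
Proof.
apply: tensor_ext => W B bB; rewrite {1}/tlift /tsum.
elim: (repr x) => [|p s ih]; first by rewrite !big_nil tlift0_subproof.
by rewrite !big_cons tliftD_subproof // -ih tlift_tens.
Qed.

End Tensor.

Section TensorMaps.
Variable K : fieldType.

Definition tmap (U V U' V' : lmodType K) (g : U -> U') (h : V -> V') :
    tensor U V -> tensor U' V' :=
  tlift (fun u v => tens (g u) (h v)).

Definition tassoc (U V W : lmodType K) :
    tensor (tensor U V) W -> tensor U (tensor V W) :=
  tlift (fun x w => tlift (fun u v => tens u (tens v w)) x).

Definition tflip (U V : lmodType K) : tensor U V -> tensor V U :=
  tlift (fun u v => tens v u).

Definition tmul (A B : algType K) (x y : tensor A B) : tensor A B :=
  tlift (fun a b => tlift (fun a' b' => tens (a * a') (b * b')) y) x.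

Definition slice_l (U V : lmodType K) (tau : U -> K) : tensor U V -> V :=
  tlift (fun u v => tau u *: v).

Definition slice_r (U V : lmodType K) (tau : V -> K) : tensor U V -> U :=
  tlift (fun u v => tau v *: u).

End TensorMaps.

Section QuantumGroup.
Variables (R : realType) (A : algType R[i]).
Local Notation C := R[i].

Definition star_structure (star : A -> A) : Prop :=
  [/\ involutive star,
      forall c a b, star (c *: a + b) = Num.conj c *: star a + star b
    & forall a b, star (a * b) = star b * star a].

Definition tstar (star : A -> A) (x : tensor A A) : tensor A A :=
  tlift (fun a b => tens (star a) (star b)) x.

Definition positive_functional (star : A -> A) (phi : A -> C) : Prop :=
  forall a, 0 <= phi (star a * a).

Definition left_invariant (Delta : A -> tensor A A) (phi : A -> C) : Prop :=
  forall a, slice_r phi (Delta a) = phi a *: 1.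

Definition star_hom_tensor (star : A -> A) (Delta : A -> tensor A A) : Prop :=
  [/\ linear Delta,
      Delta 1 = tens 1 1,
      forall a b, Delta (a * b) = tmul (Delta a) (Delta b)
    & forall a, Delta (star a) = tstar star (Delta a)].

Definition compact_aqg (star : A -> A) (Delta : A -> tensor A A) : Prop :=
  [/\ star_structure star /\ star_hom_tensor star Delta,
      forall a, tassoc (tmap Delta id (Delta a)) = tmap id Delta (Delta a),
      bijective (tlift (fun a b => tmul (Delta a) (tens b 1))
                   : tensor A A -> tensor A A),
      bijective (tlift (fun a b => tmul (Delta a) (tens 1 b))
                   : tensor A A -> tensor A A)
    & exists phi : {scalar A}, [/\ exists a, phi a != 0, positive_functional star phi
                                 & left_invariant Delta phi]].

Definition haar_state (star : A -> A) (Delta : A -> tensor A A)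
    (phi : {scalar A}) : Prop :=
  [/\ positive_functional star phi, left_invariant Delta phi & phi 1 = 1].

Definition is_counit (star : A -> A) (Delta : A -> tensor A A)
    (eps : {scalar A}) : Prop :=
  [/\ exists a, eps a != 0,
      forall a b, eps (a * b) = eps a * eps b,
      forall a, eps (star a) = Num.conj (eps a),
      forall a, slice_l eps (Delta a) = a
    & forall a, slice_r eps (Delta a) = a].

Definition is_antipode (Delta : A -> tensor A A) (eps : {scalar A})
    (S : {linear A -> A}) : Prop :=
  forall a, tlift (fun b c => S b * c) (Delta a) = eps a *: 1 /\
            tlift (fun b c => b * S c) (Delta a) = eps a *: 1.

(* [conv_l tau a] is tau * a, [conv_r a tau'] is a * tau' and
   [conv_lr tau a tau'] is tau * a * tau'. *)
Definition conv_l (Delta : A -> tensor A A) (tau : A -> C) (a : A) : A :=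
  slice_r tau (Delta a).

Definition conv_r (Delta : A -> tensor A A) (a : A) (tau' : A -> C) : A :=
  slice_l tau' (Delta a).

Definition conv_lr (Delta : A -> tensor A A) (tau : A -> C) (a : A)
    (tau' : A -> C) : A :=
  tlift (fun x c => tau c *: slice_l tau' x) (tmap Delta id (Delta a)).

Definition exponential_growth (g : C -> C) : Prop :=
  exists M r : R, 0 < M /\
    forall z : C, 0 <= complex.Re z ->
      `|g z| <= (M * expR (r * complex.Re z))%:C.

Definition modular_functionals (star : A -> A) (Delta : A -> tensor A A)
    (eps : {scalar A}) (S : {linear A -> A}) (phi : {scalar A})
    (f : C -> {scalar A}) : Prop :=
  [/\ forall z, f z 1 = 1 /\ forall a b, f z (a * b) = f z a * f z b,
      forall a, (forall z : C^o, derivable ((fun w => f w a) : C^o -> C^o) z 1)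
                /\ exponential_growth (fun z => f z a),
      (forall a, f 0 a = eps a) /\
        (forall z w a, f (z + w) a =
           tlift (fun b c => f z b * f w c : C^o) (Delta a)),
      (forall z a, f z (S a) = f (- z) a) /\
        (forall z a, Num.conj (f z (star a)) = f (- Num.conj z) a)
    & (forall a, S (S a) = conv_lr Delta (f (-1)) a (f 1)) /\
        (forall a b, phi (a * b) = phi (b * conv_lr Delta (f 1) a (f 1)))].

End QuantumGroup.

(* [tstar] is well defined although its defining map is conjugate-linear in
   each variable: it is bilinear with values in the conjugate vector space. *)
Section TStar.
Variables (R : realType) (A : algType R[i]).

Definition conj_space (W : lmodType R[i]) : Type := W.

Section ConjSpace.
Variable W : lmodType R[i].
Local Notation cW := (conj_space W).
HB.instance Definition _ := GRing.Zmodule.on cW.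
Definition conj_scale (c : R[i]) (w : cW) : cW := Num.conj c *: (w : W).

Lemma conj_scaleA a b (w : cW) :
  conj_scale a (conj_scale b w) = conj_scale (a * b) w.
Proof. by rewrite /conj_scale scalerA -rmorphM. Qed.
Lemma conj_scale1 : left_id 1 conj_scale.
Proof. by move=> w; rewrite /conj_scale rmorph1 scale1r. Qed.
Lemma conj_scaleDr : right_distributive conj_scale +%R.
Proof. by move=> c x y; rewrite /conj_scale -scalerDr. Qed.
Lemma conj_scaleDl (w : cW) : {morph conj_scale^~ w : a b / a + b}.
Proof. by move=> a b; rewrite /conj_scale rmorphD scalerDl. Qed.

HB.instance Definition _ := GRing.Zmodule_isLmodule.Build R[i] cW
  conj_scaleA conj_scale1 conj_scaleDr conj_scaleDl.
End ConjSpace.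

Lemma tstar_tens (star : A -> A) a b :
  star_structure star -> tstar star (tens a b) = tens (star a) (star b).
Proof.
move=> [_ starL _]; rewrite /tstar.
pose B (a b : A) : conj_space (tensor A A) := tens (star a) (star b).
suff bB : is_bilinear B by exact: (tlift_tens a b bB).
split=> [v|u] c x y; rewrite /B starL.
- exact: (tens_bilinear A A).1.
- exact: (tens_bilinear A A).2.
Qed.

End TStar.

Record hilbert (R : realType) := Hilbert {
  hilbert_space :> completeNormedModType R[i];
  hilbert_dot : {dot hilbert_space for (@Num.conj R[i])};
  hilbert_normE : forall x : hilbert_space, `|x| ^+ 2 = hilbert_dot x x
}.

Definition inner (R : realType) (H : hilbert R) (x y : H) : R[i] :=
  hilbert_dot H x y.

Section Operators.
Variables (R : realType) (H : hilbert R).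
Local Notation C := R[i].

Definition bounded_op (T : H -> H) : Prop :=
  linear T /\ exists M : R, forall x, `|T x| <= M%:C * `|x|.

(* Meaningful for bounded [T] only: [sup] of an unbounded set is 0. *)
Definition opnorm (T : H -> H) : R :=
  sup [set complex.Re `|T x| | x in [set x : H | `|x| <= 1]].

(* The value [adj T y] is determined by the condition; it exists for bounded
   [T] by the Riesz representation theorem. *)
Definition adj (T : H -> H) (y : H) : H :=
  xget 0 [set z | forall x, inner (T x) y = inner x z].

Definition unitary_op (T : H -> H) : Prop :=
  [/\ bounded_op T, T \o adj T = id & adj T \o T = id].

Definition compact_op : set (H -> H) :=
  [set T | bounded_op T /\ precompact (T @` [set x : H | `|x| <= 1])].

Definition norm_closure (S : set (H -> H)) : set (H -> H) :=
  [set T | bounded_op T /\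
           forall e : R, 0 < e -> exists2 X, S X & opnorm (T - X) < e].

Definition finite_sums (S : set (H -> H)) : set (H -> H) :=
  [set T | exists (n : nat) (X : 'I_n -> H -> H),
             (forall i, S (X i)) /\ T = \sum_(i < n) X i].

(* The multiplier algebra of a C*-algebra [D] acting non-degenerately on [H],
   realized as usual as the idealizer of [D] in B(H). *)
Definition multipliers (D : set (H -> H)) : set (H -> H) :=
  [set T | bounded_op T /\ forall d, D d -> D (T \o d) /\ D (d \o T)].

End Operators.

Definition op_star_hom (R : realType) (H K : hilbert R) (D : set (H -> H))
    (Phi : (H -> H) -> (K -> K)) : Prop :=
  [/\ forall X, D X -> bounded_op (Phi X),
      forall (c : R[i]) X Y, D X -> D Y ->
        Phi (c *: X + Y) = c *: Phi X + Phi Y,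
      forall X Y, D X -> D Y -> Phi (X \o Y) = Phi X \o Phi Y
    & forall X, D X -> Phi (adj X) = adj (Phi X)].

Definition char_star_hom (R : realType) (H : hilbert R) (D : set (H -> H))
    (chi : (H -> H) -> R[i]) : Prop :=
  [/\ forall c X Y, D X -> D Y -> chi (c *: X + Y) = c * chi X + chi Y,
      forall X Y, D X -> D Y -> chi (X \o Y) = chi X * chi Y
    & forall X, D X -> chi (adj X) = Num.conj (chi X)].

Definition star_automorphism (R : realType) (H : hilbert R)
    (D : set (H -> H)) (s : (H -> H) -> (H -> H)) : Prop :=
  op_star_hom D s /\ set_bij D D s.

Section HilbertTensor.
Variables (R : realType) (H HH : hilbert R) (ten : H -> H -> HH).

Definition hilbert_tensor : Prop :=
  [/\ is_bilinear ten,
      forall x y x' y', inner (ten x y) (ten x' y') = inner x x' * inner y y'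
    & dense [set v : HH | exists (n : nat) (x y : 'I_n -> H),
                            v = \sum_(i < n) ten (x i) (y i)]].

Definition is_op_tensor (X Y : H -> H) (T : HH -> HH) : Prop :=
  bounded_op T /\ forall x y, T (ten x y) = ten (X x) (Y y).

Definition min_tensor (D E : set (H -> H)) : set (HH -> HH) :=
  norm_closure (finite_sums
    [set T | exists X Y, [/\ D X, E Y & is_op_tensor X Y T]]).

(* [Phi] is the extension [chi (x) id : M(D (x) B_0(H)) -> B(H)]. *)
Definition is_slice_extension (D : set (H -> H)) (chi : (H -> H) -> R[i])
    (Phi : (HH -> HH) -> (H -> H)) : Prop :=
  op_star_hom (multipliers (min_tensor D (@compact_op R H))) Phi /\
  forall X Y T, D X -> compact_op Y -> is_op_tensor X Y T -> Phi T = chi X *: Y.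

End HilbertTensor.

(* A possibly unbounded operator is identified with its graph. *)

Section Unbounded.
Variables (R : realType) (H : hilbert R).
Local Notation C := R[i].

Definition op_domain (G : set (H * H)) : set H :=
  [set x | exists y, G (x, y)].

Definition op_adjoint (G : set (H * H)) : set (H * H) :=
  [set q | forall p, G p -> inner p.2 q.1 = inner p.1 q.2].

(* Linearity and single-valuedness of [G] follow from these conditions. *)
Definition self_adjoint (G : set (H * H)) : Prop :=
  dense (op_domain G) /\ op_adjoint G = G.

Definition op_sum (G G' : set (H * H)) : set (H * H) :=
  [set p | exists y z, [/\ G (p.1, y), G' (p.1, z) & p.2 = y + z]].

Definition op_closure (G : set (H * H)) : set (H * H) :=
  closure (G : set (H * H)%type).

(* [mu x] is the scalar measure [B |-> (P(B)x, x)]. *)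
Definition spectral_measure (P : set R -> H -> H)
    (mu : H -> {measure set (measurableTypeR R) -> \bar R}) : Prop :=
  [/\ forall B : set (measurableTypeR R), measurable B ->
        [/\ bounded_op (P B), P B \o P B = P B & adj (P B) = P B],
      P setT = id,
      forall B B' : set (measurableTypeR R), measurable B -> measurable B' ->
        P (B `&` B') = P B \o P B'
    & forall x (B : set (measurableTypeR R)), measurable B ->
        mu x B = (complex.Re (inner (P B x) x))%:E].

(* [G] is the integral of [lambda] with respect to the spectral measure. *)
Definition spectral_resolution (G : set (H * H))
    (mu : H -> {measure set (measurableTypeR R) -> \bar R}) : Prop :=
  (forall x, op_domain G x <->
     (\int[mu x]_(s in setT) ((s ^+ 2)%:E) < +oo)%E) /\
  (forall x y, G (x, y) -> inner y x = (\int[mu x]_s s)%:C).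

(* [U = g(G)] in the Borel functional calculus of the self-adjoint operator
   [G], for [g] bounded; the spectral measure of [G] is unique. *)
Definition is_functional_calculus (G : set (H * H)) (g : R -> C)
    (U : H -> H) : Prop :=
  bounded_op U /\
  exists (P : set R -> H -> H)
         (mu : H -> {measure set (measurableTypeR R) -> \bar R}),
    [/\ spectral_measure P mu, spectral_resolution G mu
      & forall x, inner (U x) x =
          (\int[mu x]_s (complex.Re (g s))) +i*
          (\int[mu x]_s (complex.Im (g s)))].

Definition is_exp_i (t : R) (G : set (H * H)) (U : H -> H) : Prop :=
  is_functional_calculus G (fun s => cos (t * s) +i* sin (t * s)) U.

End Unbounded.

Section KMS.
Variables (R : realType) (H : hilbert R) (D : set (H -> H)).
Local Notation C := R[i].

Definition strip (beta : R) : set C :=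
  [set z | 0 <= complex.Im z <= beta].

(* [g] is continuous on the strip [0 <= Im z <= beta], analytic in its interior
   and extends [t |-> sigma_t(X)], so that [g (i beta) = sigma_{i beta}(X)]. *)
Definition analytic_extension (sigma : R -> (H -> H) -> (H -> H)) (beta : R)
    (X : H -> H) (g : C -> (H -> H)) : Prop :=
  [/\ forall z, strip beta z -> D (g z),
      forall t : R, g t%:C = sigma t X,
      forall z, strip beta z -> forall e : R, 0 < e ->
        exists2 d : R, 0 < d & forall w, strip beta w ->
          `|w - z| < d%:C -> opnorm (g w - g z) < e
    & forall z, 0 < complex.Im z < beta ->
        exists2 L, D L & forall e : R, 0 < e ->
          exists2 d : R, 0 < d & forall h : C, h != 0 -> `|h| < d%:C ->
            opnorm (h^-1 *: (g (z + h) - g z) - L) < e].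

Definition kms_condition (psi : (H -> H) -> C)
    (sigma : R -> (H -> H) -> (H -> H)) (beta : R) : Prop :=
  forall X Y g, D X -> D Y -> analytic_extension sigma beta X g ->
    psi (X \o Y) = psi (Y \o g (0 +i* beta)).

End KMS.

Section Reduced.
Variables (R : realType) (A : algType R[i]) (H : hilbert R).
Local Notation C := R[i].

Definition gns_pair (star : A -> A) (phi : {scalar A})
    (Lambda : {linear A -> H}) : Prop :=
  dense (range Lambda) /\
  forall a b, inner (Lambda a) (Lambda b) = phi (star b * a).

Definition gns_representation (star : A -> A) (Lambda : {linear A -> H})
    (pi : A -> H -> H) : Prop :=
  [/\ forall a, bounded_op (pi a),
      forall a b, pi a (Lambda b) = Lambda (a * b),
      forall (c : C) a b, pi (c *: a + b) = c *: pi a + pi b,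
      (forall a b, pi (a * b) = pi a \o pi b) /\
        (forall a, pi (star a) = adj (pi a))
    & injective pi].

Definition reduced_algebra (pi : A -> H -> H) : set (H -> H) :=
  norm_closure (range pi).

Definition reduced_state (Lambda : {linear A -> H}) (T : H -> H) : C :=
  inner (T (Lambda 1)) (Lambda 1).

Definition co_amenable (pi : A -> H -> H) (eps : {scalar A}) : Prop :=
  exists M : R, forall a, `|eps a| <= (M * opnorm (pi a))%:C.

Definition is_multiplicative_unitary (HH : hilbert R) (ten : H -> H -> HH)
    (Delta : A -> tensor A A) (Lambda : {linear A -> H})
    (W : HH -> HH) : Prop :=
  unitary_op W /\
  forall a b,
    W (tlift (fun c d => ten (Lambda c) (Lambda d))
         (tmul (Delta b) (tens a 1))) = ten (Lambda a) (Lambda b).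

Definition is_reduced_character (pi : A -> H -> H) (chi : A -> C)
    (chi_r : (H -> H) -> C) : Prop :=
  char_star_hom (reduced_algebra pi) chi_r /\ forall a, chi_r (pi a) = chi a.

End Reduced.

(* Main.v *)
(* [W] and its adjoint permute the operators [pi a (x) |Lambda b><Lambda c|] up
   to finite sums, so they are multipliers and [F_t], [E_t] are unitaries acting
   on [Lambda A] by convolution with the characters [f_{-it}].  The derivative
   [g] of [z |-> f_z] at 0 gives two commuting operators [a |-> a * g] and
   [a |-> g * a] on [A]; they are symmetric because [F_t] and [E_t] are unitary,
   and locally finite because [Delta a] is a finite sum of tensors.  Hence
   [Lambda A] is spanned by joint eigenvectors, [F_t] and [E_t] are
   simultaneously diagonal, and all the self-adjoint operators, spectral
   measures and functional calculi involved are discrete.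

   Conjugation by [V_t] implements [sigma_t] on [pi A], and star homomorphisms
   of [A_r] are determined on the dense subalgebra [pi A] since they are bounded:
   if [||T|| <= 1/2] then [1 - T^* T] has a self-adjoint square root in [A_r].

   For the KMS condition, an analytic extension is compared with an entire
   function of [z] built from [f_{iz}]; they agree on the real axis, hence at
   [i], where the modular property [phi(ab) = phi(b (f_1 * a * f_1))] gives the
   result.  Uniqueness of the continuation is elementary: the primitive given by
   Goursat's theorem vanishes on the real axis, and a maximum principle applied
   to the product of its rotations by quarter turns propagates the vanishing. *)
Require Import Defs.
From mathcomp Require Import all_boot all_order all_algebra complex ring lra.
From mathcomp Require Import all_classical all_reals all_analysis measurable_realfun.
Set Implicit Arguments.
Unset Strict Implicit.
Unset Printing Implicit Defensive.

Import Order.TTheory GRing.Theory Num.Theory.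
Import numFieldNormedType.Exports.
Local Open Scope classical_set_scope.
Local Open Scope complex_scope.
Local Open Scope ring_scope.

(** * Hilbert spaces *)

(** The joint eigenspaces are those of the unitary groups themselves, so [F] and [E] are simply
    written down as diagonal operators on them; the generators serve only to prove that these
    eigenspaces are total. The extension of a slice map to multipliers is known only as a star
    homomorphism with prescribed values on elementary tensors. Its value at the adjoint of [W] is
    therefore read off from the product of that adjoint with [pi 1 (x) |Lambda a><Lambda 1|], a
    finite sum because the coproduct is algebraic. Everything on [W_op] and [E_t] is the statement
    on [W] and [F_t] for the flipped coproduct, so the common lemmas ask only for what survives the
    flip. In the KMS part, a function differentiable once has no known second order expansion, while
    its primitive has one: this is why the maximum principle is applied to a primitive. Injectivity
    of [Lambda], which turns equations in [H] into equations in [A], comes from the modular property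
    and the injectivity of [pi]. *)

Section Norm.
Variable R : realType.
Local Notation C := R[i].

(** The norm of a space over [R[i]] is itself an element of [R[i]], real and nonnegative; [nrm]
    returns it in [R], where estimates are left to [lra] and [nra]. *)
Definition nrm (V : normedZmodType C) (x : V) : R := complex.Re `|x|.

Variable V : normedZmodType C.
Implicit Types x y : V.

Lemma nrmE x : `|x| = (nrm x)%:C.
Proof. by rewrite /nrm RRe_real // ger0_real. Qed.

Lemma nrm_ge0 x : 0 <= nrm x.
Proof. by rewrite -ler0c -nrmE. Qed.

Lemma nrm0 : nrm (0 : V) = 0.
Proof. by rewrite /nrm normr0. Qed.

Lemma nrm_eq0 x : nrm x = 0 -> x = 0.
Proof. by move=> h; apply/eqP; rewrite -normr_eq0 nrmE h. Qed.

Lemma nrmN x : nrm (- x) = nrm x.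
Proof. by rewrite /nrm normrN. Qed.

Lemma nrmC x y : nrm (x - y) = nrm (y - x).
Proof. by rewrite /nrm distrC. Qed.

Lemma ler_nrmD x y : nrm (x + y) <= nrm x + nrm y.
Proof. by rewrite -lecR rmorphD /= -!nrmE; exact: ler_normD. Qed.

Lemma ler_nrmB x y : nrm (x - y) <= nrm x + nrm y.
Proof. by rewrite -(nrmN y) ler_nrmD. Qed.

Lemma nrm_triangle z x y : nrm (x - y) <= nrm (x - z) + nrm (z - y).
Proof. by rewrite -[x - y](subrKA z) ler_nrmD. Qed.

Lemma nrm_sum I (r : seq I) (P : pred I) (F : I -> V) :
  nrm (\sum_(i <- r | P i) F i) <= \sum_(i <- r | P i) nrm (F i).
Proof.
apply: (big_ind2 (fun x a => nrm x <= a)) => [|x a y b hx hy|//].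
  by rewrite nrm0.
by rewrite (le_trans (ler_nrmD _ _)) // lerD.
Qed.

Lemma nrm_lt_all x : (forall e : R, 0 < e -> nrm x < e) -> x = 0.
Proof.
move=> h; apply: nrm_eq0; apply/eqP/negPn/negP => n0.
have : 0 < nrm x by rewrite lt_neqAle eq_sym n0 nrm_ge0.
by move/h; rewrite ltxx.
Qed.

End Norm.

Section NormScalar.
Variable R : realType.
Local Notation C := R[i].

Lemma nrmM (c d : C) : nrm (c * d) = nrm c * nrm d.
Proof. by apply: complexI; rewrite rmorphM /= -!nrmE normrM. Qed.

Lemma nrmZ (V : normedModType C) (c : C) (x : V) : nrm (c *: x) = nrm c * nrm x.
Proof. by apply: complexI; rewrite rmorphM /= -nrmE -[(nrm c)%:C]nrmE -[(nrm x)%:C]nrmE normrZ. Qed.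

Lemma nrm_conj (c : C) : nrm (Num.conj c) = nrm c.
Proof. by rewrite /nrm norm_conjC. Qed.

Lemma nrm_real (a : R) : nrm a%:C = `|a|.
Proof. by rewrite /nrm normc_def /= expr0n addr0 sqrtr_sqr. Qed.

Lemma nrm1 : nrm (1 : C) = 1.
Proof. by rewrite /nrm normr1. Qed.

Lemma nrmi : nrm ('i%C : C) = 1.
Proof. by rewrite /nrm normc_def /= expr0n expr1n add0r sqrtr1. Qed.

Lemma nrm_sqr (c : C) : nrm c ^+ 2 = (complex.Re c) ^+ 2 + (complex.Im c) ^+ 2.
Proof. by apply: complexI; rewrite rmorphXn /= -nrmE -add_Re2_Im2. Qed.

Lemma Re_le_nrm (c : C) : `|complex.Re c| <= nrm c.
Proof. by rewrite -lecR -nrmE normc_ge_Re. Qed.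

Lemma Im_le_nrm (c : C) : `|complex.Im c| <= nrm c.
Proof.
rewrite -(ler_sqr) ?nnegrE ?nrm_ge0 // nrm_sqr real_normK ?num_real //.
by rewrite lerDr sqr_ge0.
Qed.

Lemma nrm_le_ReIm (c : C) : nrm c <= `|complex.Re c| + `|complex.Im c|.
Proof.
rewrite -ler_sqr ?nnegrE ?nrm_ge0 ?addr_ge0 // nrm_sqr sqrrD !real_normK ?num_real //.
by rewrite lerD2r lerDl mulrn_wge0 // mulr_ge0.
Qed.

Lemma conjCE (c : C) : Num.conj c = conjc c.
Proof. by []. Qed.

Lemma Re_conj (c : C) : complex.Re (Num.conj c) = complex.Re c.
Proof. by case: c. Qed.

Lemma Im_conj (c : C) : complex.Im (Num.conj c) = - complex.Im c.
Proof. by case: c. Qed.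

Lemma cReD (c d : C) : complex.Re (c + d) = complex.Re c + complex.Re d.
Proof. by case: c; case: d. Qed.
Lemma cImD (c d : C) : complex.Im (c + d) = complex.Im c + complex.Im d.
Proof. by case: c; case: d. Qed.
Lemma cReN (c : C) : complex.Re (- c) = - complex.Re c.
Proof. by case: c. Qed.
Lemma cImN (c : C) : complex.Im (- c) = - complex.Im c.
Proof. by case: c. Qed.
Lemma cReB (c d : C) : complex.Re (c - d) = complex.Re c - complex.Re d.
Proof. by rewrite cReD cReN. Qed.
Lemma cImB (c d : C) : complex.Im (c - d) = complex.Im c - complex.Im d.
Proof. by rewrite cImD cImN. Qed.
Lemma cReM (c d : C) : complex.Re (c * d) =
  complex.Re c * complex.Re d - complex.Im c * complex.Im d.
Proof. by case: c; case: d. Qed.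
Lemma cImM (c d : C) : complex.Im (c * d) =
  complex.Re c * complex.Im d + complex.Im c * complex.Re d.
Proof. by case: c; case: d. Qed.
Lemma eqC (c d : C) :
  complex.Re c = complex.Re d -> complex.Im c = complex.Im d -> c = d.
Proof. by case: c; case: d => a b a' b' /= -> ->. Qed.

End NormScalar.

Section Hilbert.
Variables (R : realType) (H : hilbert R).
Local Notation C := R[i].
Implicit Types (x y z : H) (c : C).

Lemma innerDl x y z : inner (x + y) z = inner x z + inner y z.
Proof. by rewrite /inner linearDl. Qed.
Lemma innerZl c x z : inner (c *: x) z = c * inner x z.
Proof. by rewrite /inner linearZl_LR. Qed.
Lemma inner_conj x y : Num.conj (inner x y) = inner y x.
Proof. by rewrite /inner (hermC _ y x) /= expr0 mul1r. Qed.
Lemma innerDr x y z : inner z (x + y) = inner z x + inner z y.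
Proof. by rewrite -inner_conj innerDl rmorphD /= !inner_conj. Qed.
Lemma innerZr c x z : inner z (c *: x) = Num.conj c * inner z x.
Proof. by rewrite -inner_conj innerZl rmorphM /= !inner_conj. Qed.
Lemma inner0l z : inner 0 z = 0.
Proof. by rewrite -(scale0r 0) innerZl mul0r. Qed.
Lemma inner0r z : inner z 0 = 0.
Proof. by rewrite -inner_conj inner0l conjC0. Qed.
Lemma innerNl x z : inner (- x) z = - inner x z.
Proof. by rewrite -scaleN1r innerZl mulN1r. Qed.
Lemma innerNr x z : inner z (- x) = - inner z x.
Proof. by rewrite -inner_conj innerNl rmorphN /= inner_conj. Qed.
Lemma innerBl x y z : inner (x - y) z = inner x z - inner y z.
Proof. by rewrite innerDl innerNl. Qed.
Lemma innerBr x y z : inner z (x - y) = inner z x - inner z y.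
Proof. by rewrite innerDr innerNr. Qed.
Lemma inner_suml I (r : seq I) (P : pred I) (F : I -> H) z :
  inner (\sum_(i <- r | P i) F i) z = \sum_(i <- r | P i) inner (F i) z.
Proof. exact: (big_morph (fun x => inner x z) (fun x y => innerDl x y z) (inner0l z)). Qed.
Lemma inner_sumr I (r : seq I) (P : pred I) (F : I -> H) z :
  inner z (\sum_(i <- r | P i) F i) = \sum_(i <- r | P i) inner z (F i).
Proof. exact: (big_morph (inner z) (fun x y => innerDr x y z) (inner0r z)). Qed.

Lemma innerxx x : inner x x = (nrm x ^+ 2)%:C.
Proof. by rewrite /inner -hilbert_normE nrmE rmorphXn. Qed.

Lemma nrm_sqrE x : nrm x ^+ 2 = complex.Re (inner x x).
Proof. by rewrite innerxx. Qed.

Lemma inner_eq0 x : inner x x = 0 -> x = 0.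
Proof. by rewrite innerxx => /complexI/eqP; rewrite expf_eq0 /= => /eqP/nrm_eq0. Qed.

Lemma Re_innerC x y : complex.Re (inner y x) = complex.Re (inner x y).
Proof. by rewrite -inner_conj Re_conj. Qed.

Lemma nrmD_sqr x y :
  nrm (x + y) ^+ 2 = nrm x ^+ 2 + nrm y ^+ 2 + 2 * complex.Re (inner x y).
Proof.
rewrite !nrm_sqrE innerDl !innerDr !cReD (Re_innerC x y); ring.
Qed.

Lemma nrmB_sqr x y :
  nrm (x - y) ^+ 2 = nrm x ^+ 2 + nrm y ^+ 2 - 2 * complex.Re (inner x y).
Proof. by rewrite nrmD_sqr innerNr nrmN cReN mulrN. Qed.

Lemma parallelogram x y :
  nrm (x + y) ^+ 2 + nrm (x - y) ^+ 2 = 2 * nrm x ^+ 2 + 2 * nrm y ^+ 2.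
Proof. rewrite nrmD_sqr nrmB_sqr; ring. Qed.

Lemma cauchy_schwarz x y : nrm (inner x y) <= nrm x * nrm y.
Proof.
have [->|y0] := eqVneq y 0; first by rewrite inner0r !nrm0 mulr0.
have ny : 0 < nrm y.
  rewrite lt_neqAle nrm_ge0 andbT eq_sym; apply: contra_neq y0; exact: nrm_eq0.
rewrite -ler_sqr ?nnegrE ?mulr_ge0 ?nrm_ge0 // exprMn.
have := sqr_ge0 (nrm ((nrm y ^+ 2)%:C *: x - inner x y *: y)).
rewrite nrmB_sqr !nrmZ nrm_real ger0_norm ?sqr_ge0 // innerZl innerZr inner_conj.
have -> : inner y x * inner x y = (nrm (inner x y) ^+ 2)%:C.
  apply: eqC; rewrite -inner_conj nrm_sqr.
    by rewrite cReM Re_conj Im_conj /=; ring.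
  by rewrite cImM Re_conj Im_conj /=; ring.
rewrite cReM /= mul0r subr0; set a := nrm (inner x y); set b := nrm x.
set d := nrm y in ny *.
have -> : (d ^+ 2 * b) ^+ 2 + (a * d) ^+ 2 - 2 * (d ^+ 2 * a ^+ 2) =
  d ^+ 2 * (b ^+ 2 * d ^+ 2 - a ^+ 2) by ring.
by rewrite pmulr_rge0 ?exprn_gt0 // subr_ge0.
Qed.

Lemma inner_eq x y : (forall z, inner x z = inner y z) -> x = y.
Proof.
move=> h; apply/eqP; rewrite -subr_eq0; apply/eqP/inner_eq0.
by rewrite innerBl h subrr.
Qed.

Lemma inner_eqr x y : (forall z, inner z x = inner z y) -> x = y.
Proof. by move=> h; apply: inner_eq => z; rewrite -inner_conj h inner_conj. Qed.

Definition tends (u : nat -> H) (l : H) : Prop :=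
  forall e : R, 0 < e -> exists N, forall n, (N <= n)%N -> nrm (u n - l) < e.

(** Entourages of [H] have radii in [R[i]]; a positive radius has zero imaginary part, so real radii
    suffice. *)
Lemma hilbert_complete (u : nat -> H) :
  (forall e : R, 0 < e -> exists N, forall m n, (N <= m)%N -> (N <= n)%N ->
     nrm (u m - u n) < e) -> exists l, tends u l.
Proof.
move=> h.
have /cauchy_cvgP cu : cauchy (u @ \oo).
  apply/cauchy_ballP => e e0.
  have e0' : 0 < complex.Re e by move: e0; rewrite ltcE /= => /andP[].
  have eE : e = (complex.Re e)%:C by rewrite RRe_real // gtr0_real.
  have [N hN] := h _ e0'.
  exists (u @` [set n | (N <= n)%N], u @` [set n | (N <= n)%N]) => /=.
    by split; exists N => //= n Nn; exists n.
  move=> [_ _] /= [[m hm <-] [n hn <-]].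
  by rewrite -ball_normE /= eE nrmE ltcR hN.
exists (lim (u @ \oo)) => e e0.
have /cvgrPdist_lt/(_ e%:C) := cu.
rewrite ltcR => /(_ e0) [N _ hN]; exists N => n /hN /=.
by rewrite nrmE ltcR nrmC.
Qed.

Lemma denseP (S : set H) : dense S <->
  forall x (e : R), 0 < e -> exists2 y, S y & nrm (x - y) < e.
Proof.
split=> [dS x e e0|h].
  have := dS (ball x e%:C); case.
  - exists x; apply: ballxx; by rewrite ltcR.
  - exact: ball_open.
  move=> y []; rewrite -ball_normE /= => xy Sy; exists y => //.
  by rewrite -ltcR -nrmE.
move=> O [x Ox]; rewrite openE => /(_ _ Ox); rewrite /interior /= nbhs_ballP => -[/= e e0 xe].
have e0' : 0 < complex.Re e by move: e0; rewrite ltcE /= => /andP[].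
have eE : e = (complex.Re e)%:C by rewrite RRe_real // gtr0_real.
have [y Sy xy] := h x _ e0'; exists y; split=> //; apply: xe.
by rewrite -ball_normE /= eE nrmE ltcR.
Qed.

Definition closed_subspace (M : set H) : Prop :=
  [/\ M 0, forall c x y, M x -> M y -> M (c *: x + y)
    & forall x, (forall e : R, 0 < e -> exists2 y, M y & nrm (x - y) < e) -> M x].

Definition bounded_functional (g : H -> C) : Prop :=
  (forall c x y, g (c *: x + y) = c * g x + g y) /\
  exists2 K, 0 <= K & forall x, nrm (g x) <= K * nrm x.

Section Riesz.
Variables (M : set H) (g : H -> C).
Hypotheses (hM : closed_subspace M) (hg : bounded_functional g).

Let J x : R := nrm x ^+ 2 - 2 * complex.Re (g x).

Let gD x y : g (x + y) = g x + g y.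
Proof. by have := hg.1 1 x y; rewrite scale1r mul1r. Qed.

Let gZ c x : g (c *: x) = c * g x.
Proof.
have g0 : g 0 = 0.
  by have := hg.1 (-1) 0 0; rewrite scaler0 addr0 mulN1r addNr.
by have := hg.1 c x 0; rewrite !addr0 g0 addr0.
Qed.

Let MD x y : M x -> M y -> M (x + y).
Proof. by case: hM => _ + _ Mx My => /(_ 1 x y Mx My); rewrite scale1r. Qed.

Let MZ c x : M x -> M (c *: x).
Proof. by case: hM => M0 + _ Mx => /(_ c x 0 Mx M0); rewrite addr0. Qed.

(* The functional is represented by the minimizer of [nrm x ^+ 2 - 2 Re (g x)]
   over [M]; the parallelogram law makes minimizing sequences Cauchy. *)
Lemma riesz_subspace : exists2 z, M z & forall x, M x -> g x = inner x z.
Proof.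
have [K K0 hK] := hg.2.
(* Since [Re (g x) <= K * nrm x], completing the square in [nrm x] bounds [J] below. *)
have Jlow x : - K ^+ 2 <= J x.
  rewrite /J; have := le_trans (Re_le_nrm (g x)) (hK x).
  have := sqr_ge0 (nrm x - K); have := ler_norm (complex.Re (g x)); nra.
have infJ : has_inf (J @` M).
  split; first by exists (J 0), 0 => //; case: hM.
  by exists (- K ^+ 2) => _ [x _ <-].
pose I := inf (J @` M).
have JI x : M x -> I <= J x by move=> Mx; apply: ge_inf; [exact: infJ.2 | exists x].
have /choice[u hu] n : exists x, M x /\ J x < I + n.+1%:R^-1.
  have [|_ [x Mx <-] ?] := @inf_adherent _ (J @` M) (n.+1%:R^-1) _ infJ.
    by rewrite invr_gt0.
  by exists x.
have small (e : R) : 0 < e -> exists N, forall n, (N <= n)%N -> n.+1%:R^-1 < e.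
  move=> e0; exists (Num.trunc e^-1) => n hn.
  rewrite invf_plt ?posrE //; apply: lt_le_trans (truncnS_gt _) _.
  by rewrite ler_nat ltnS.
have [|z uz] := @hilbert_complete u.
  (* [nrm (u m - u n) ^+ 2] equals [2 J(u m) + 2 J(u n) - 4 J((u m + u n) / 2)], and for large
     indices the first two values are within [e ^+ 2 / 4] of the infimum. *)
  move=> e e0; have e4 : 0 < e ^+ 2 / 4 by rewrite divr_gt0 ?exprn_gt0.
  have [N hN] := small _ e4; exists N => m n hm hn.
  rewrite -ltr_sqr ?nnegrE ?nrm_ge0 ?ltW //.
  have := JI _ (MZ (2^-1)%:C (MD (hu m).1 (hu n).1)).
  rewrite /J nrmZ nrm_real gZ gD cReM /= mul0r subr0 cReD exprMn ger0_norm ?invr_ge0 //.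
  have := parallelogram (u m) (u n).
  have := (hu m).2; have := (hu n).2; rewrite /J.
  have := hN m hm; have := hN n hn.
  set a := nrm (u m); set b := nrm (u n); set c := nrm (u m + u n).
  set d := nrm (u m - u n).
  set r := complex.Re _; set r' := complex.Re _.
  move=> h1 h2 h3 h4 h5.
  have -> : 2^-1 ^+ 2 = 4^-1 :> R by rewrite exprVn -natrX.
  move: (n.+1%:R^-1) (m.+1%:R^-1) h1 h2 h3 h4 => p q h1 h2 h3 h4; lra.
have Mz : M z.
  case: hM => _ _; apply => e e0; have [N hN] := uz e e0.
  by exists (u N); [exact: (hu N).1 | rewrite nrmC hN].
exists z => //.
(* The right-hand side is [J (z + t x) - J z]; minimality of [z] is the limit of
   [I <= J (u n + t x)]. *)
have var x (t : R) : M x ->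
    0 <= t ^+ 2 * nrm x ^+ 2 + 2 * t * (complex.Re (inner x z) - complex.Re (g x)).
  move=> Mx; apply/ler_addgt0Pl => e e0.
  have e2 : 0 < e / 2 by lra.
  have [N1 hN1] := small _ e2.
  pose q := 2 * `|t| * nrm x + 1.
  have q0 : 0 < q by rewrite /q ltr_wpDl // !mulr_ge0 ?nrm_ge0.
  have [N2 hN2] := uz (e / 2 / q) (divr_gt0 e2 q0).
  pose n := maxn N1 N2.
  have := JI _ (MD (hu n).1 (MZ t%:C Mx)); have := (hu n).2.
  have := hN1 n (leq_maxl _ _); have := hN2 n (leq_maxr _ _).
  rewrite /J nrmD_sqr nrmZ nrm_real gD gZ innerZr cReD !cReM /= !mul0r.
  rewrite exprMn real_normK ?num_real // oppr0 mul0r !subr0.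
  have -> : complex.Re (inner (u n) x) =
     complex.Re (inner x z) + complex.Re (inner (u n - z) x).
    by rewrite innerBl cReB (Re_innerC x z); ring.
  have := le_trans (Re_le_nrm _) (cauchy_schwarz (u n - z) x).
  set rr := complex.Re (inner (u n - z) x); set dd := nrm (u n - z).
  rewrite ltr_pdivlMr // => h1 h2 h3 h4 h5.
  have : `|2 * t * rr| <= dd * q.
    rewrite !normrM (ger0_norm (ler0n _ 2)) /q.
    have := nrm_ge0 (u n - z); rewrite -/dd.
    have : 2 * `|t| * `|rr| <= 2 * `|t| * (dd * nrm x).
      by rewrite ler_wpM2l // mulr_ge0.
    nra.
  have := ler_norm (2 * t * rr).
  move: (n.+1%:R^-1) h3 h4 => w h3 h4; lra.
have Req x : M x -> complex.Re (inner x z) = complex.Re (g x).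
  move=> Mx; apply/eqP; rewrite -subr_eq0; set D := _ - _.
  apply/negPn/negP => D0.
  (* At this [t] the quadratic polynomial is [- (D / (N + 1)) ^+ 2 * (N + 2)], negative unless [D]
     is zero; the denominator [N + 1] also covers [x = 0]. *)
  have := var x (- D / (nrm x ^+ 2 + 1)) Mx; rewrite -/D.
  set N := nrm x ^+ 2; have N0 : 0 <= N by rewrite sqr_ge0.
  have N1 : 0 < N + 1 by lra.
  have -> : (- D / (N + 1)) ^+ 2 * N + 2 * (- D / (N + 1)) * D =
     - (D / (N + 1)) ^+ 2 * (N + 2) by field; rewrite gt_eqF.
  rewrite mulNr oppr_ge0 leNgt => /negP; apply.
  rewrite mulr_gt0 ?exprn_even_gt0 ?mulf_neq0 ?invr_eq0 ?(gt_eqF N1) //=.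
  by rewrite ltr_wpDl.
move=> x Mx; apply: eqC; first by rewrite Req.
(* Testing at [i x] turns imaginary parts into real ones. *)
have := Req _ (MZ 'i%C Mx); rewrite innerZl gZ !cReM /=.
by rewrite !mul0r !mul1r !sub0r => /oppr_inj.
Qed.

End Riesz.

End Hilbert.

(** * Bounded operators *)

Section BoundedMaps.
Variable R : realType.
Local Notation C := R[i].

(** Source and target may differ, as for the maps [x |-> ten x y] from [H] to [HH]; on a single
    space this is [bounded_op] with a nonnegative bound. *)
Definition blin (H K : hilbert R) (T : H -> K) : Prop :=
  (forall (c : C) x y, T (c *: x + y) = c *: T x + T y) /\
  exists2 M : R, 0 <= M & forall x, nrm (T x) <= M * nrm x.

Definition hadj (H K : hilbert R) (T : H -> K) (y : K) : H :=
  xget 0 [set z | forall x, inner (T x) y = inner x z].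

Lemma bounded_opP (H : hilbert R) (T : H -> H) : bounded_op T <-> blin T.
Proof.
split=> [[lT [M hM]]|[lT [M M0 hM]]]; split=> //.
  exists (Num.max M 0) => [|x]; first by rewrite le_max lexx orbT.
  apply: (@le_trans _ _ (M * nrm x)); last by rewrite ler_wpM2r ?nrm_ge0 // le_max lexx.
  by rewrite -lecR rmorphM /= -!nrmE hM.
by exists M => x; rewrite !nrmE -rmorphM lecR.
Qed.

Lemma adjE (H : hilbert R) (T : H -> H) : adj T = hadj T.
Proof. by []. Qed.

Section Two.
Variables H K : hilbert R.
Implicit Types (S T : H -> K).

Lemma blinD T x y : blin T -> T (x + y) = T x + T y.
Proof. by case=> lT _; have := lT 1 x y; rewrite !scale1r. Qed.
Lemma blin0 T : blin T -> T 0 = 0.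
Proof. by case=> lT _; have := lT (-1) 0 0; rewrite scaler0 addr0 scaleN1r addNr. Qed.
Lemma blinZ T c x : blin T -> T (c *: x) = c *: T x.
Proof. by move=> bT; have := bT.1 c x 0; rewrite (blin0 bT) !addr0. Qed.
Lemma blinN T x : blin T -> T (- x) = - T x.
Proof. by move=> bT; rewrite -scaleN1r blinZ // scaleN1r. Qed.
Lemma blinB T x y : blin T -> T (x - y) = T x - T y.
Proof. by move=> bT; rewrite blinD // blinN. Qed.
Lemma blin_sum T I (r : seq I) (P : pred I) (F : I -> H) : blin T ->
  T (\sum_(i <- r | P i) F i) = \sum_(i <- r | P i) T (F i).
Proof.
by move=> bT; exact: (big_morph T (fun x y => blinD x y bT) (blin0 bT)).
Qed.

Lemma hadj_uniq T (S : K -> H) :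
  (forall x y, inner (T x) y = inner x (S y)) -> hadj T = S.
Proof.
move=> h; apply/funext => y; rewrite /hadj; case: xgetP => [z _ hz|/(_ (S y))].
  by apply: inner_eqr => x; rewrite -h hz.
by case=> x; rewrite h.
Qed.

Lemma hadjP T : blin T -> forall x y, inner (T x) y = inner x (hadj T y).
Proof.
move=> bT x y; rewrite /hadj; case: xgetP => [z _ -> //|].
have cT : closed_subspace (setT : set H) by split.
have [|z _ hz] := @riesz_subspace R H setT (fun x => inner (T x) y) cT.
  split=> [c u v|]; first by rewrite bT.1 innerDl innerZl.
  case: bT => _ [M M0 hM]; exists (M * nrm y); first by rewrite mulr_ge0 ?nrm_ge0.
  move=> u; apply: le_trans (cauchy_schwarz _ _) _.
  by rewrite mulrAC ler_wpM2r ?nrm_ge0.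
move/(_ z); case=> u; exact: hz.
Qed.

(** [nrm (hadj T y) ^+ 2] is the real part of [<T (hadj T y), y>]; Cauchy-Schwarz applies and
    [nrm (hadj T y)] is divided out. *)
Lemma hadj_bound T (M : R) : 0 <= M -> blin T -> (forall x, nrm (T x) <= M * nrm x) ->
  forall y, nrm (hadj T y) <= M * nrm y.
Proof.
move=> M0 bT hM y; have [->|z0] := eqVneq (nrm (hadj T y)) 0.
  by rewrite mulr_ge0 ?nrm_ge0.
have n0 : 0 < nrm (hadj T y) by rewrite lt_neqAle eq_sym z0 nrm_ge0.
rewrite -(ler_pM2l n0) -expr2 nrm_sqrE -hadjP //.
apply: le_trans (ler_norm _) _; apply: le_trans (Re_le_nrm _) _.
apply: le_trans (cauchy_schwarz _ _) _.
by rewrite mulrA ler_wpM2r ?nrm_ge0 // mulrC hM.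
Qed.

Lemma blin_hadj T : blin T -> blin (hadj T).
Proof.
move=> bT; split=> [c x y|].
  apply: inner_eqr => z; rewrite -hadjP // !innerDr !innerZr.
  by rewrite -!hadjP.
by case: (bT) => _ [M M0 hM]; exists M => //; exact: hadj_bound.
Qed.

Lemma hadjPr T : blin T -> forall x y, inner x (T y) = inner (hadj T x) y.
Proof. by move=> bT x y; rewrite -inner_conj hadjP // inner_conj. Qed.

Lemma blin_ext (D : set H) S T : dense D -> blin S -> blin T ->
  (forall x, D x -> S x = T x) -> S = T.
Proof.
move=> /denseP dD bS bT h; apply/funext => x; apply/eqP; rewrite -subr_eq0.
apply/eqP/nrm_lt_all => e e0.
case: (bS) => _ [M M0 hM]; case: (bT) => _ [N N0 hN].
have [|y Dy xy] := dD x (e / (M + N + 1)); first by rewrite divr_gt0 // ltr_wpDl ?addr_ge0.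
rewrite ltr_pdivlMr ?ltr_wpDl ?addr_ge0 // in xy.
have -> : S x - T x = S (x - y) - T (x - y).
  by rewrite !blinB // (h y Dy) opprB addrA subrK.
apply: le_lt_trans xy; apply: le_trans (ler_nrmB _ _) _.
have := hM (x - y); have := hN (x - y); have := nrm_ge0 (x - y); nra.
Qed.

End Two.

Lemma hadjK (H K : hilbert R) (T : H -> K) : blin T -> hadj (hadj T) = T.
Proof. by move=> bT; apply: hadj_uniq => x y; rewrite hadjPr. Qed.

Lemma blin_id (H : hilbert R) : blin (@id H).
Proof. by split=> //; exists 1 => // x; rewrite mul1r. Qed.

Lemma blin_comp (H K L : hilbert R) (S : K -> L) (T : H -> K) :
  blin S -> blin T -> blin (S \o T).
Proof.
move=> bS bT; split=> [c x y|] /=; first by rewrite bT.1 bS.1.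
case: bS bT => _ [M M0 hM] [_ [N N0 hN]]; exists (M * N); first by rewrite mulr_ge0.
by move=> x /=; apply: le_trans (hM _) _; rewrite -mulrA ler_wpM2l.
Qed.

Lemma hadj_comp (H K L : hilbert R) (S : K -> L) (T : H -> K) :
  blin S -> blin T -> hadj (S \o T) = hadj T \o hadj S.
Proof. by move=> bS bT; apply: hadj_uniq => x y /=; rewrite !hadjP. Qed.

Lemma blin_lin (H K : hilbert R) c (S T : H -> K) :
  blin S -> blin T -> blin (c *: S + T).
Proof.
move=> bS bT; split=> [d x y|].
  rewrite !fctE /= bS.1 bT.1 !scalerDr !scalerA (mulrC c d) -!addrA.
  by congr (_ + _); rewrite addrCA.
case: bS bT => _ [M M0 hM] [_ [N N0 hN]].
exists (nrm c * M + N); first by rewrite addr_ge0 ?mulr_ge0 ?nrm_ge0.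
move=> x; rewrite !fctE; apply: le_trans (ler_nrmD _ _) _.
by rewrite nrmZ mulrDl lerD // -mulrA ler_wpM2l ?nrm_ge0.
Qed.

Lemma blin_0 (H K : hilbert R) : blin (0 : H -> K).
Proof.
split=> [c x y|]; first by change ((0 : K) = c *: 0 + 0); rewrite scaler0 addr0.
by exists 0 => // x; change (nrm (0 : K) <= 0 * nrm x); rewrite nrm0 mul0r.
Qed.

Lemma blin_D (H K : hilbert R) (S T : H -> K) : blin S -> blin T -> blin (S + T).
Proof. by move=> bS bT; rewrite -[S]scale1r; exact: blin_lin. Qed.

Lemma blin_Z (H K : hilbert R) c (S : H -> K) : blin S -> blin (c *: S).
Proof. by move=> bS; rewrite -[_ *: _]addr0; apply: blin_lin => //; exact: blin_0. Qed.

Lemma blin_B (H K : hilbert R) (S T : H -> K) : blin S -> blin T -> blin (S - T).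
Proof. by move=> bS bT; rewrite addrC -scaleN1r; exact: blin_lin. Qed.

Lemma blin_bigsum (H K : hilbert R) I (r : seq I) (P : pred I) (F : I -> H -> K) :
  (forall i, P i -> blin (F i)) -> blin (\sum_(i <- r | P i) F i).
Proof.
by move=> h; apply: big_ind => //; [exact: blin_0 | exact: blin_D].
Qed.

Lemma hadj_lin (H K : hilbert R) c (S T : H -> K) : blin S -> blin T ->
  hadj (c *: S + T) = Num.conj c *: hadj S + hadj T.
Proof.
move=> bS bT; apply: hadj_uniq => x y; rewrite !fctE.
by rewrite innerDl innerZl innerDr innerZr conjCK !hadjP.
Qed.

End BoundedMaps.

Section OperatorNorm.
Variables (R : realType) (H : hilbert R).
Local Notation C := R[i].
Implicit Types (S T X Y : H -> H).

Lemma opnorm_has_sup T : blin T ->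
  has_sup [set complex.Re `|T x| | x in [set x : H | `|x| <= 1]].
Proof.
move=> [_ [M M0 hM]]; split.
  by exists (complex.Re `|T 0|), 0 => //=; rewrite normr0.
exists M => _ /= [x x1 <-]; apply: le_trans (hM x) _.
by rewrite -[leRHS]mulr1 ler_wpM2l // -lecR -nrmE.
Qed.

Lemma opnorm_ge0 T : blin T -> 0 <= opnorm T.
Proof.
move=> bT; apply: le_trans (sup_ubound (opnorm_has_sup bT).2 _).
  exact: (nrm_ge0 (T 0)).
by exists 0 => //=; rewrite normr0.
Qed.

Lemma opnormP T x : blin T -> nrm (T x) <= opnorm T * nrm x.
Proof.
move=> bT; have [x0|x0] := eqVneq (nrm x) 0.
  by rewrite (nrm_eq0 x0) (blin0 bT) !nrm0 mulr0.
have n0 : 0 < nrm x by rewrite lt_neqAle eq_sym x0 nrm_ge0.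
rewrite -ler_pdivrMr // mulrC.
have -> : (nrm x)^-1 * nrm (T x) = nrm (T ((nrm x)^-1%:C *: x)).
  by rewrite blinZ // nrmZ nrm_real ger0_norm // invr_ge0 nrm_ge0.
apply: (sup_ubound (opnorm_has_sup bT).2); eexists; last reflexivity.
by rewrite /= nrmE nrmZ nrm_real ger0_norm ?invr_ge0 ?nrm_ge0 // mulVf // lecR.
Qed.

Lemma opnorm_le T (M : R) : 0 <= M -> (forall x, nrm (T x) <= M * nrm x) ->
  opnorm T <= M.
Proof.
move=> M0 hM; apply: ge_sup.
  by exists (complex.Re `|T 0|), 0 => //=; rewrite normr0.
move=> _ /= [x x1 <-]; apply: le_trans (hM x) _.
by rewrite ler_piMr // -lecR -nrmE.
Qed.

(** Replaces [opnorm (X - Y) <= e]: a pointwise bound passes through sums, composites and adjoints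
    without handling a supremum. *)
Definition near_op (e : R) X Y := forall x, nrm (X x - Y x) <= e * nrm x.

Lemma opnorm_near e X Y : blin X -> blin Y -> opnorm (X - Y) < e -> near_op e X Y.
Proof.
move=> bX bY h x; apply: le_trans (opnormP x (blin_B bX bY)) _.
by rewrite ler_wpM2r ?nrm_ge0 // ltW.
Qed.

Lemma near_opnorm e X Y : 0 <= e -> near_op e X Y -> opnorm (X - Y) <= e.
Proof. exact: opnorm_le. Qed.

Lemma near_op_sym e X Y : near_op e X Y -> near_op e Y X.
Proof. by move=> h x; rewrite nrmC. Qed.

Lemma near_op_trans e e' X Y Z : near_op e X Y -> near_op e' Y Z ->
  near_op (e + e') X Z.
Proof.
move=> h h' x; apply: le_trans (nrm_triangle (Y x) _ _) _.
by rewrite mulrDl lerD.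
Qed.

Lemma near_op_eq X Y : (forall e : R, 0 < e -> near_op e X Y) -> X = Y.
Proof.
move=> h; apply/funext => x; apply/eqP; rewrite -subr_eq0.
apply/eqP/nrm_lt_all => e e0.
have p0 : 0 < nrm x + 1 by rewrite ltr_wpDl ?nrm_ge0.
apply: le_lt_trans (h (e / (nrm x + 1)) _ x) _; first by rewrite divr_gt0.
by rewrite mulrAC ltr_pdivrMr // ltr_pM2l // ltrDl.
Qed.

Lemma near_op_adj e X Y : 0 <= e -> blin X -> blin Y -> near_op e X Y ->
  near_op e (hadj X) (hadj Y).
Proof.
move=> e0 bX bY h x.
have -> : hadj X x - hadj Y x = hadj (X - Y) x.
  apply: inner_eqr => z; rewrite innerBr -!hadjP //; last exact: blin_B.
  by rewrite !fctE innerBl.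
by apply: hadj_bound => //; exact: blin_B.
Qed.

Lemma near_op_comp e X X' Y (M : R) : blin X -> 0 <= M ->
  (forall x, nrm (X x) <= M * nrm x) -> near_op e Y X' ->
  near_op (M * e) (X \o Y) (X \o X').
Proof.
move=> bX M0 hM h x /=; rewrite -blinB //; apply: le_trans (hM _) _.
by rewrite -mulrA ler_wpM2l.
Qed.

Variable S : set (H -> H).
Hypothesis bS : forall X, S X -> blin X.

Lemma norm_closureP T : norm_closure S T <->
  blin T /\ forall e : R, 0 < e -> exists2 X, S X & near_op e T X.
Proof.
split=> [[/bounded_opP bT h]|[bT h]]; split=> //; try exact/bounded_opP.
  by move=> e /h[X SX hX]; exists X => //; apply: opnorm_near => //; exact: bS.
move=> e e0; have [|X SX hX] := h (e / 2); first lra.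
by exists X => //; apply: le_lt_trans (near_opnorm _ hX) _; lra.
Qed.

Lemma norm_closure_blin T : norm_closure S T -> blin T.
Proof. by case/norm_closureP. Qed.

Lemma sub_norm_closure T : S T -> norm_closure S T.
Proof.
move=> ST; apply/norm_closureP; split=> [|e e0]; first exact: bS.
by exists T => // x; rewrite subrr nrm0 mulr_ge0 ?nrm_ge0 ?ltW.
Qed.

Lemma norm_closure_closed T : blin T ->
  (forall e : R, 0 < e -> exists2 X, norm_closure S X & near_op e T X) ->
  norm_closure S T.
Proof.
move=> bT h; apply/norm_closureP; split=> // e e0.
have e2 : 0 < e / 2 by lra.
have [X /norm_closureP[bX /(_ _ e2)[Y SY XY]] TX] := h _ e2.
exists Y => //; have -> : e = e / 2 + e / 2 by lra.
exact: near_op_trans TX XY.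
Qed.

Lemma norm_closure_lin :
  (forall c X Y, S X -> S Y -> S (c *: X + Y)) ->
  forall c X Y, norm_closure S X -> norm_closure S Y -> norm_closure S (c *: X + Y).
Proof.
move=> hS c X Y /norm_closureP[bX hX] /norm_closureP[bY hY].
apply/norm_closureP; split=> [|e e0]; first exact: blin_lin.
have q0 : 0 < nrm c + 1 by rewrite ltr_wpDl ?nrm_ge0.
have e1 : 0 < e / (nrm c + 1) by rewrite divr_gt0.
have [X' SX' hX'] := hX _ (divr_gt0 e1 (ltr0n R 2)).
have [|Y' SY' hY'] := hY (e / 2); first lra.
exists (c *: X' + Y'); first exact: hS.
move=> x; rewrite !fctE opprD addrACA -scalerBr; apply: le_trans (ler_nrmD _ _) _.
rewrite nrmZ; have := hX' x; have := hY' x.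
move=> h2 h1; have : nrm c * nrm (X x - X' x) <= e / 2 * nrm x.
  apply: le_trans (ler_wpM2l (nrm_ge0 c) h1) _.
  have h5 : nrm c / (nrm c + 1) <= 1 by rewrite ler_pdivrMr // mul1r lerDl.
  rewrite (_ : nrm c * (_ * nrm x) = nrm c / (nrm c + 1) * (e / 2 * nrm x)); last by ring.
  by rewrite ler_piMl // !mulr_ge0 ?nrm_ge0 ?invr_ge0 // ltW.
lra.
Qed.

Lemma norm_closure_comp :
  (forall X Y, S X -> S Y -> S (X \o Y)) ->
  forall X Y, norm_closure S X -> norm_closure S Y -> norm_closure S (X \o Y).
Proof.
move=> hS X Y hX hY; have bX := norm_closure_blin hX; have bY := norm_closure_blin hY.
move: hX hY => /norm_closureP[_ hX] /norm_closureP[_ hY].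
case: (bX) => _ [M M0 hM]; case: (bY) => _ [N N0 hN].
apply/norm_closureP; split=> [|e e0]; first exact: blin_comp.
(* [Y] contributes [M * e'] and [X] contributes [min e' 1 * (N + e')], at most [e' * (N + 1)]; the
   cap at 1 makes the second error linear in [e']. *)
pose e' := e / (M + N + 1 + 1).
have q0 : 0 < M + N + 1 + 1 by rewrite -addrA ltr_wpDl ?addr_ge0.
have e'0 : 0 < e' by rewrite divr_gt0.
have [X' SX' hX'] := hX (Num.min e' 1) (ltac:(by rewrite lt_min e'0 ltr01)).
have [Y' SY' hY'] := hY e' e'0.
exists (X' \o Y'); first exact: hS.
have eE : e = e' * (M + N + 1 + 1) by rewrite /e' mulfVK // gt_eqF.
move=> x /=; rewrite (_ : _ - _ = X (Y x - Y' x) + (X (Y' x) - X' (Y' x))); last first.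
  by rewrite (blinB _ _ bX) subrKA.
apply: le_trans (ler_nrmD _ _) _.
have h1 := le_trans (hM (Y x - Y' x)) (ler_wpM2l M0 (hY' x)).
have h2 := hX' (Y' x).
have h3 : Num.min e' 1 * nrm (Y' x) <= e' * (N + 1) * nrm x.
  have h4 : nrm (Y' x) <= (N + e') * nrm x.
    rewrite -[Y' x](subKr (Y x)); apply: le_trans (ler_nrmB _ _) _.
    by rewrite mulrDl lerD.
  apply: (@le_trans _ _ (Num.min e' 1 * ((N + e') * nrm x))).
    by rewrite ler_wpM2l // le_min ltW // ler01.
  rewrite mulrA ler_wpM2r ?nrm_ge0 //.
  case: (leP e' 1) => [h|/ltW h].
    by apply: ler_wpM2l; [exact: ltW | rewrite lerD2l].
  by rewrite mul1r mulrDr mulr1 lerD2r ler_peMl.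
rewrite eE; have := nrm_ge0 x; nra.
Qed.

Lemma norm_closure_adj :
  (forall X, S X -> S (hadj X)) ->
  forall X, norm_closure S X -> norm_closure S (hadj X).
Proof.
move=> hS X /norm_closureP[bX hX]; apply/norm_closureP; split=> [|e e0].
  exact: blin_hadj.
have [Y SY XY] := hX e e0; exists (hadj Y); first exact: hS.
by apply: near_op_adj => //; [exact: ltW | exact: bS].
Qed.

End OperatorNorm.

(** * Orthogonal projections and orthonormal families *)

Section Projection.
Variables (R : realType) (H : hilbert R) (M : set H).
Hypothesis hM : closed_subspace M.
Local Notation C := R[i].

Definition proj (y : H) : H :=
  xget 0 [set z | M z /\ forall x, M x -> inner x y = inner x z].

Lemma projP y : M (proj y) /\ forall x, M x -> inner x y = inner x (proj y).
Proof.
rewrite /proj; case: xgetP => [z _ //|].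
have [|z Mz hz] := @riesz_subspace R H M (fun x => inner x y) hM.
  split=> [c u v|]; first by rewrite innerDl innerZl.
  by exists (nrm y) => [|x]; rewrite ?nrm_ge0 // mulrC cauchy_schwarz.
by move/(_ z); case; split.
Qed.

Lemma proj_uniq y z : M z -> (forall x, M x -> inner x y = inner x z) -> proj y = z.
Proof.
move=> Mz hz; have [Mp hp] := projP y; apply/eqP; rewrite -subr_eq0; apply/eqP.
have Md : M (proj y - z).
  by case: hM => _ /(_ (-1) _ _ Mz Mp); rewrite scaleN1r addrC.
by apply: inner_eq0; rewrite innerBr -hp // hz // subrr.
Qed.

Lemma proj_sym x y : inner (proj x) y = inner x (proj y).
Proof.
rewrite (projP y).2; last exact: (projP x).1.
by rewrite -inner_conj -(projP x).2 ?inner_conj //; exact: (projP y).1.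
Qed.

Lemma proj_id x : M x -> proj x = x.
Proof. by move=> Mx; apply: proj_uniq. Qed.

Lemma nrm_proj_le x : nrm (proj x) <= nrm x.
Proof.
have [->|x0] := eqVneq (nrm (proj x)) 0; first exact: nrm_ge0.
have n0 : 0 < nrm (proj x) by rewrite lt_neqAle eq_sym x0 nrm_ge0.
rewrite -(ler_pM2l n0) -expr2 nrm_sqrE -(projP x).2; last exact: (projP x).1.
apply: le_trans (ler_norm _) _; apply: le_trans (Re_le_nrm _) _.
exact: cauchy_schwarz.
Qed.

Lemma blin_proj : blin proj.
Proof.
split=> [c x y|].
  apply: proj_uniq; first by case: hM => _ h _; apply: h; apply: (projP _).1.
  move=> z Mz; rewrite !innerDr !innerZr.
  by rewrite -!(projP _).2.
by exists 1 => // x; rewrite mul1r nrm_proj_le.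
Qed.

Lemma nrm_proj_best x y : M y -> nrm (x - proj x) <= nrm (x - y).
Proof.
move=> My; rewrite -ler_sqr ?nnegrE ?nrm_ge0 //.
rewrite (_ : x - y = (x - proj x) + (proj x - y)); last by rewrite addrA subrK.
rewrite [leRHS]nrmD_sqr.
have -> : inner (x - proj x) (proj x - y) = 0.
  rewrite -inner_conj innerBr (projP x).2 ?subrr ?conjC0 //.
  by case: hM => _ /(_ (-1) _ _ My (projP x).1); rewrite scaleN1r addrC.
by rewrite /= mulr0 addr0 lerDl sqr_ge0.
Qed.

End Projection.

Section GramSchmidt.
Variables (R : realType) (H : hilbert R).
Local Notation C := R[i].

Definition orthonormal_family (n : nat) (e : nat -> H) :=
  forall i j, (i < n)%N -> (j < n)%N -> inner (e i) (e j) = (i == j)%:R.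

Lemma orthonormal_inner n e (c : nat -> C) j : orthonormal_family n e -> (j < n)%N ->
  inner (\sum_(i < n) c i *: e i) (e j) = c j.
Proof.
move=> he jn; rewrite inner_suml (bigD1 (Ordinal jn)) //= innerZl he // eqxx mulr1.
rewrite big1 ?addr0 // => i; rewrite -val_eqE /= => ij.
by rewrite innerZl he // (negbTE ij) mulr0.
Qed.

Lemma bessel_residue n e x : orthonormal_family n e ->
  nrm (x - \sum_(i < n) inner x (e i) *: e i) <= nrm x.
Proof.
move=> he; set p := \sum_(i < n) _.
have op : inner (x - p) p = 0.
  rewrite {2}/p inner_sumr big1 // => i _; rewrite innerZr innerBl.
  by rewrite (orthonormal_inner (fun i => inner x (e i))) // subrr mulr0.
rewrite -ler_sqr ?nnegrE ?nrm_ge0 //.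
rewrite -[X in _ <= nrm X ^+ 2](subrK p) (nrmD_sqr (x - p)) op /= mulr0 addr0.
by rewrite lerDl sqr_ge0.
Qed.

(** The orthonormal vectors stay in a subspace [D] that need not be closed: [D] will be
    [range Lambda]. The sequence [e] is total on [nat], but only its first [n] terms are
    orthonormal. *)
Lemma gram_schmidt (D : set H) (s : seq H) :
  (forall c x y, D x -> D y -> D (c *: x + y)) -> D 0 ->
  (forall x, x \in s -> D x) ->
  exists (n : nat) (e : nat -> H), [/\ forall i, D (e i), orthonormal_family n e
    & forall x, x \in s -> x = \sum_(i < n) inner x (e i) *: e i].
Proof.
move=> hD D0; elim: s => [_|x s ih hs].
  by exists 0%N, (fun=> 0).
have /ih[n [e [De oe he]]] : forall y, y \in s -> D y.
  by move=> y ys; apply: hs; rewrite inE ys orbT.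
have Dsum (c : nat -> C) m : D (\sum_(i < m) c i *: e i).
  elim: m => [|m ihm]; first by rewrite big_ord0.
  by rewrite big_ord_recr /= addrC; exact: hD.
pose r := x - \sum_(i < n) inner x (e i) *: e i.
have Dr : D r.
  rewrite /r addrC -scaleN1r; apply: hD; first exact: (Dsum (fun i => inner x (e i))).
  by apply: hs; rewrite inE eqxx.
have [r0|r0] := eqVneq r 0.
  exists n, e; split=> // y; rewrite inE => /orP[/eqP ->|/he //].
  by apply/eqP; rewrite -subr_eq0 -/r r0.
have nr : nrm r != 0 by apply: contra_neq r0; exact: nrm_eq0.
pose u := (nrm r)^-1%:C *: r.
have ur j : (j < n)%N -> inner u (e j) = 0.
  move=> jn; rewrite /u innerZl innerBl.
  by rewrite (orthonormal_inner (fun i => inner x (e i))) // subrr mulr0.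
have uu : inner u u = 1.
  rewrite innerxx nrmZ nrm_real ger0_norm ?invr_ge0 ?nrm_ge0 //.
  by rewrite mulVf // expr1n.
pose e' i := if (i < n)%N then e i else u.
have oe' : orthonormal_family n.+1 e'.
  move=> i j; rewrite !ltnS /e' => hi hj.
  have [i1|i1] := ltnP i n; have [j1|j1] := ltnP j n.
  - exact: oe.
  - by rewrite -inner_conj ur // conjC0; case: eqP => // ij; move: i1; rewrite ij ltnNge j1.
  - by rewrite ur //; case: eqP => // ij; move: j1; rewrite -ij ltnNge i1.
  - by rewrite uu (_ : i = j) ?eqxx //; apply/eqP; rewrite eqn_leq (leq_trans hi) ?(leq_trans hj).
have sumE y : \sum_(i < n.+1) inner y (e' i) *: e' i =
    \sum_(i < n) inner y (e i) *: e i + inner y u *: u.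
  rewrite big_ord_recr /=; congr (_ + _); last by rewrite /e' ltnn.
  by apply: eq_bigr => i _; rewrite /e' ltn_ord.
exists n.+1, e'; split=> // [i|y].
  by rewrite /e'; case: ifP => // _; rewrite /u -[_ *: r]addr0; exact: hD.
rewrite inE => /orP[/eqP ->|ys]; rewrite sumE.
  have xE : x = r + \sum_(i < n) inner x (e i) *: e i by rewrite subrK.
  rewrite {1}xE addrC; congr (_ + _).
  have -> : inner x u = inner r u.
    rewrite [in LHS]xE innerDl -[RHS]addr0; congr (_ + _).
    rewrite inner_suml big1 // => i _.
    by rewrite innerZl -[inner (e i) u]inner_conj ur // conjC0 mulr0.
  rewrite /u innerZr innerxx conjCE conjc_real scalerA -!rmorphM /=.
  rewrite -[LHS]scale1r; congr (_ *: _); rewrite -[LHS](rmorph1 (real_complex R)).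
  by congr (_%:C); field.
have -> : inner y u = 0.
  rewrite (he y ys) inner_suml big1 // => i _.
  by rewrite innerZl -[inner (e i) u]inner_conj ur // conjC0 mulr0.
by rewrite scale0r addr0; exact: he.
Qed.

End GramSchmidt.

(** * Convolution on the algebraic tensor product *)

Section TensorTheory.
Variable K : fieldType.

Lemma tlift_paramP (U V : lmodType K) (W : lmodType K) (B B1 B2 : U -> V -> W) c y :
  (forall u v, B u v = c *: B1 u v + B2 u v) ->
  tlift B y = c *: tlift B1 y + tlift B2 y.
Proof.
move=> h; rewrite /tlift /tsum scaler_sumr -big_split /=.
by apply: eq_bigr => p _; rewrite h.
Qed.

Lemma linearPP (U W : lmodType K) (L : U -> W) : linear L ->
  forall c x y, L (c *: x + y) = c *: L x + L y.
Proof. by []. Qed.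

Lemma linearZZ (U W : lmodType K) (L : U -> W) c x : linear L -> L (c *: x) = c *: L x.
Proof.
move=> lL; have L0 : L 0 = 0.
  by have := linearPP lL (-1) 0 0; rewrite scaler0 addr0 scaleN1r addNr.
by have := linearPP lL c x 0; rewrite !addr0 L0 addr0.
Qed.

Lemma linear_sum_fun (U W : lmodType K) (L : U -> W) I (r : seq I) (F : I -> U) :
  linear L -> L (\sum_(i <- r) F i) = \sum_(i <- r) L (F i).
Proof.
move=> lL; have L0 : L 0 = 0.
  by have := linearPP lL (-1) 0 0; rewrite scaler0 addr0 scaleN1r addNr.
apply: (big_morph L) => // x y.
by have := linearPP lL 1 x y; rewrite !scale1r.
Qed.

Lemma linear_comp_fun (U V W : lmodType K) (L : V -> W) (M : U -> V) :
  linear L -> linear M -> linear (fun x => L (M x)).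
Proof. by move=> lL lM c x y; rewrite (linearPP lM) (linearPP lL). Qed.

Section Ext.
Variables U V W : lmodType K.

(** Every tensor is a finite sum of elementary ones; the tensor identities below are reduced to
    elementary tensors in this way, one tensor factor after the other. *)
Lemma tensor_lin_ext (L M : tensor U V -> W) : linear L -> linear M ->
  (forall u v, L (tens u v) = M (tens u v)) -> L =1 M.
Proof.
move=> lL lM h x; rewrite [x]tensE !linear_sum_fun //.
by apply: eq_bigr => p _; exact: h.
Qed.

Lemma tlift_sum (B : U -> V -> W) x :
  tlift B x = \sum_(p <- repr x) B p.1 p.2.
Proof. by []. Qed.

Lemma linear_tlift (B : U -> V -> W) : is_bilinear B -> linear (tlift B).
Proof. by move=> bB c x y; exact: tlift_linear. Qed.

End Ext.

Lemma bilinear_tens (U V U' V' : lmodType K) (g : U -> U') (h : V -> V') :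
  linear g -> linear h -> is_bilinear (fun u v => tens (g u) (h v)).
Proof.
move=> lg lh; split=> [v|u] c x y.
  by rewrite (linearPP lg); exact: (tens_bilinear U' V').1.
by rewrite (linearPP lh); exact: (tens_bilinear U' V').2.
Qed.

Lemma tmap_tens (U V U' V' : lmodType K) (g : U -> U') (h : V -> V') u v :
  linear g -> linear h -> tmap g h (tens u v) = tens (g u) (h v).
Proof. by move=> lg lh; rewrite /tmap tlift_tens //; exact: bilinear_tens. Qed.

Lemma linear_tmap (U V U' V' : lmodType K) (g : U -> U') (h : V -> V') :
  linear g -> linear h -> linear (tmap g h).
Proof. by move=> lg lh; apply: linear_tlift; exact: bilinear_tens. Qed.

Lemma bilinear_flip (U V : lmodType K) :
  is_bilinear (fun (u : U) (v : V) => tens v u).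
Proof.
by split=> [v|u] c x y; [exact: (tens_bilinear V U).2 | exact: (tens_bilinear V U).1].
Qed.

Lemma linear_tflip (U V : lmodType K) : linear (@tflip K U V).
Proof. exact/linear_tlift/bilinear_flip. Qed.

Lemma tflip_tens (U V : lmodType K) (u : U) (v : V) : tflip (tens u v) = tens v u.
Proof. exact/tlift_tens/bilinear_flip. Qed.

Lemma tflipK (U V : lmodType K) : cancel (@tflip K U V) (@tflip K V U).
Proof.
apply: tensor_lin_ext => [||u v]; rewrite ?tflip_tens //.
by apply: linear_comp_fun; exact: linear_tflip.
Qed.

Lemma tlift_flip (U V W : lmodType K) (B : U -> V -> W) x :
  is_bilinear B -> tlift (fun v u => B u v) (tflip x) = tlift B x.
Proof.
move=> bB; have bB' : is_bilinear (fun v u => B u v) by split; apply bB.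
move: x; apply: tensor_lin_ext => [||u v].
- by apply: linear_comp_fun; [exact: linear_tlift | exact: linear_tflip].
- exact: linear_tlift.
- by rewrite tflip_tens !tlift_tens.
Qed.

Lemma bilinear_comp (U V W W' : lmodType K) (L : W -> W') (B : U -> V -> W) :
  linear L -> is_bilinear B -> is_bilinear (fun u v => L (B u v)).
Proof.
move=> lL [b1 b2]; split=> [v|u] c x y.
  by rewrite (linearPP (b1 v)) (linearPP lL).
by rewrite (linearPP (b2 u)) (linearPP lL).
Qed.

Lemma tlift_comp (U V W W' : lmodType K) (L : W -> W') (B : U -> V -> W) x :
  linear L -> is_bilinear B -> L (tlift B x) = tlift (fun u v => L (B u v)) x.
Proof.
move=> lL bB; move: x; apply: tensor_lin_ext => [||u v].
- by apply: linear_comp_fun => //; exact: linear_tlift.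
- exact/linear_tlift/bilinear_comp.
- by rewrite !tlift_tens //; exact: bilinear_comp.
Qed.

Lemma bilinear_tassoc_inner (U V W : lmodType K) (w : W) :
  is_bilinear (fun (u : U) (v : V) => tens u (tens v w)).
Proof.
split=> [v|u] c x y; first exact: (tens_bilinear _ _).1.
by rewrite (linearPP ((tens_bilinear V W).1 w)); exact: (tens_bilinear _ _).2.
Qed.

Lemma bilinear_tassoc (U V W : lmodType K) :
  is_bilinear (fun (x : tensor U V) (w : W) => tlift (fun u v => tens u (tens v w)) x).
Proof.
split=> [w|x] c y z; first exact/linear_tlift/bilinear_tassoc_inner.
apply: tlift_paramP => u v.
by rewrite (linearPP ((tens_bilinear V W).2 v)) (linearPP ((tens_bilinear _ _).2 u)).
Qed.

Lemma linear_tassoc (U V W : lmodType K) : linear (@tassoc K U V W).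
Proof. exact/linear_tlift/bilinear_tassoc. Qed.

Lemma tassoc_tens (U V W : lmodType K) (u : U) (v : V) (w : W) :
  tassoc (tens (tens u v) w) = tens u (tens v w).
Proof.
rewrite /tassoc tlift_tens; last exact: bilinear_tassoc.
exact/tlift_tens/bilinear_tassoc_inner.
Qed.

Section TMul.
Variables A B : algType K.

Lemma bilinear_tmul_inner (a : A) (b : B) :
  is_bilinear (fun a' b' => tens (a * a') (b * b')).
Proof. by apply: bilinear_tens => c x y; rewrite mulrDr -scalerAr. Qed.

Lemma bilinear_tmul_outer (y : tensor A B) :
  is_bilinear (fun a b => tlift (fun a' b' => tens (a * a') (b * b')) y).
Proof.
split=> [b|a] c x x'; apply: tlift_paramP => u v; rewrite mulrDl -scalerAl.
  exact: (tens_bilinear A B).1.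
exact: (tens_bilinear A B).2.
Qed.

Lemma linear_tmull (y : tensor A B) : linear (fun x => tmul x y).
Proof. exact/linear_tlift/bilinear_tmul_outer. Qed.

Lemma linear_tmulr (x : tensor A B) : linear (tmul x).
Proof.
move=> c y z; apply: tlift_paramP => a b.
exact: (linear_tlift (bilinear_tmul_inner a b)).
Qed.

Lemma tmul_tens (a a' : A) (b b' : B) :
  tmul (tens a b) (tens a' b') = tens (a * a') (b * b').
Proof.
rewrite /tmul tlift_tens; last exact: bilinear_tmul_outer.
exact/tlift_tens/bilinear_tmul_inner.
Qed.

End TMul.

Lemma tflip_tmul (A B : algType K) (x y : tensor A B) :
  tflip (tmul x y) = tmul (tflip x) (tflip y).
Proof.
move: x; apply: tensor_lin_ext => [||a b].
- by apply: linear_comp_fun; [exact: linear_tflip | exact: linear_tmull].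
- by apply: (linear_comp_fun (linear_tmull _)); exact: linear_tflip.
move: y; apply: tensor_lin_ext => [||a' b'].
- by apply: linear_comp_fun; [exact: linear_tflip | exact: linear_tmulr].
- by apply: (linear_comp_fun (linear_tmulr _)); exact: linear_tflip.
by rewrite tmul_tens !tflip_tens tmul_tens.
Qed.

Lemma bilinear_scale_l (U V : lmodType K) (tau : U -> K) :
  linear (tau : U -> K^o) -> is_bilinear (fun u (v : V) => tau u *: v).
Proof.
move=> lt; split=> [v|u] c x y; last by rewrite scalerDr !scalerA mulrC.
have -> : tau (c *: x + y) = c * tau x + tau y by exact: lt.
by rewrite scalerDl scalerA.
Qed.

Lemma bilinear_scale_r (U V : lmodType K) (tau : V -> K) :
  linear (tau : V -> K^o) -> is_bilinear (fun (u : U) v => tau v *: u).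
Proof. by move=> /(bilinear_scale_l U)[h1 h2]; split. Qed.

Lemma bilinear_mul_fun (U V : lmodType K) (s : U -> K) (t : V -> K) :
  linear (s : U -> K^o) -> linear (t : V -> K^o) ->
  is_bilinear (fun u v => s u * t v : K^o).
Proof.
move=> ls lt; split=> [v|u] c x y.
  have -> : s (c *: x + y) = c * s x + s y by exact: ls.
  by rewrite mulrDl -mulrA.
have -> : t (c *: x + y) = c * t x + t y by exact: lt.
by rewrite mulrDr mulrCA.
Qed.

End TensorTheory.

Section Comultiplication.
Variables (R : realType) (A : algType R[i]).
Local Notation C := R[i].

Definition functional (tau : A -> C) : Prop := linear (tau : A -> C^o).

Lemma functional_scalar (tau : {scalar A}) : functional tau.
Proof. by move=> c x y; rewrite linearP. Qed.

(** The convolution product [(s (x) t) Delta] of two functionals. *)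
Definition fmul (Delta : A -> tensor A A) (s t : A -> C) (a : A) : C :=
  tlift (fun b c => s b * t c : C^o) (Delta a).

(* [W^*] maps [Lambda a (x) Lambda b] to the image of [Delta b * (a (x) 1)]. *)
Definition bialgebra (Delta : A -> tensor A A) : Prop :=
  [/\ linear Delta, Delta 1 = tens 1 1,
      forall a b, Delta (a * b) = tmul (Delta a) (Delta b),
      forall a, tassoc (tmap Delta id (Delta a)) = tmap id Delta (Delta a)
    & forall y, exists x, tlift (fun a b => tmul (Delta b) (tens a 1)) x = y].

Section Theory.
Variable Delta : A -> tensor A A.
Hypothesis hD : bialgebra Delta.
Local Notation conv := (conv_r Delta).

Let lD : linear Delta. Proof. by case: hD. Qed.

Lemma bilinear_Tmap : is_bilinear (fun a b => tmul (Delta b) (tens a 1)).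
Proof.
split=> [b|a] c x y.
  by rewrite (linearPP ((tens_bilinear A A).1 1)) (linearPP (linear_tmulr _)).
by rewrite (linearPP lD) (linearPP (linear_tmull _)).
Qed.

Lemma convE a tau : conv a tau = \sum_(p <- repr (Delta a)) tau p.1 *: p.2.
Proof. by []. Qed.

Lemma linear_slice_l (V : lmodType C) tau : functional tau ->
  linear (slice_l tau : tensor A V -> V).
Proof. by move=> lt; apply/linear_tlift/bilinear_scale_l. Qed.

Lemma linear_conv tau : functional tau -> linear (conv^~ tau).
Proof. by move=> lt; apply: linear_comp_fun => //; exact: linear_slice_l. Qed.

Lemma functional_fmul s t : functional s -> functional t -> functional (fmul Delta s t).
Proof.
move=> ls lt; apply: (linear_comp_fun _ lD); exact/linear_tlift/bilinear_mul_fun.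
Qed.

Lemma conv1 tau : functional tau -> tau 1 = 1 -> conv 1 tau = 1.
Proof.
case: hD => _ D1 _ _ _ lt t1; rewrite /conv_r D1 /slice_l tlift_tens ?t1 ?scale1r //.
exact: bilinear_scale_l.
Qed.

Lemma convM tau a b : functional tau -> (forall x y, tau (x * y) = tau x * tau y) ->
  conv (a * b) tau = conv a tau * conv b tau.
Proof.
move=> lt tM; case: hD => _ _ DM _ _; rewrite /conv_r DM.
have lm (x : A) : linear ( *%R x) by move=> c u v; rewrite mulrDr -scalerAr.
have lm' (x : A) : linear (fun y => y * x) by move=> c u v; rewrite mulrDl -scalerAl.
have ls := linear_slice_l (V := A) lt.
move: (Delta a) (Delta b) => x y; move: x; apply: tensor_lin_ext.
- exact: (linear_comp_fun ls (linear_tmull y)).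
- exact: (linear_comp_fun (lm' _) ls).
move=> u v; move: y; apply: tensor_lin_ext.
- exact: (linear_comp_fun ls (linear_tmulr _)).
- exact: (linear_comp_fun (lm _) ls).
move=> u' v'; rewrite tmul_tens /slice_l !tlift_tens; try exact: bilinear_scale_l.
by rewrite tM -scalerAl -scalerAr scalerA.
Qed.

(** Coassociativity sliced by [s] on the first leg and [t] on the second: the functionals act on [A]
    from the right. [L] is this slice on right-nested tensors. *)
Lemma conv_fmul s t a : functional s -> functional t ->
  conv a (fmul Delta s t) = conv (conv a s) t.
Proof.
move=> ls lt.
pose L : tensor A (tensor A A) -> A := slice_l s \o (tmap id (slice_l t)).
have lL : linear L.
  apply: linear_comp_fun; first exact: linear_slice_l.
  by apply: linear_tmap => //; exact: linear_slice_l.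
case: hD => _ _ _ coass _.
have := congr1 L (coass a).
have -> : L (tmap id Delta (Delta a)) = conv (conv a s) t.
  rewrite -[conv (conv a s) t]/(slice_l t (Delta (tlift (fun u v => s u *: v) (Delta a)))).
  rewrite (tlift_comp _ (linear_comp_fun (linear_slice_l (V := A) lt) lD)); last first.
    exact: bilinear_scale_l.
  move: (Delta a); apply: tensor_lin_ext.
  - by apply: (linear_comp_fun lL); exact: linear_tmap.
  - apply: linear_tlift.
    exact: (bilinear_comp (linear_comp_fun (linear_slice_l (V := A) lt) lD) (bilinear_scale_l _ ls)).
  move=> u v; rewrite tmap_tens // tlift_tens; last first.
    exact: (bilinear_comp (linear_comp_fun (linear_slice_l (V := A) lt) lD) (bilinear_scale_l _ ls)).
  rewrite /L /= tmap_tens //; last exact: linear_slice_l.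
  rewrite /slice_l tlift_tens; last exact: bilinear_scale_l.
  by symmetry; exact: (linearZZ (s u) v (linear_comp_fun (linear_slice_l (V := A) lt) lD)).
move=> <-; rewrite /conv_r /slice_l.
have bl : is_bilinear (fun u (v : A) => fmul Delta s t u *: v).
  by apply: bilinear_scale_l; exact: functional_fmul.
move: (Delta a); apply: tensor_lin_ext.
- exact: linear_tlift.
- by apply: (linear_comp_fun lL); apply: (linear_comp_fun (@linear_tassoc _ _ _ _)); exact: linear_tmap.
move=> u v; rewrite tlift_tens // tmap_tens // /fmul.
have lsv : linear (fun x : C^o => x *: v) by move=> c x y; rewrite scalerDl scalerA.
rewrite (tlift_comp _ lsv (bilinear_mul_fun ls lt)).
have bB : is_bilinear (fun a b => (s a * t b : C^o) *: v).
  exact: (bilinear_comp lsv (bilinear_mul_fun ls lt)).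
move: (Delta u); apply: tensor_lin_ext.
- exact: linear_tlift.
- apply: (linear_comp_fun lL); apply: (linear_comp_fun (@linear_tassoc _ _ _ _)).
  exact: (tens_bilinear _ _).1.
move=> x y; rewrite tlift_tens // tassoc_tens /L /= tmap_tens //; last exact: linear_slice_l.
rewrite /slice_l !tlift_tens; try exact: bilinear_scale_l.
by rewrite scalerA.
Qed.

End Theory.

(** The first canonical bijection gives surjectivity for [Delta]; the second one, conjugated by the
    flip, gives it for the opposite coproduct. *)
Lemma bialgebra_flip Delta :
  linear Delta -> Delta 1 = tens 1 1 ->
  (forall a b, Delta (a * b) = tmul (Delta a) (Delta b)) ->
  (forall a, tassoc (tmap Delta id (Delta a)) = tmap id Delta (Delta a)) ->
  bijective (tlift (fun a b => tmul (Delta a) (tens b 1)) : tensor A A -> tensor A A) ->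
  bijective (tlift (fun a b => tmul (Delta a) (tens 1 b)) : tensor A A -> tensor A A) ->
  bialgebra Delta /\ bialgebra (fun a => tflip (Delta a)).
Proof.
move=> lD D1 DM coass [g1 _ g1K] [g2 _ g2K].
have lf := @linear_tflip R[i] A A.
have lD' : linear (fun a => tflip (Delta a)) by exact: linear_comp_fun.
split; split=> //.
- move=> y; exists (tflip (g1 y)); rewrite -[RHS]g1K.
  rewrite (tlift_flip (B := fun a b => tmul (Delta a) (tens b 1))) //.
  split=> [b|a] c u v.
    by rewrite (linearPP lD) (linearPP (linear_tmull _)).
  by rewrite (linearPP ((tens_bilinear A A).1 1)) (linearPP (linear_tmulr _)).
- by rewrite D1 tflip_tens.
- by move=> a b; rewrite DM tflip_tmul.
- move=> a.
  (* Reversal of the three legs: it exchanges the two sides of coassociativity for [Delta] with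
     those for its flip. *)
  pose rev3 : tensor A (tensor A A) -> tensor (tensor A A) A :=
    @tflip _ _ _ \o tmap id (@tflip _ _ _).
  have lr : linear rev3.
    by apply: (linear_comp_fun (@linear_tflip _ _ _)); apply: linear_tmap.
  have lt3 : linear (fun z : tensor (tensor A A) A => tassoc (rev3 (tassoc z))).
    apply: (linear_comp_fun (@linear_tassoc _ _ _ _)).
    exact: (linear_comp_fun lr (@linear_tassoc _ _ _ _)).
  pose D' x := tflip (Delta x).
  have h1 x : tassoc (rev3 (tassoc (tmap Delta id x))) = tmap id D' (tflip x).
    move: x; apply: tensor_lin_ext.
    + by apply: (linear_comp_fun lt3); exact: linear_tmap.
    + by apply: linear_comp_fun => //; exact: linear_tmap.
    move=> u v; rewrite tflip_tens !tmap_tens // /D'.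
    move: (Delta u); apply: tensor_lin_ext.
    + exact: (linear_comp_fun lt3 ((tens_bilinear _ _).1 v)).
    + by apply: linear_comp_fun => //; exact: (tens_bilinear _ _).2.
    by move=> x y; rewrite tassoc_tens /rev3 /= tmap_tens // !tflip_tens tassoc_tens.
  have h2 x : tassoc (rev3 (tmap id Delta x)) = tassoc (tmap D' id (tflip x)).
    congr tassoc; move: x; apply: tensor_lin_ext.
    + by apply: linear_comp_fun => //; exact: linear_tmap.
    + by apply: linear_comp_fun => //; exact: linear_tmap.
    by move=> u v; rewrite tflip_tens !tmap_tens // /rev3 /= tmap_tens // tflip_tens.
  by rewrite -/(D' a) -h2 -coass h1.
- move=> y; exists (tflip (g2 (tflip y))).
  have bB : is_bilinear (fun a b => tmul (Delta a) (tens 1 b)).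
    split=> [b|a] c u v.
      by rewrite (linearPP lD) (linearPP (linear_tmull _)).
    by rewrite (linearPP ((tens_bilinear A A).2 1)) (linearPP (linear_tmulr _)).
  apply: (can_inj (@tflipK _ _ _)); rewrite -[RHS]g2K -[RHS](tlift_flip _ bB).
  rewrite (tlift_comp _ (@linear_tflip _ _ _)); last first.
    split=> [b|a] c u v.
      by rewrite (linearPP ((tens_bilinear A A).1 1)) (linearPP (linear_tmulr _)).
    by rewrite (linearPP lD') (linearPP (linear_tmull _)).
  rewrite /tlift /tsum; apply: eq_bigr => p _.
  by rewrite tflip_tmul tflip_tens tflipK.
Qed.

Section LeftRight.
Variable Delta : A -> tensor A A.
Hypothesis hD : bialgebra Delta.

Let lD : linear Delta. Proof. by case: hD. Qed.

(** Left convolution is right convolution for the opposite coproduct, so the statements on [E_t]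
    become instances of those on [F_t]. *)
Lemma conv_l_flip tau a : functional tau ->
  conv_l Delta tau a = conv_r (fun x => tflip (Delta x)) a tau.
Proof.
move=> lt; rewrite /conv_l /conv_r /slice_l /slice_r.
by rewrite -(tlift_flip _ (bilinear_scale_r _ lt)).
Qed.

Lemma fmul_flip s t a : functional s -> functional t ->
  fmul (fun x => tflip (Delta x)) s t a = fmul Delta t s a.
Proof.
move=> ls lt; rewrite /fmul -(tlift_flip _ (bilinear_mul_fun lt ls)).
by rewrite /tlift /tsum; apply: eq_bigr => p _; rewrite mulrC.
Qed.

Lemma conv_lrE tau a tau' : functional tau -> functional tau' ->
  conv_lr Delta tau a tau' = conv_r Delta (conv_l Delta tau a) tau'.
Proof.
move=> lt lt'; rewrite /conv_lr /conv_l /slice_r.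
rewrite (tlift_comp _ (linear_conv hD lt') (bilinear_scale_r _ lt)).
have bB : is_bilinear (fun x c => tau c *: slice_l tau' x : A).
  have [b1 b2] := @bilinear_scale_r _ A A tau lt.
  split=> [c|x]; last exact: b2.
  by apply: (linear_comp_fun (b1 c)); exact: linear_slice_l.
have bB' := bilinear_comp (linear_conv hD lt') (bilinear_scale_r A lt).
move: (Delta a); apply: tensor_lin_ext.
- by apply: linear_comp_fun; [exact: linear_tlift | exact: linear_tmap].
- exact: linear_tlift.
move=> u v; rewrite tmap_tens // !tlift_tens // /conv_r.
have ls := linear_comp_fun (linear_slice_l (V := A) lt') lD.
by rewrite (linearZZ (tau v) u ls).
Qed.

(** Both sides slice the twofold coproduct by [tau'] on the first leg and [tau] on the last one;
    this is the source of the commutation of [F_t] with [E_t]. *)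
Lemma conv_lr_comm tau a tau' : functional tau -> functional tau' ->
  conv_l Delta tau (conv_r Delta a tau') = conv_r Delta (conv_l Delta tau a) tau'.
Proof.
move=> lt lt'; rewrite -conv_lrE //.
pose L : tensor A (tensor A A) -> A := slice_l tau' \o tmap id (slice_r tau).
have lsr : linear (slice_r tau : tensor A A -> A).
  by apply/linear_tlift/bilinear_scale_r.
have lL : linear L.
  by apply: linear_comp_fun; [exact: linear_slice_l | exact: linear_tmap].
have ll := linear_comp_fun lsr lD.
have -> : conv_l Delta tau (conv_r Delta a tau') = L (tmap id Delta (Delta a)).
  have bB := bilinear_comp ll (bilinear_scale_l A lt').
  rewrite /conv_l /conv_r /slice_l (tlift_comp _ ll (bilinear_scale_l _ lt')).
  move: (Delta a); apply: tensor_lin_ext; first exact: linear_tlift.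
    by apply: (linear_comp_fun lL); exact: linear_tmap.
  move=> u v; rewrite tlift_tens // tmap_tens // /L /= tmap_tens //.
  rewrite /slice_l tlift_tens; last exact: bilinear_scale_l.
  by rewrite (linearZZ (tau' u) v ll).
case: hD => _ _ _ <- _; rewrite /conv_lr.
have bB : is_bilinear (fun x c => tau c *: slice_l tau' x : A).
  have [b1 b2] := @bilinear_scale_r _ A A tau lt.
  split=> [c|x]; last exact: b2.
  by apply: (linear_comp_fun (b1 c)); exact: linear_slice_l.
move: (tmap Delta id (Delta a)); apply: tensor_lin_ext.
- by apply: (linear_comp_fun lL); exact: linear_tassoc.
- exact: linear_tlift.
move=> x v; rewrite tlift_tens //; move: x; apply: tensor_lin_ext.
- apply: (linear_comp_fun lL); apply: (linear_comp_fun (@linear_tassoc _ _ _ _)).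
  exact: (tens_bilinear _ _).1.
- exact: bB.1.
move=> u w; rewrite tassoc_tens /L /= tmap_tens //.
rewrite /slice_l !tlift_tens; try exact: bilinear_scale_l.
rewrite /slice_r tlift_tens; last exact: bilinear_scale_r.
by rewrite !scalerA mulrC.
Qed.

End LeftRight.

End Comultiplication.

(** * Analytic functions on a strip vanishing on the real axis *)

Section RealDerivative.
Variable R : realType.

Lemma continuous_epsP (g : R -> R) (x : R) : {for x, continuous g} <->
  forall e : R, 0 < e -> exists2 d : R, 0 < d &
    forall z, `|z - x| < d -> `|g z - g x| < e.
Proof.
split=> [/cvgrPdist_lt h e e0|h].
  have [/= d d0 hd] := h e e0; exists d => // z zx.
  by rewrite distrC; apply: hd; rewrite /ball /= distrC.
apply/cvgrPdist_lt => e e0; have [d d0 hd] := h e e0.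
by exists d => // z zx; rewrite /= distrC; apply: hd; rewrite distrC.
Qed.

Lemma is_derive_epsP (f : R -> R) (x a : R) : is_derive x 1 f a <->
  forall e : R, 0 < e -> exists2 d : R, 0 < d &
    forall z, `|z - x| < d -> `|f z - f x - a * (z - x)| <= e * `|z - x|.
Proof.
split=> [/is_derive1_caratheodory[g [fg /continuous_epsP cg <-]] e e0|h].
  have [d d0 hd] := cg e e0; exists d => // z zx.
  by rewrite fg -mulrBl normrM ler_wpM2r // ltW // hd.
apply/is_derive1_caratheodory.
exists (fun z => if z == x then a else (f z - f x) / (z - x)); split.
- move=> z; case: eqVneq => [->|zx]; first by rewrite !subrr mulr0.
  by rewrite mulfVK // subr_eq0.
- apply/continuous_epsP => e e0; have [|d d0 hd] := h (e / 2); first lra.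
  exists d => // z zx; rewrite eqxx; case: eqVneq => [_|zx0].
    by rewrite subrr normr0.
  have n0 : 0 < `|z - x| by rewrite normr_gt0 subr_eq0.
  have -> : (f z - f x) / (z - x) - a = (f z - f x - a * (z - x)) / (z - x).
    by field; rewrite subr_eq0.
  rewrite normrM normfV ltr_pdivrMr //; apply: le_lt_trans (hd _ zx) _.
  by rewrite ltr_pM2r //; lra.
- by rewrite eqxx.
Qed.

Lemma is_derive_quadratic (c0 c1 c2 x : R) :
  is_derive x 1 (fun t => c0 + c1 * t + c2 * t ^+ 2) (c1 + 2 * c2 * x).
Proof.
apply/is_derive_epsP => e e0; have q0 : 0 < `|c2| + 1 by rewrite ltr_wpDl.
exists (e / (`|c2| + 1)) => [|z zx]; first by rewrite divr_gt0.
rewrite ltr_pdivlMr // in zx.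
have -> : c0 + c1 * z + c2 * z ^+ 2 - (c0 + c1 * x + c2 * x ^+ 2) -
  (c1 + 2 * c2 * x) * (z - x) = c2 * (z - x) * (z - x) by ring.
rewrite 2!normrM ler_wpM2r //; have := normr_ge0 (z - x); nra.
Qed.

Lemma is_derive_sub (f g : R -> R) (x a b : R) : is_derive x 1 f a ->
  is_derive x 1 g b -> is_derive x 1 (fun t => f t - g t) (a - b).
Proof. by move=> df dg; exact: is_deriveB. Qed.

Lemma is_derive_add (f g : R -> R) (x a b : R) : is_derive x 1 f a ->
  is_derive x 1 g b -> is_derive x 1 (fun t => f t + g t) (a + b).
Proof. by move=> df dg; exact: is_deriveD. Qed.

Lemma is_derive_continuous (f df : R -> R) :
  (forall x : R, is_derive x 1 f (df x)) -> continuous f.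
Proof.
move=> h x; apply/differentiable_continuous; rewrite -derivable1_diffP.
exact: (@ex_derive _ _ _ _ _ _ _ (h x)).
Qed.

Lemma mean_value_bound (f df : R -> R) (M t1 t2 : R) :
  (forall x : R, is_derive x 1 f (df x)) ->
  (forall s, Num.min t1 t2 <= s <= Num.max t1 t2 -> `|df s| <= M) ->
  `|f t2 - f t1| <= M * `|t2 - t1|.
Proof.
move=> hf; wlog t12 : t1 t2 / t1 <= t2.
  move=> h hM; have [/h|/ltW/h] := leP t1 t2; first exact.
  by rewrite minC maxC distrC (distrC t1); exact.
move=> hM; have [//||c + ->] := @MVT_segment _ f df t1 t2.
  exact/continuous_subspaceT/(is_derive_continuous hf).
rewrite in_itv /= => ct; rewrite normrM ler_wpM2r // hM //.
by rewrite (min_idPl t12) (max_idPr t12).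
Qed.

Lemma primitive_right (g : R -> R) (a : R) : continuous g ->
  exists G : R -> R, forall x : R, a < x -> is_derive x 1 G (g x).
Proof.
move=> cg; exists (fun y => (\int[lebesgue_measure]_(t in `[a, y]) g t)) => x ax.
have [||||d D] := @continuous_FTC1_closed R g a x (x + 1).
- by rewrite ltrDl.
- apply: continuous_compact_integrable; first exact: segment_compact.
  exact: continuous_subspaceT.
- exact: ax.
- exact: cg.
by apply: DeriveDef; [exact: d | rewrite -derive1E; exact: D].
Qed.

(** An integral with fixed lower bound is a primitive only to the right of that bound. A reflected
    copy covers the left; the two differ by a constant on [(-1, 1)] and are glued at 0. *)
Lemma primitive (g : R -> R) : continuous g ->
  exists G : R -> R, forall x : R, is_derive x 1 G (g x).
Proof.
move=> cg; have [F hF] := @primitive_right g (-1) cg.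
have [|F' hF'] := @primitive_right (fun t => g (- t)) (-1).
  by move=> t; apply: (@continuous_comp _ _ _ (-%R) g); [exact: opp_continuous | exact: cg].
pose K t := - F' (- t).
have hK (x : R) : x < 1 -> is_derive x 1 K (g x).
  move=> x1; have /is_derive_epsP h : is_derive (- x) 1 F' (g x).
    by rewrite -{2}(opprK x); apply: hF'; lra.
  apply/is_derive_epsP => e e0; have [d d0 hd] := h e e0; exists d => // z zx.
  have := hd (- z); rewrite opprK (_ : - z + x = - (z - x)) ?normrN; last by ring.
  move=> /(_ zx); rewrite /K; have -> : - F' (- z) - - F' (- x) - g x * (z - x) =
    - (F' (- z) - F' (- x) - g x * (- (z - x))) by ring.
  by rewrite normrN.
have cst (x : R) : -1 < x < 1 -> F x - K x = F 0 - K 0.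
  move=> x1; pose c s := F s - K s.
  have dc (s : R) : -1 < s < 1 -> is_derive s 1 c 0.
    move=> s1; rewrite -(subrr (g s)); apply: is_derive_sub; [apply: hF | apply: hK]; lra.
  have cc (u v : R) : -1 < u < 1 -> -1 < v < 1 -> u <= v -> c v = c u.
    move=> hu hv uv; apply/eqP; rewrite -subr_eq0; apply/eqP.
    have [//|s||s _ ->] := @MVT_segment _ c (fun=> 0) u v; last by rewrite mul0r.
      by rewrite in_itv /= => hs; apply: dc; lra.
    apply: derivable_within_continuous => s; rewrite in_itv /= => hs.
    by apply: (@ex_derive _ _ _ _ _ _ 0); apply: dc; lra.
  have [x0|/ltW x0] := leP 0 x; [apply: cc => //; lra | symmetry; apply: cc => //; lra].
exists (fun x => if 0 <= x then F x else K x + (F 0 - K 0)) => x.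
have [x0|x0] := ltP x 0.
  have /is_derive_epsP h : is_derive x 1 K (g x) by apply: hK; lra.
  apply/is_derive_epsP => e e0; have [d d0 hd] := h e e0.
  exists (Num.min d (- x)); first by rewrite lt_min d0 oppr_gt0.
  move=> z; rewrite lt_min => /andP[zd zx].
  have zn : z < 0 by have := ler_norm (z - x); lra.
  by rewrite (lt_geF zn) (lt_geF x0) opprD addrACA subrr addr0; exact: hd.
have /is_derive_epsP h : is_derive x 1 F (g x) by apply: hF; lra.
apply/is_derive_epsP => e e0; have [d d0 hd] := h e e0.
exists (Num.min d 1); first by rewrite lt_min d0 ltr01.
move=> z; rewrite lt_min => /andP[zd zx]; rewrite x0.
have := ler_norm (x - z); rewrite distrC => zx'.
case: (leP 0 z) => z0; first exact: hd.
rewrite -(cst z); last by lra.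
by rewrite (addrC (K z)) subrK; exact: hd.
Qed.

End RealDerivative.

Section StripUniqueness.
Variable R : realType.
Local Notation C := R[i].

Definition eps_continuous (k : C -> C) (z : C) : Prop :=
  forall e : R, 0 < e -> exists2 d : R, 0 < d &
    forall w, nrm (w - z) < d -> nrm (k w - k z) < e.

(** [q] is the derivative at the real point [t] of the complex-valued function [L], taken on real
    and imaginary parts. *)
Definition cis_derive (t : R) (L : R -> C) (q : C) : Prop :=
  is_derive t 1 (fun s => complex.Re (L s)) (complex.Re q) /\
  is_derive t 1 (fun s => complex.Im (L s)) (complex.Im q).

Lemma complex_primitive (q : R -> C) :
  (forall t (e : R), 0 < e -> exists2 d : R, 0 < d &
     forall s, `|s - t| < d -> nrm (q s - q t) < e) ->
  exists L : R -> C, forall t, cis_derive t L (q t).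
Proof.
move=> cq.
have [|G1 h1] := @primitive R (fun t => complex.Re (q t)).
  move=> t; apply/continuous_epsP => e /cq-/(_ t)[d d0 hd]; exists d => // z /hd h.
  by rewrite -cReB; apply: le_lt_trans h; exact: Re_le_nrm.
have [|G2 h2] := @primitive R (fun t => complex.Im (q t)).
  move=> t; apply/continuous_epsP => e /cq-/(_ t)[d d0 hd]; exists d => // z /hd h.
  by rewrite -cImB; apply: le_lt_trans h; exact: Im_le_nrm.
by exists (fun t => G1 t +i* G2 t) => t; split => /=.
Qed.

(** [L] is compared with a quadratic polynomial of derivative [b + 2 c s]. The mean value theorem is
    used on real and imaginary parts separately, whence the factor 2. *)
Lemma complex_mvt (L q : R -> C) (a b c : C) (eta t1 t2 : R) :
  (forall t, cis_derive t L (q t)) ->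
  (forall s, Num.min t1 t2 <= s <= Num.max t1 t2 ->
     nrm (q s - (b + 2 * c * s%:C)) <= eta) ->
  nrm (L t2 - L t1 - ((a + b * t2%:C + c * t2%:C ^+ 2) - (a + b * t1%:C + c * t1%:C ^+ 2)))
    <= 2 * eta * `|t2 - t1|.
Proof.
move=> hL hq; apply: le_trans (nrm_le_ReIm _) _.
rewrite -mulrA (mulr_natl _ 2) mulr2n; apply: lerD.
- pose f t := complex.Re (L t) -
    (complex.Re a + complex.Re b * t + complex.Re c * t ^+ 2).
  have -> : complex.Re (L t2 - L t1 - ((a + b * t2%:C + c * t2%:C ^+ 2) -
      (a + b * t1%:C + c * t1%:C ^+ 2))) = f t2 - f t1.
    rewrite /f !expr2 !(cReB, cReD, cReN) !cReM !cImM /=; ring.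
  apply: (@mean_value_bound _ f (fun t => complex.Re (q t) -
      (complex.Re b + 2 * complex.Re c * t))).
    by move=> x; apply: is_derive_sub; [exact: (hL x).1 | exact: is_derive_quadratic].
  move=> s /hq h; apply: le_trans h; apply: le_trans (Re_le_nrm _).
  rewrite !(cReB, cReD, cReN) !cReM !cImM /=; rewrite le_eqVlt; apply/orP; left; apply/eqP; congr (`|_|); ring.
- pose f t := complex.Im (L t) -
    (complex.Im a + complex.Im b * t + complex.Im c * t ^+ 2).
  have -> : complex.Im (L t2 - L t1 - ((a + b * t2%:C + c * t2%:C ^+ 2) -
      (a + b * t1%:C + c * t1%:C ^+ 2))) = f t2 - f t1.
    rewrite /f !expr2 !(cImB, cImD, cImN) !cImM !cReM /=; ring.
  apply: (@mean_value_bound _ f (fun t => complex.Im (q t) -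
      (complex.Im b + 2 * complex.Im c * t))).
    by move=> x; apply: is_derive_sub; [exact: (hL x).2 | exact: is_derive_quadratic].
  move=> s /hq h; apply: le_trans h; apply: le_trans (Im_le_nrm _).
  rewrite !(cImB, cImD, cImN) !cImM !cReM /=; rewrite le_eqVlt; apply/orP; left; apply/eqP; congr (`|_|); ring.
Qed.

End StripUniqueness.

(** * Goursat's theorem on rectangles *)

Section Goursat.
Variable R : realType.
Local Notation C := R[i].

Definition cdiff (k : C -> C) (z : C) : Prop :=
  exists b, forall e : R, 0 < e -> exists2 d : R, 0 < d &
    forall w, nrm (w - z) < d -> nrm (k w - k z - b * (w - z)) <= e * nrm (w - z).

Lemma nrm_cplx_le (z : C) (a b : R) : `|complex.Re z| <= a -> `|complex.Im z| <= b ->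
  nrm z <= a + b.
Proof. by move=> ha hb; apply: le_trans (nrm_le_ReIm _) _; exact: lerD. Qed.

Lemma small_dyadic (s d : R) : 0 < d -> exists n, s / 2 ^+ n < d.
Proof.
move=> d0; exists (Num.trunc (s / d)).+1.
rewrite ltr_pdivrMr ?exprn_gt0 // mulrC -ltr_pdivrMr //.
apply: lt_le_trans (truncnS_gt _) _.
by rewrite -natrX ler_nat ltnW // ltn_expl.
Qed.

Variable kk : C -> C.
Hypothesis ckk : forall z, eps_continuous kk z.

(** Contour integrals are differences of primitives along lines, so only continuity of [kk] on the
    whole plane is required to define them. *)
Lemma line_primitives : exists LP : C -> C -> R -> C, forall p d t,
  cis_derive t (LP p d) (kk (p + t%:C * d) * d).
Proof.
have /choice[LP hLP] (pd : C * C) : exists L : R -> C, forall t,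
    cis_derive t L (kk (pd.1 + t%:C * pd.2) * pd.2).
  apply: complex_primitive => t e e0; set p := pd.1; set d := pd.2.
  have q0 : 0 < nrm d + 1 by rewrite ltr_wpDl ?nrm_ge0.
  have [del del0 hdel] := ckk (p + t%:C * d) (divr_gt0 e0 q0).
  exists (del / (nrm d + 1)) => [|s]; first by rewrite divr_gt0.
  rewrite ltr_pdivlMr // => st; rewrite -mulrBl nrmM.
  have := hdel (p + s%:C * d); rewrite opprD addrACA subrr add0r -mulrBl nrmM.
  rewrite -rmorphB /= nrm_real ltr_pdivlMr // => /(_ _)h.
  apply: (@le_lt_trans _ _ (nrm (kk (p + s%:C * d) - kk (p + t%:C * d)) * (nrm d + 1))).
    by rewrite ler_wpM2l ?nrm_ge0 // lerDl.
  apply: h; apply: le_lt_trans st; rewrite ler_wpM2l // lerDl //.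
by exists (fun p d => LP (p, d)) => p d t; exact: hLP.
Qed.

Definition LP : C -> C -> R -> C := projT1 (cid line_primitives).
Lemma LPP p d t : cis_derive t (LP p d) (kk (p + t%:C * d) * d).
Proof. exact: (projT2 (cid line_primitives)). Qed.

Definition line_int p d t1 t2 := LP p d t2 - LP p d t1.

(** The primitive of the affine function [z |-> a + b * z]. *)
Definition quad (a b z : C) := a * z + b / 2 * z ^+ 2.

Lemma line_int_est (a b p d : C) (eta t1 t2 : R) : nrm d = 1 ->
  (forall s, Num.min t1 t2 <= s <= Num.max t1 t2 ->
     nrm (kk (p + s%:C * d) - (a + b * (p + s%:C * d))) <= eta) ->
  nrm (line_int p d t1 t2 - (quad a b (p + t2%:C * d) - quad a b (p + t1%:C * d)))
    <= 2 * eta * `|t2 - t1|.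
Proof.
move=> d1 h.
have := @complex_mvt R (LP p d) (fun t => kk (p + t%:C * d) * d) (quad a b p)
  ((a + b * p) * d) (b / 2 * d ^+ 2) eta t1 t2 (LPP p d).
have quadE (t : R) : quad a b (p + t%:C * d) =
    quad a b p + (a + b * p) * d * t%:C + b / 2 * d ^+ 2 * t%:C ^+ 2.
  by rewrite /quad; field.
rewrite !quadE; apply=> s hs.
have -> : kk (p + s%:C * d) * d - ((a + b * p) * d + 2 * (b / 2 * d ^+ 2) * s%:C) =
   (kk (p + s%:C * d) - (a + b * (p + s%:C * d))) * d by field.
by rewrite nrmM d1 mulr1 h.
Qed.

Definition hint y x1 x2 := line_int (0 +i* y) 1 x1 x2.
Definition vint x y1 y2 := line_int x%:C 'i%C y1 y2.

Lemma hpointE (x y : R) : (0 +i* y : C) + x%:C * 1 = x +i* y.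
Proof. by apply: eqC; rewrite mulr1 /= ?add0r ?addr0. Qed.
Lemma vpointE (x y : R) : x%:C + y%:C * 'i%C = x +i* y :> C.
Proof. by apply: eqC => /=; rewrite ?mulr0 ?mulr1 ?mul0r ?subr0 ?addr0 ?add0r. Qed.

Lemma hint_est (a b : C) (eta y x1 x2 : R) :
  (forall s, Num.min x1 x2 <= s <= Num.max x1 x2 ->
     nrm (kk (s +i* y) - (a + b * (s +i* y))) <= eta) ->
  nrm (hint y x1 x2 - (quad a b (x2 +i* y) - quad a b (x1 +i* y)))
    <= 2 * eta * `|x2 - x1|.
Proof.
move=> h; rewrite -(hpointE x2 y) -(hpointE x1 y); apply: line_int_est; first exact: nrm1.
by move=> s hs; rewrite hpointE; exact: h.
Qed.

Lemma vint_est (a b : C) (eta x y1 y2 : R) :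
  (forall s, Num.min y1 y2 <= s <= Num.max y1 y2 ->
     nrm (kk (x +i* s) - (a + b * (x +i* s))) <= eta) ->
  nrm (vint x y1 y2 - (quad a b (x +i* y2) - quad a b (x +i* y1)))
    <= 2 * eta * `|y2 - y1|.
Proof.
move=> h; rewrite -(vpointE x y2) -(vpointE x y1); apply: line_int_est; first exact: nrmi.
by move=> s hs; rewrite vpointE; exact: h.
Qed.

(** The integral of [kk] along the boundary of a rectangle, counterclockwise. *)
Definition rect x1 x2 y1 y2 :=
  hint y1 x1 x2 + vint x2 y1 y2 - hint y2 x1 x2 - vint x1 y1 y2.

Lemma rect_splitx x2 x1 x3 y1 y2 : rect x1 x3 y1 y2 = rect x1 x2 y1 y2 + rect x2 x3 y1 y2.
Proof. rewrite /rect /hint /vint /line_int; ring. Qed.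
Lemma rect_splity y2 x1 x2 y1 y3 : rect x1 x2 y1 y3 = rect x1 x2 y1 y2 + rect x1 x2 y2 y3.
Proof. rewrite /rect /hint /vint /line_int; ring. Qed.
Lemma rect_antix x1 x2 y1 y2 : rect x2 x1 y1 y2 = - rect x1 x2 y1 y2.
Proof. rewrite /rect /hint /vint /line_int; ring. Qed.

(** The values of the primitive [quad] of the affine approximation cancel around the four corners,
    so only the deviation [eta] remains. *)
Lemma rect_est (a b : C) (eta x1 x2 y1 y2 : R) : x1 <= x2 -> y1 <= y2 ->
  (forall x y, x1 <= x <= x2 -> y1 <= y <= y2 ->
     nrm (kk (x +i* y) - (a + b * (x +i* y))) <= eta) ->
  nrm (rect x1 x2 y1 y2) <= 4 * eta * ((x2 - x1) + (y2 - y1)).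
Proof.
move=> x12 y12 h.
have hx y : y1 <= y <= y2 -> nrm (hint y x1 x2 - (quad a b (x2 +i* y) - quad a b (x1 +i* y)))
    <= 2 * eta * (x2 - x1).
  move=> hy; rewrite -[x2 - x1]ger0_norm ?subr_ge0 //; apply: hint_est => s.
  by rewrite (min_idPl x12) (max_idPr x12) => hs; exact: h.
have hy x : x1 <= x <= x2 -> nrm (vint x y1 y2 - (quad a b (x +i* y2) - quad a b (x +i* y1)))
    <= 2 * eta * (y2 - y1).
  move=> hx'; rewrite -[y2 - y1]ger0_norm ?subr_ge0 //; apply: vint_est => s.
  by rewrite (min_idPl y12) (max_idPr y12) => hs; exact: h.
have := hx y1; have := hx y2; have := hy x1; have := hy x2.
rewrite !lexx x12 y12 => /(_ isT) h1 /(_ isT) h2 /(_ isT) h3 /(_ isT) h4.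
rewrite /rect; set A := hint y1 x1 x2 in h4 *; set B := vint x2 y1 y2 in h1 *.
set D := hint y2 x1 x2 in h3 *; set E := vint x1 y1 y2 in h2 *.
set q11 := quad a b (x1 +i* y1) in h2 h4; set q12 := quad a b (x1 +i* y2) in h2 h3.
set q21 := quad a b (x2 +i* y1) in h1 h4; set q22 := quad a b (x2 +i* y2) in h1 h3.
have -> : A + B - D - E = ((A - (q21 - q11)) + (B - (q22 - q21))) -
   ((D - (q22 - q12)) + (E - (q12 - q11))) by ring.
apply: le_trans (ler_nrmB _ _) _.
have := ler_nrmD (A - (q21 - q11)) (B - (q22 - q21)).
have := ler_nrmD (D - (q22 - q12)) (E - (q12 - q11)).
lra.
Qed.

(** Some quarter of a rectangle carries at least a quarter of its contour integral. At the common
    point of the nested quarters the affine approximation makes the integral [o(4^-n)], which beats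
    the factor [4^n]. *)
Lemma goursat x1 x2 y1 y2 : x1 <= x2 -> y1 <= y2 ->
  (forall x y, x1 <= x <= x2 -> y1 <= y <= y2 -> cdiff kk (x +i* y)) ->
  rect x1 x2 y1 y2 = 0.
Proof.
move=> x12 y12 hd; pose w := x2 - x1; pose h := y2 - y1.
have w0 : 0 <= w by rewrite subr_ge0.
have h0 : 0 <= h by rewrite subr_ge0.
pose wn n : R := w / 2 ^+ n; pose hn n : R := h / 2 ^+ n.
have wn0 n : 0 <= wn n by rewrite divr_ge0 ?exprn_ge0.
have hn0 n : 0 <= hn n by rewrite divr_ge0 ?exprn_ge0.
have wnS n : wn n = wn n.+1 + wn n.+1 by rewrite /wn exprS; field; rewrite expf_neq0.
have hnS n : hn n = hn n.+1 + hn n.+1 by rewrite /hn exprS; field; rewrite expf_neq0.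
pose rc n (c : R * R) := rect c.1 (c.1 + wn n) c.2 (c.2 + hn n).
pose step n c c' := [/\ nrm (rc n c) <= 4 * nrm (rc n.+1 c'),
   c.1 <= c'.1 <= c.1 + wn n.+1 & c.2 <= c'.2 <= c.2 + hn n.+1].
have /choice[nx hnx] (nc : nat * (R * R)) : exists c', step nc.1 nc.2 c'.
  case: nc => n [x y] /=; rewrite /step /rc /=.
  set a := wn n.+1; set b := hn n.+1.
  have a0 : 0 <= a := wn0 _; have b0 : 0 <= b := hn0 _.
  have -> : rect x (x + wn n) y (y + hn n) =
     (rect x (x + a) y (y + b) + rect x (x + a) (y + b) (y + b + b)) +
     (rect (x + a) (x + a + a) y (y + b) + rect (x + a) (x + a + a) (y + b) (y + b + b)).
    rewrite (wnS n) (hnS n) -/a -/b (addrA x) (addrA y) (rect_splitx (x + a)).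
    by congr (_ + _); exact: rect_splity.
  set r1 := rect x _ y _; set r2 := rect x _ (y + b) _.
  set r3 := rect _ _ y _; set r4 := rect (x + a) _ (y + b) _.
  pose m := Num.max (Num.max (nrm r1) (nrm r2)) (Num.max (nrm r3) (nrm r4)).
  have hm : nrm (r1 + r2 + (r3 + r4)) <= 4 * m.
    apply: le_trans (ler_nrmD _ _) _.
    have := ler_nrmD r1 r2; have := ler_nrmD r3 r4.
    have : nrm r1 <= m by rewrite !le_max lexx.
    have : nrm r2 <= m by rewrite !le_max lexx orbT.
    have : nrm r3 <= m by rewrite !le_max lexx !orbT.
    have : nrm r4 <= m by rewrite !le_max lexx !orbT.
    lra.
  have [E|[E|[E|E]]] : m = nrm r1 \/ m = nrm r2 \/ m = nrm r3 \/ m = nrm r4.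
    rewrite /m; case: (leP (nrm r1) (nrm r2)) => _; case: (leP (nrm r3) (nrm r4)) => _;
      case: leP => _; tauto.
  - by exists (x, y); rewrite -/a -/b -/r1 -E; split=> //=; rewrite lexx lerDl.
  - by exists (x, y + b); rewrite -/a -/b -/r2 -E; split=> //=; rewrite ?lexx ?lerDl ?a0 ?b0.
  - by exists (x + a, y); rewrite -/a -/b -/r3 -E; split=> //=; rewrite ?lexx ?lerDl ?a0 ?b0.
  - by exists (x + a, y + b); rewrite -/a -/b -/r4 -E; split=> //=; rewrite ?lexx ?lerDl ?a0 ?b0.
(* [c n] is the lower left corner of the rectangle chosen at stage [n], of sides [wn n] and
   [hn n]. *)
pose c := fix c n := if n is m.+1 then nx (m, c m) else (x1, y1).
have cS n : step n (c n) (c n.+1) by exact: hnx (n, c n).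
have rc0 : rc 0%N (c 0%N) = rect x1 x2 y1 y2.
  by rewrite /rc /wn /hn /= expr0 !divr1 /w /h !(addrC x1) !(addrC y1) !subrK.
have rcn n : nrm (rect x1 x2 y1 y2) <= 4 ^+ n * nrm (rc n (c n)).
  elim: n => [|n ih]; first by rewrite expr0 mul1r rc0.
  apply: le_trans ih _; rewrite exprSr -mulrA ler_wpM2l ?exprn_ge0 //.
  by case: (cS n).
have cmono m n : (m <= n)%N -> [/\ (c m).1 <= (c n).1, (c n).1 + wn n <= (c m).1 + wn m,
    (c m).2 <= (c n).2 & (c n).2 + hn n <= (c m).2 + hn m].
  elim: n => [|n ih]; first by rewrite leqn0 => /eqP ->.
  rewrite leq_eqVlt => /orP[/eqP -> //|]; rewrite ltnS => /ih[i1 i2 i3 i4].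
  have [_ /andP[s1 s2] /andP[s3 s4]] := cS n.
  have := wnS n; have := hnS n; move=> e1 e2; split; lra.
have cbnd m n : (c m).1 <= (c n).1 + wn n /\ (c m).2 <= (c n).2 + hn n.
  have := wn0 n; have := hn0 n; have := wn0 m; have := hn0 m.
  have [/cmono[i1 i2 i3 i4]|/ltnW/cmono[i1 i2 i3 i4]] := leqP m n; lra.
(* The lower left corners increase and stay below every upper right corner, so their supremum lies
   in all the rectangles. *)
pose X := sup (range (fun n => (c n).1)); pose Y := sup (range (fun n => (c n).2)).
have supX : has_sup (range (fun n => (c n).1)).
  split; first by exists (c 0%N).1, 0%N.
  by exists ((c 0%N).1 + wn 0%N) => _ [m _ <-]; exact: (cbnd m 0%N).1.
have supY : has_sup (range (fun n => (c n).2)).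
  split; first by exists (c 0%N).2, 0%N.
  by exists ((c 0%N).2 + hn 0%N) => _ [m _ <-]; exact: (cbnd m 0%N).2.
have hX n : (c n).1 <= X <= (c n).1 + wn n.
  apply/andP; split; first by apply: (sup_ubound supX.2); exists n.
  by apply: ge_sup; [exact: supX.1 | move=> _ [m _ <-]; exact: (cbnd m n).1].
have hY n : (c n).2 <= Y <= (c n).2 + hn n.
  apply/andP; split; first by apply: (sup_ubound supY.2); exists n.
  by apply: ge_sup; [exact: supY.1 | move=> _ [m _ <-]; exact: (cbnd m n).2].
have [b hb] : cdiff kk (X +i* Y).
  apply: hd.
    by have := hX 0%N; rewrite /wn /= expr0 divr1 /w (addrC x1 (x2 - x1)) subrK.
  by have := hY 0%N; rewrite /hn /= expr0 divr1 /h (addrC y1 (y2 - y1)) subrK.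
apply: nrm_lt_all => e e0.
(* [4 ^+ n] times [4 * (e / q) * (wn n + hn n) ^+ 2] is [e / q * (4 * (w + h) ^+ 2)] for every [n];
   the added 1 keeps [q] positive. *)
pose q := 4 * (w + h) ^+ 2 + 1.
have q0 : 0 < q by rewrite /q ltr_wpDl // mulr_ge0 ?sqr_ge0.
have [d d0 hdd] := hb (e / q) (divr_gt0 e0 q0).
have [n hn'] := small_dyadic (w + h) d0.
have sE : (w + h) / 2 ^+ n = wn n + hn n by rewrite mulrDl.
apply: le_lt_trans (rcn n) _.
have re : nrm (rc n (c n)) <= 4 * (e / q * (wn n + hn n)) * (wn n + hn n).
  have := @rect_est (kk (X +i* Y) - b * (X +i* Y)) b (e / q * (wn n + hn n))
    (c n).1 ((c n).1 + wn n) (c n).2 ((c n).2 + hn n).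
  rewrite !lerDl !(addrC (_ n).1) !(addrC (_ n).2) !addrK wn0 hn0.
  rewrite /rc !(addrC (_ n).1) !(addrC (_ n).2).
  apply=> // x y hx hy.
  have -> : kk (x +i* y) - (kk (X +i* Y) - b * (X +i* Y) + b * (x +i* y)) =
     kk (x +i* y) - kk (X +i* Y) - b * ((x +i* y) - (X +i* Y)) by ring.
  have dist : nrm ((x +i* y) - (X +i* Y) : C) <= wn n + hn n.
    have /andP[X1 X2] := hX n; have /andP[Y1 Y2] := hY n.
    by apply: nrm_cplx_le => /=; rewrite ler_norml; lra.
  apply: le_trans (hdd _ _) _; first by apply: le_lt_trans dist _; rewrite -sE.
  by rewrite ler_wpM2l // divr_ge0 ?ltW.
apply: (@le_lt_trans _ _ (e / q * (4 * (w + h) ^+ 2))).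
  apply: le_trans (ler_wpM2l (exprn_ge0 n (ler0n R 4)) re) _.
  rewrite le_eqVlt; apply/orP; left; apply/eqP; rewrite -sE.
  have -> : (4 : R) = 2 ^+ 2 by rewrite -natrX.
  by rewrite -exprM mulnC exprM; field; rewrite expf_neq0 //= gt_eqF.
by rewrite mulrAC ltr_pdivrMr // ltr_pM2l // /q ltrDl.
Qed.

End Goursat.

(** * Second order expansions and a maximum principle on squares *)

Section MaximumPrinciple.
Variable R : realType.
Local Notation C := R[i].

Definition second_order (f : C -> C) (z : C) : Prop :=
  exists a b c, forall e : R, 0 < e -> exists2 d : R, 0 < d &
    forall h, nrm h < d -> nrm (f (z + h) - (a + b * h + c * h ^+ 2)) <= e * nrm h ^+ 2.

Lemma second_order_mul (f g : C -> C) z : second_order f z -> second_order g z ->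
  second_order (fun w => f w * g w) z.
Proof.
move=> [a [b [c hf]]] [a' [b' [c' hg]]].
exists (a * a'), (a * b' + b * a'), (a * c' + b * b' + c * a') => e e0.
pose A := nrm a + nrm b + nrm c; pose A' := nrm a' + nrm b' + nrm c'.
pose B := nrm (b * c' + c * b') + nrm (c * c').
have A0 : 0 <= A by rewrite !addr_ge0 ?nrm_ge0.
have A'0 : 0 <= A' by rewrite !addr_ge0 ?nrm_ge0.
have B0 : 0 <= B by rewrite !addr_ge0 ?nrm_ge0.
(* The remainders of the two factors cost at most [e' * (1 + A' + A)], and the terms of degree at
   least three cost [B * e'] once [nrm h <= e']; all are relative to [nrm h ^+ 2]. *)
pose q := A + A' + B + 2; have q0 : 0 < q by rewrite /q; lra.
pose e' := Num.min 1 (e / (3 * q)).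
have e'0 : 0 < e' by rewrite lt_min ltr01 divr_gt0 // mulr_gt0.
have e'1 : e' <= 1 by rewrite ge_min lexx.
have e'q : 3 * (e' * q) <= e.
  by rewrite mulrCA -ler_pdivlMr ?mulr_gt0 // ge_min lexx orbT.
have [d1 d10 h1] := hf e' e'0; have [d2 d20 h2] := hg e' e'0.
exists (Num.min (Num.min d1 d2) e'); first by rewrite lt_min lt_min d10 d20 e'0.
move=> h; rewrite lt_min lt_min => /andP[/andP[/h1 {}h1 /h2 {}h2] he].
set p := a + b * h + c * h ^+ 2 in h1; set p' := a' + b' * h + c' * h ^+ 2 in h2.
have n0 := nrm_ge0 h; set n := nrm h in h1 h2 he n0 *.
have n1 : n <= 1 by lra.
have bnd (x y w : C) : nrm (x + y * h + w * h ^+ 2) <= nrm x + nrm y + nrm w.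
  apply: le_trans (ler_nrmD _ _) _; apply: lerD.
    apply: le_trans (ler_nrmD _ _) _; rewrite lerD2l nrmM.
    by rewrite ler_piMr ?nrm_ge0.
  rewrite !nrmM -/n ler_piMr ?nrm_ge0 //; nra.
have hp : nrm p <= A by exact: bnd.
have hp' : nrm p' <= A' by exact: bnd.
have -> : f (z + h) * g (z + h) - (a * a' + (a * b' + b * a') * h +
    (a * c' + b * b' + c * a') * h ^+ 2) =
    (f (z + h) - p) * (g (z + h) - p') + (f (z + h) - p) * p' +
    p * (g (z + h) - p') + ((b * c' + c * b') + (c * c') * h) * h * h ^+ 2.
  by rewrite /p /p'; ring.
have hB : nrm (((b * c' + c * b') + (c * c') * h) * h * h ^+ 2) <= B * e' * n ^+ 2.
  have -> : nrm (((b * c' + c * b') + (c * c') * h) * h * h ^+ 2) =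
    nrm ((b * c' + c * b') + (c * c') * h) * n * n ^+ 2 by rewrite !nrmM expr2.
  rewrite ler_wpM2r ?sqr_ge0 // ler_pM ?nrm_ge0 ?(ltW he) //.
  apply: le_trans (ler_nrmD _ _) _; rewrite lerD2l nrmM.
  by rewrite ler_piMr ?nrm_ge0.
set r := f _ - p in h1 *; set r' := g _ - p' in h2 *.
have := ler_nrmD (r * r' + r * p' + p * r') (((b * c' + c * b') + c * c' * h) * h * h ^+ 2).
have := ler_nrmD (r * r' + r * p') (p * r').
have := ler_nrmD (r * r') (r * p').
rewrite !(nrmM r) (nrmM p).
have N0 : 0 <= n ^+ 2 by rewrite sqr_ge0.
have N1 : n ^+ 2 <= 1 by nra.
have t1 : nrm r * nrm r' <= e' * n ^+ 2.
  apply: (@le_trans _ _ (e' * n ^+ 2 * 1)); last by rewrite mulr1.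
  apply: ler_pM; rewrite ?nrm_ge0 //; nra.
have t2 : nrm r * nrm p' <= e' * n ^+ 2 * A' by apply: ler_pM; rewrite ?nrm_ge0.
have t3 : nrm p * nrm r' <= A * (e' * n ^+ 2) by apply: ler_pM; rewrite ?nrm_ge0.
move=> s1 s2 s3.
apply: (@le_trans _ _ (e' * q * n ^+ 2)); last first.
  by rewrite ler_wpM2r //; have := mulr_gt0 e'0 q0; lra.
apply: le_trans s3 _; rewrite /q.
have : 0 <= e' * n ^+ 2 by rewrite mulr_ge0 // ltW.
nra.
Qed.

Lemma second_order_rot (f : C -> C) (z0 om w : C) : nrm om = 1 ->
  second_order f (z0 + om * w) -> second_order (fun u => f (z0 + om * u)) w.
Proof.
move=> om1 [a [b [c h]]]; exists a, (b * om), (c * om ^+ 2) => e e0.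
have [d d0 hd] := h e e0; exists d => // u ud.
have := hd (om * u); rewrite nrmM om1 mul1r => /(_ ud).
by rewrite mulrDr addrA exprMn !mulrA.
Qed.

Definition square (r : R) : set C :=
  [set z | `|complex.Re z| <= r /\ `|complex.Im z| <= r].

Definition continuous_on (S : set C) (f : C -> C) : Prop :=
  forall z, S z -> forall e : R, 0 < e -> exists2 d : R, 0 < d &
    forall w, S w -> nrm (w - z) < d -> nrm (f w - f z) < e.

(* A function with a complex second order expansion has the discrete mean value
   property on the four points [z + i^j rho] up to [o(rho^2)], which prevents
   [Re (conj c * G) + delta * nrm ^+ 2] from having an interior maximum. *)
Lemma square_maximum_principle (G : C -> C) (r : R) : 0 < r ->
  continuous_on (square r) G ->
  (forall z, `|complex.Re z| < r -> `|complex.Im z| < r -> second_order G z) ->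
  (forall z, square r z -> `|complex.Re z| = r \/ `|complex.Im z| = r -> G z = 0) ->
  G 0 = 0.
Proof.
move=> r0 cG tG bG; apply/eqP/negPn/negP => G0.
pose c := G 0; pose u z := complex.Re (Num.conj c * G z).
have u0 : u 0 = nrm c ^+ 2.
  by rewrite /u -/c cReM Re_conj Im_conj nrm_sqr; ring.
have nc : 0 < nrm c.
  by rewrite lt_neqAle nrm_ge0 andbT eq_sym; apply: contra_neq G0; exact: nrm_eq0.
have u0p : 0 < u 0 by rewrite u0 exprn_gt0.
(* On the boundary, where [G] vanishes, the perturbation is at most [delta * (2 * r ^+ 2)], half of
   [u 0]: the maximum of [v] is interior. *)
pose delta := u 0 / (4 * r ^+ 2).
have r2 : 0 < r ^+ 2 by rewrite exprn_gt0.
have delta0 : 0 < delta by rewrite divr_gt0 ?mulr_gt0.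
pose v (p : R * R) := u (p.1 +i* p.2) + delta * (p.1 ^+ 2 + p.2 ^+ 2).
pose I : set R := `[(- r), r]%classic.
have II x : I x <-> `|x| <= r by rewrite /I /= in_itv /= ler_norml.
have cI : compact (I `*` I) by apply: compact_setX; exact: segment_compact.
have nI : (I `*` I) !=set0.
  by exists (0, 0); split; apply/II; rewrite normr0 ltW.
have [|[x1 y1]] := compact_EVT_max nI cI (f := v).
  apply/subspace_continuousP => -[x y] [/= /II Ix /II Iy].
  apply/cvgrPdist_lt => e e0.
  have q0 : 0 < nrm c + 1 by rewrite addr_gt0.
  have e2 : 0 < e / 2 by rewrite divr_gt0.
  have [d d0 hd] := cG (x +i* y) (conj Ix Iy) _ (divr_gt0 e2 q0).
  pose d' := Num.min (d / 2) (e / (16 * delta * r)).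
  have d'0 : 0 < d'.
    rewrite lt_min; apply/andP; split; first by rewrite divr_gt0.
    apply: divr_gt0 => //; apply: mulr_gt0 => //; exact: mulr_gt0.
  exists (ball x d', ball y d'); first by split; exact: nbhsx_ballx.
  move=> [x' y'] [/= bx by'] [/= /II Ix' /II Iy'].
  move: bx by'; rewrite /ball /= => bx by'.
  have xx : `|x' - x| < d' by rewrite distrC.
  have yy : `|y' - y| < d' by rewrite distrC.
  have dd : d' <= d / 2 by rewrite ge_min lexx.
  have ee : d' * (16 * delta * r) <= e.
    have dp : 0 < 16 * delta * r by apply: mulr_gt0 => //; exact: mulr_gt0.
    by rewrite -ler_pdivlMr // /d' ge_min lexx orbT.
  have h1 : `|u (x +i* y) - u (x' +i* y')| <= e / 2.
    rewrite /u -cReB -mulrBr; apply: le_trans (Re_le_nrm _) _.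
    rewrite nrmM nrm_conj nrmC.
    have /ltW : nrm (G (x' +i* y') - G (x +i* y)) < e / 2 / (nrm c + 1).
      apply: hd => //; apply: (@le_lt_trans _ _ (`|x' - x| + `|y' - y|)).
        exact: nrm_le_ReIm.
      lra.
    rewrite ler_pdivlMr // => h; apply: le_trans h.
    by rewrite mulrC ler_wpM2l ?nrm_ge0 // lerDl.
  rewrite /v /=.
  have -> : u (x +i* y) + delta * (x ^+ 2 + y ^+ 2) -
    (u (x' +i* y') + delta * (x' ^+ 2 + y' ^+ 2)) = (u (x +i* y) - u (x' +i* y')) +
    delta * ((x - x') * (x + x') + (y - y') * (y + y')) by ring.
  apply: le_lt_trans (ler_normD _ _) _.
  have sq (a b : R) : `|a| <= r -> `|b| <= r -> `|b - a| < d' ->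
      `|(a - b) * (a + b)| <= d' * (2 * r).
    move=> ha hb hab; rewrite normrM ler_pM //; first by rewrite distrC ltW.
    by apply: le_trans (ler_normD _ _) _; lra.
  have h2 : `|delta * ((x - x') * (x + x') + (y - y') * (y + y'))| <= e / 4.
    rewrite normrM gtr0_norm //.
    apply: (@le_trans _ _ (delta * (d' * (2 * r) + d' * (2 * r)))).
      apply: ler_wpM2l; first exact: ltW.
      exact: le_trans (ler_normD _ _) (lerD (sq _ _ Ix Ix' xx) (sq _ _ Iy Iy' yy)).
    lra.
  lra.
rewrite inE => -[/= /II Ix1 /II Iy1] hmax.
have hmax' x y : `|x| <= r -> `|y| <= r -> v (x, y) <= v (x1, y1).
  by move=> hx hy; apply: hmax; rewrite inE; split; apply/II.
have v0 : v (0, 0) = u 0 by rewrite /v /= expr0n addr0 mulr0 addr0.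
have inside : `|x1| < r /\ `|y1| < r.
  suff h : ~ (`|x1| = r \/ `|y1| = r).
    by split; rewrite lt_neqAle ?Ix1 ?Iy1 andbT; apply/eqP => e; apply: h; [left|right].
  move=> h; have := hmax' 0 0; rewrite normr0 v0 => /(_ (ltW r0) (ltW r0)).
  have Gz : G (x1 +i* y1) = 0 by exact: bG.
  rewrite (_ : v (x1, y1) = delta * (x1 ^+ 2 + y1 ^+ 2)); last first.
    by rewrite /v /= /u Gz mulr0 add0r.
  rewrite leNgt => /negP; apply.
  have : x1 ^+ 2 <= r ^+ 2.
    by move: Ix1; rewrite ler_norml => /andP[? ?]; nra.
  have : y1 ^+ 2 <= r ^+ 2.
    by move: Iy1; rewrite ler_norml => /andP[? ?]; nra.
  have dr : delta * (4 * r ^+ 2) = u 0 by rewrite /delta mulfVK // gt_eqF ?mulr_gt0.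
  move=> hy hx; nra.
have [ix iy] := inside.
have [a [b [k hk]]] := tG (x1 +i* y1) ix iy.
(* Each of the four remainders is then at least [- delta / 2 * rho ^+ 2], and their sum is beaten by
   the gain [4 * delta * rho ^+ 2] of the perturbation. *)
pose e := delta / (2 * (nrm c + 1)).
have q0 : 0 < 2 * (nrm c + 1) by rewrite mulr_gt0 // addr_gt0.
have e0 : 0 < e by rewrite divr_gt0.
have [d d0 hd] := hk e e0.
have aE : a = G (x1 +i* y1).
  have := hd 0; rewrite nrm0 => /(_ d0); rewrite addr0 mulr0 expr0n !mulr0 !addr0.
  rewrite expr0n /= mulr0 => h; apply/eqP; rewrite eq_sym -subr_eq0; apply/eqP/nrm_eq0.
  by apply/eqP; rewrite eq_le h nrm_ge0.
pose m := Num.min (r - `|x1|) (r - `|y1|).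
have m0 : 0 < m by rewrite lt_min !subr_gt0 ix iy.
pose rho := Num.min (d / 2) m.
have rho0 : 0 < rho by rewrite lt_min m0 divr_gt0.
have rhod : rho < d by rewrite /rho gt_min; apply/orP; left; lra.
have rhom : rho <= m by rewrite ge_min lexx orbT.
have rx : `|x1| + rho <= r.
  have : rho <= r - `|x1| by rewrite (le_trans rhom) // ge_min lexx.
  lra.
have ry : `|y1| + rho <= r.
  have : rho <= r - `|y1| by rewrite (le_trans rhom) // ge_min lexx orbT.
  lra.
have small t : `|t| = rho -> `|x1 + t| <= r /\ `|y1 + t| <= r.
  by move=> ht; split; apply: le_trans (ler_normD _ _) _; rewrite ht.
have nr : `|rho| = rho by rewrite gtr0_norm.
have nrN : `|- rho| = rho by rewrite normrN.
pose rem h := G (x1 +i* y1 + h) - (a + b * h + k * h ^+ 2).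
have hrem h : nrm h = rho -> complex.Re (Num.conj c * rem h) >= - (delta / 2 * rho ^+ 2).
  move=> hh; have := hd h; rewrite hh => /(_ rhod) h1.
  have := Re_le_nrm (Num.conj c * rem h); rewrite nrmM nrm_conj ler_norml => /andP[h2 _].
  apply: le_trans h2; rewrite lerN2.
  apply: (@le_trans _ _ (nrm c * (e * rho ^+ 2))); first by rewrite ler_wpM2l ?nrm_ge0.
  rewrite mulrA ler_wpM2r ?sqr_ge0 //.
  have -> : delta / 2 = (nrm c + 1) * e by rewrite /e; field; rewrite gt_eqF // addr_gt0.
  by apply: ler_wpM2r; [exact: ltW | rewrite lerDl].
have s1 := hrem rho%:C (ltac:(by rewrite nrm_real)).
have s2 := hrem (- rho%:C) (ltac:(by rewrite nrmN nrm_real)).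
have s3 := hrem (rho%:C * 'i%C) (ltac:(by rewrite nrmM nrm_real nrmi mulr1)).
have s4 := hrem (- (rho%:C * 'i%C)) (ltac:(by rewrite nrmN nrmM nrm_real nrmi mulr1)).
(* The linear terms cancel in pairs, and the quadratic ones because
   [rho ^+ 2 + (i * rho) ^+ 2 = 0]. *)
have sumE : rem rho%:C + rem (- rho%:C) + rem (rho%:C * 'i%C) + rem (- (rho%:C * 'i%C)) =
   G ((x1 + rho) +i* y1) + G ((x1 - rho) +i* y1) + G (x1 +i* (y1 + rho)) +
   G (x1 +i* (y1 - rho)) - 4 * a.
  rewrite /rem.
  have -> : (x1 +i* y1 + rho%:C : C) = (x1 + rho) +i* y1 by apply: eqC; rewrite /= ?addr0.
  have -> : (x1 +i* y1 - rho%:C : C) = (x1 - rho) +i* y1 by apply: eqC; rewrite /= ?oppr0 ?addr0.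
  have -> : (x1 +i* y1 + rho%:C * 'i%C : C) = x1 +i* (y1 + rho).
    by apply: eqC; rewrite /= ?mulr0 ?mul0r ?mulr1 ?subr0 ?addr0.
  have -> : (x1 +i* y1 - rho%:C * 'i%C : C) = x1 +i* (y1 - rho).
    by apply: eqC; rewrite /= ?mulr0 ?mul0r ?mulr1 ?subr0 ?oppr0 ?addr0.
  rewrite !sqrrN !exprMn sqr_i; ring.
have vsum : v (x1 + rho, y1) + v (x1 - rho, y1) + v (x1, y1 + rho) + v (x1, y1 - rho) -
    4 * v (x1, y1) = complex.Re (Num.conj c * (rem rho%:C + rem (- rho%:C) +
      rem (rho%:C * 'i%C) + rem (- (rho%:C * 'i%C)))) + 4 * delta * rho ^+ 2.
  rewrite sumE /v /u aE /= !mulrDr !mulrN !cReD cReN.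
  have -> : Num.conj c * (4 * G (x1 +i* y1)) = 4 * (Num.conj c * G (x1 +i* y1)) by ring.
  have -> : complex.Re (4 * (Num.conj c * G (x1 +i* y1))) =
     4 * complex.Re (Num.conj c * G (x1 +i* y1)).
    move: (Num.conj c * G (x1 +i* y1)) => W.
    rewrite (_ : 4 * W = W + W + W + W); last by ring.
    by rewrite !cReD; ring.
  ring.
have [A1 _] := small _ nr; have [A2 _] := small _ nrN.
have [_ A3] := small _ nr; have [_ A4] := small _ nrN.
have b1 := hmax' (x1 + rho) y1 A1 Iy1; have b2 := hmax' (x1 - rho) y1 A2 Iy1.
have b3 := hmax' x1 (y1 + rho) Ix1 A3; have b4 := hmax' x1 (y1 - rho) Ix1 A4.
have : 0 < delta * rho ^+ 2 by rewrite mulr_gt0 ?exprn_gt0.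
have E1 : delta / 2 * rho ^+ 2 = delta * rho ^+ 2 / 2 by ring.
have E2 : 4 * delta * rho ^+ 2 = 4 * (delta * rho ^+ 2) by ring.
move: vsum b1 b2 b3 b4 s1 s2 s3 s4; rewrite E1 E2 !(mulrDr (Num.conj c)) !cReD.
move: (v _) (v _) (v _) (v _) (v _) (complex.Re _) (complex.Re _) (complex.Re _)
  (complex.Re _) (delta * _) => ? ? ? ? ? ? ? ? ? ?; lra.
Qed.

End MaximumPrinciple.

(** * Vanishing on the strip of a function that vanishes on the real axis *)

Section StripUniquenessProof.
Variable R : realType.
Local Notation C := R[i].
Variable k : C -> C.
Hypothesis ck : forall z, strip 1 z -> forall e : R, 0 < e -> exists2 d : R, 0 < d &
  forall w, strip 1 w -> nrm (w - z) < d -> nrm (k w - k z) < e.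
Hypothesis dk : forall z, 0 < complex.Im z < 1 -> cdiff k z.
Hypothesis k0 : forall t : R, k t%:C = 0.

(** A 1-Lipschitz retraction of the plane onto the strip: it extends [k] continuously to the plane,
    where line primitives are available, without changing it on the strip. *)
Let clamp (z : C) : C := complex.Re z +i* Num.min 1 (Num.max 0 (complex.Im z)).
Let kk z := k (clamp z).

Let clamp_strip z : strip 1 (clamp z).
Proof.
by rewrite /strip /= ge_min lexx andbT le_min ler01 le_max lexx.
Qed.

Let clamp_id z : strip 1 z -> clamp z = z.
Proof.
rewrite /strip /= => /andP[z0 z1]; apply: eqC => //=.
by rewrite (max_idPr z0) (min_idPr z1).
Qed.

Let clamp_lip z w : nrm (clamp z - clamp w) <= nrm (z - w).
Proof.
rewrite -ler_sqr ?nnegrE ?nrm_ge0 // !nrm_sqr !cReB !cImB /= lerD2l.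
rewrite -[leLHS]real_normK ?num_real // -[leRHS]real_normK ?num_real //.
rewrite ler_sqr ?nnegrE //.
move: (complex.Im z) (complex.Im w) => a b.
have cl (s : R) : Num.min 1 (Num.max 0 s) = if s <= 0 then 0 else if s <= 1 then s else 1.
  case: (leP s 0) => h; first by rewrite min_r.
  by case: (leP s 1).
rewrite !cl; have := ler_norm (a - b); have := ler_norm (b - a); rewrite (distrC b).
by case: (leP a 0) => ha; case: (leP b 0) => hb; rewrite ?subrr ?normr0 //;
  try case: (leP a 1) => ha1; try case: (leP b 1) => hb1; rewrite ler_norml; lra.
Qed.

Let ckk z : eps_continuous kk z.
Proof.
move=> e e0; have [d d0 hd] := ck (clamp_strip z) e0; exists d => // w wz.
by apply: hd => //; apply: le_lt_trans (clamp_lip _ _) wz.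
Qed.

Let kkE z : strip 1 z -> kk z = k z.
Proof. by move=> h; rewrite /kk clamp_id. Qed.

Let dkk z : 0 < complex.Im z < 1 -> cdiff kk z.
Proof.
move=> /andP[z0 z1]; have [|b hb] := dk (z := z); first by rewrite z0.
exists b => e e0; have [d d0 hd] := hb e e0.
exists (Num.min d (Num.min (complex.Im z) (1 - complex.Im z))).
  by rewrite !lt_min d0 z0 subr_gt0.
move=> w; rewrite !lt_min => /and3P[wd w0 w1].
have := Im_le_nrm (w - z); rewrite cImB ler_norml => /andP[i1 i2].
rewrite !kkE; first exact: hd.
  by rewrite /strip /=; lra.
by rewrite /strip /=; lra.
Qed.

Local Notation hint := (hint ckk).
Local Notation vint := (vint ckk).
Local Notation rect := (rect ckk).

Let kk0 t : kk t%:C = 0.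
Proof. by rewrite kkE // /strip /= lexx ler01. Qed.

Let hint0 x1 x2 : hint 0 x1 x2 = 0.
Proof.
have := @hint_est _ _ ckk 0 0 0 0 x1 x2; rewrite /quad !mul0r !addr0 subrr subr0 mulr0 mul0r.
move=> h; apply: nrm_eq0; apply/eqP; rewrite eq_le nrm_ge0 andbT; apply: h => s _.
by rewrite complexr0 kk0 mul0r addr0 subrr nrm0.
Qed.

(** [kk] vanishes on the real axis; compactness of [[x1, x2]] makes its smallness near the axis
    uniform. *)
Let bottom_small x1 x2 (e : R) : 0 < e -> exists2 eta : R, 0 < eta &
  forall x y, x1 <= x <= x2 -> 0 <= y <= eta -> nrm (kk (x +i* y)) <= e.
Proof.
move=> e0.
have /compact_near_coveringP := @segment_compact R x1 x2.
move=> /(_ R (nbhs (0 : R)) (fun eta x => 0 <= eta -> forall y, 0 <= y <= eta -> nrm (kk (x +i* y)) <= e)).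
case=> [x _|/= d d0 hd].
  have [d d0 hd] := ckk x%:C e0.
  have d2 : 0 < d / 2 by rewrite divr_gt0.
  exists (ball x (d / 2), ball (0 : R) (d / 2)).
    by split; exact: nbhsx_ballx.
  move=> [x' eta] [/=]; rewrite /ball /= sub0r normrN => h1 h2 eta0 y /andP[y0 ye].
  have := hd (x' +i* y); rewrite kk0 subr0 => h; apply: ltW; apply: h.
  apply: le_lt_trans (nrm_le_ReIm _) _ => /=; rewrite subr0 distrC (ger0_norm y0).
  by rewrite (ger0_norm eta0) in h2; lra.
exists (d / 2); first by rewrite divr_gt0.
move=> x y hx hy; apply: (hd (d / 2)) => //.
- by rewrite /ball_ /= sub0r normrN gtr0_norm ?divr_gt0 //; lra.
- by rewrite divr_ge0 // ltW.
Qed.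

(** Differentiability is known only above the axis. A thin rectangle of height [m] on the axis is
    cut off, where [kk] is small, and Goursat's theorem handles the rest. *)
Let rect0_le x1 x2 y : x1 <= x2 -> 0 <= y -> y < 1 -> rect x1 x2 0 y = 0.
Proof.
move=> x12 y0 y1; apply: nrm_lt_all => e e0.
pose q := 4 * ((x2 - x1) + 1) + 1.
have q0 : 0 < q by rewrite /q; lra.
have [eta eta0 heta] := bottom_small x1 x2 (divr_gt0 e0 q0).
pose m := Num.min eta y.
have m0 : 0 <= m by rewrite le_min (ltW eta0).
have my : m <= y by rewrite ge_min lexx orbT.
have me : m <= eta by rewrite ge_min lexx.
have upper : rect x1 x2 m y = 0.
  move: (y0); rewrite le_eqVlt => /orP[/eqP y00|yp].
    have -> : m = y by rewrite /m (min_idPr _) // -y00 ltW.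
    by rewrite /rect /vint /line_int !subrr addr0 subr0 subrr.
  apply: goursat => // x v _ /andP[mv vy]; apply: dkk => /=.
  rewrite (lt_le_trans _ mv) ?(le_lt_trans vy) //.
  by rewrite /m lt_min eta0.
rewrite (rect_splity ckk m) upper addr0.
have hr : nrm (rect x1 x2 0 m) <= 4 * (e / q) * ((x2 - x1) + (m - 0)).
  apply: (@rect_est _ _ ckk 0 0) => // x v hx /andP[v0 vm].
  by rewrite mul0r addr0 subr0; apply: heta; rewrite // v0 (le_trans vm).
apply: le_lt_trans hr _.
have m1 : m <= 1 by rewrite (le_trans my) // ltW.
rewrite subr0 -[ltRHS]mulr1.
have -> : 4 * (e / q) * (x2 - x1 + m) = e * (4 * (x2 - x1 + m) / q) by ring.
rewrite ltr_pM2l // ltr_pdivrMr // /q; lra.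
Qed.

Let rect0 x1 x2 y : 0 <= y -> y < 1 -> rect x1 x2 0 y = 0.
Proof.
move=> y0 y1; have [h|/ltW h] := leP x1 x2; first exact: rect0_le.
by rewrite rect_antix rect0_le // oppr0.
Qed.

(* A primitive of [kk] vanishing on the real axis. *)
Let P (z : C) : C := vint (complex.Re z) 0 (complex.Im z).

(** Path independence: by [rect0], the vertical integral from the axis may be replaced by a
    horizontal step at height [Im z] and a vertical one above [Re z']; the bottom side contributes
    nothing. *)
Let P_diff z z' : 0 <= complex.Im z -> complex.Im z < 1 ->
  P z' - P z = vint (complex.Re z') (complex.Im z) (complex.Im z') +
               hint (complex.Im z) (complex.Re z) (complex.Re z').
Proof.
move=> z0 z1; have := rect0 (complex.Re z) (complex.Re z') z0 z1.
rewrite /rect hint0 add0r => /eqP; rewrite subr_eq0 subr_eq => /eqP h.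
have -> : P z' = vint (complex.Re z') 0 (complex.Im z) +
    vint (complex.Re z') (complex.Im z) (complex.Im z').
  by rewrite /P /vint /line_int; ring.
by rewrite h /P; ring.
Qed.

Let P_est (a b z z' : C) (eta : R) : 0 <= complex.Im z -> complex.Im z < 1 ->
  (forall w, nrm (w - z) <= `|complex.Re z' - complex.Re z| + `|complex.Im z' - complex.Im z| ->
     nrm (kk w - (a + b * w)) <= eta) ->
  nrm (P z' - P z - (quad a b z' - quad a b z)) <=
    2 * eta * (`|complex.Re z' - complex.Re z| + `|complex.Im z' - complex.Im z|).
Proof.
case: z z' => x y [x' y'] /= y0 y1 h; rewrite P_diff //=.
have hh : nrm (hint y x x' - (quad a b (x' +i* y) - quad a b (x +i* y))) <=
    2 * eta * `|x' - x|.
  apply: hint_est => s hs; apply: h.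
  apply: le_trans (nrm_le_ReIm _) _ => /=; rewrite subrr normr0 lerD //.
  move: hs; have [xx|xx] := leP x x' => hs.
    by rewrite !ger0_norm ?subr_ge0 ?lerD2r //; move: hs => /andP[].
  by rewrite !ler0_norm ?subr_le0 ?lerN2 ?lerD2r ?(ltW xx) //; move: hs => /andP[].
have hv : nrm (vint x' y y' - (quad a b (x' +i* y') - quad a b (x' +i* y))) <=
    2 * eta * `|y' - y|.
  apply: vint_est => s hs; apply: h.
  apply: le_trans (nrm_le_ReIm _) _ => /=; rewrite lerD2l.
  move: hs; have [xx|xx] := leP y y' => hs.
    by rewrite !ger0_norm ?subr_ge0 ?lerD2r //; move: hs => /andP[].
  by rewrite !ler0_norm ?subr_le0 ?lerN2 ?lerD2r ?(ltW xx) //; move: hs => /andP[].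
have -> : vint x' y y' + hint y x x' - (quad a b (x' +i* y') - quad a b (x +i* y)) =
  (hint y x x' - (quad a b (x' +i* y) - quad a b (x +i* y))) +
  (vint x' y y' - (quad a b (x' +i* y') - quad a b (x' +i* y))) by ring.
apply: le_trans (ler_nrmD _ _) _; rewrite mulrDr; exact: lerD.
Qed.

Let P0 (x : R) : P x%:C = 0.
Proof. by rewrite /P /vint /line_int subrr. Qed.

Let taxi (z z' : C) :
  `|complex.Re z' - complex.Re z| + `|complex.Im z' - complex.Im z| <= 2 * nrm (z' - z).
Proof.
by have := Re_le_nrm (z' - z); have := Im_le_nrm (z' - z); rewrite cReB cImB; lra.
Qed.

Let P_cont z (e : R) : 0 <= complex.Im z -> complex.Im z < 1 -> 0 < e ->
  exists2 d : R, 0 < d & forall w, nrm (w - z) < d -> nrm (P w - P z) < e.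
Proof.
move=> z0 z1 e0; have [d d0 hd] := ckk z ltr01.
pose M := nrm (kk z) + 1; have M0 : 0 < M by rewrite ltr_wpDl ?nrm_ge0.
exists (Num.min (d / 2) (e / (8 * M))); first by rewrite lt_min !divr_gt0 // mulr_gt0.
move=> w; rewrite lt_min => /andP[wd]; rewrite ltr_pdivlMr ?mulr_gt0 // => we.
have tw := taxi z w.
have := @P_est 0 0 z w M z0 z1; rewrite /quad !mul0r !addr0 subrr subr0.
move=> h; apply: le_lt_trans (h _) _ => [v vz|].
  rewrite !mul0r addr0 subr0 /M -{1}[kk v](subrK (kk z)) addrC.
  apply: le_trans (ler_nrmD _ _) _; rewrite lerD2l ltW // hd //.
  apply: le_lt_trans vz _; lra.
have := nrm_ge0 (w - z); nra.
Qed.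

(** Integrating the affine approximation of [kk] at [z] gives a quadratic approximation of [P], with
    linear coefficient [kk z]. *)
Let P_second_order z : 0 < complex.Im z < 1 -> exists a c, forall e : R, 0 < e ->
  exists2 d : R, 0 < d & forall h, nrm h < d ->
    nrm (P (z + h) - (a + kk z * h + c * h ^+ 2)) <= e * nrm h ^+ 2.
Proof.
move=> /andP[z0 z1]; have [|b hb] := dkk (z := z); first by rewrite z0.
(* The 8 absorbs three factors 2: the one of [P_est], and twice the comparison of the taxicab norm
   with [nrm]. *)
exists (P z), (b / 2) => e e0; have [|d d0 hd] := hb (e / 8); first by rewrite divr_gt0.
exists (d / 2); first by rewrite divr_gt0.
move=> h hh; have tw := taxi z (z + h).
rewrite (_ : z + h - z = h) in tw; last by ring.
have := @P_est (kk z - b * z) b z (z + h) (e / 8 * (2 * nrm h)) (ltW z0) z1.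
have -> : quad (kk z - b * z) b (z + h) - quad (kk z - b * z) b z =
   kk z * h + b / 2 * h ^+ 2 by rewrite /quad; field.
move=> hP.
have -> : P (z + h) - (P z + kk z * h + b / 2 * h ^+ 2) =
  P (z + h) - P z - (kk z * h + b / 2 * h ^+ 2) by ring.
apply: le_trans (hP _) _ => [w hw|].
  have -> : kk w - (kk z - b * z + b * w) = kk w - kk z - b * (w - z) by ring.
  have wh : nrm (w - z) <= 2 * nrm h by exact: le_trans hw tw.
  apply: le_trans (hd _ _) _; first by apply: le_lt_trans wh _; lra.
  by rewrite ler_wpM2l // divr_ge0 // ltW.
have := nrm_ge0 h; have := mulr_ge0 (ltW e0) (nrm_ge0 h); nra.
Qed.

(* If [P] vanishes below height [c], the product of its four rotations about
   [x + i (c + r)] vanishes on the boundary of the square of half side [r]. *)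
Let P_climb (c : R) : 0 <= c < 1 ->
  (forall z, 0 <= complex.Im z <= c -> P z = 0) ->
  forall z, c < complex.Im z -> complex.Im z <= c + (1 - c) / 3 -> P z = 0.
Proof.
move=> /andP[c0 c1] hc z0 z0c z0d; pose r := complex.Im z0 - c.
have r0 : 0 < r by rewrite subr_gt0.
pose rot j : C := 'i%C ^+ j.
have nrot j : nrm (rot j) = 1.
  by elim: j => [|j ih]; rewrite /rot ?expr0 ?nrm1 // exprS nrmM nrmi ih mulr1.
have rotE : [/\ rot 0%N = 1, rot 1%N = 'i%C, rot 2%N = -1 & rot 3%N = - 'i%C].
  by rewrite /rot expr0 expr1 sqr_i exprS sqr_i mulrN1.
pose G w := P (z0 + rot 0%N * w) * P (z0 + rot 1%N * w) *
            (P (z0 + rot 2%N * w) * P (z0 + rot 3%N * w)).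
have ims w : [/\ complex.Im (z0 + rot 0%N * w) = complex.Im z0 + complex.Im w,
    complex.Im (z0 + rot 1%N * w) = complex.Im z0 + complex.Re w,
    complex.Im (z0 + rot 2%N * w) = complex.Im z0 - complex.Im w &
    complex.Im (z0 + rot 3%N * w) = complex.Im z0 - complex.Re w].
  have [-> -> -> ->] := rotE.
  rewrite !cImD !cImM /= oppr0; split; ring.
(* The square reaches height [Im z0 + r], at most [c + 2 * (1 - c) / 3], below 1; hence the third in
   the statement. *)
have region w : square r w -> forall j, (j < 4)%N ->
    c <= complex.Im (z0 + rot j * w) < 1.
  rewrite /square /= !ler_norml => -[/andP[w1 w2] /andP[w3 w4]] j.
  have [i0 i1 i2 i3] := ims w; move: w1 w2 w3 w4; rewrite /r.
  by case: j => [|[|[|[|//]]]] w1 w2 w3 w4 _; rewrite ?i0 ?i1 ?i2 ?i3; lra.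
have interior w : `|complex.Re w| < r -> `|complex.Im w| < r -> forall j, (j < 4)%N ->
    0 < complex.Im (z0 + rot j * w) < 1.
  rewrite !ltr_norml => /andP[w1 w2] /andP[w3 w4] j.
  have [i0 i1 i2 i3] := ims w; move: w1 w2 w3 w4; rewrite /r.
  by case: j => [|[|[|[|//]]]] w1 w2 w3 w4 _; rewrite ?i0 ?i1 ?i2 ?i3; lra.
have Pj_cont j : (j < 4)%N -> continuous_on (square r) (fun w => P (z0 + rot j * w)).
  move=> j4 w hw e e0; have /andP[h1 h2] := region w hw j j4.
  have [d d0 hd] := P_cont (le_trans c0 h1) h2 e0; exists d => // v _ vw.
  by apply: hd; rewrite opprD addrACA subrr add0r -mulrBr nrmM nrot mul1r.
have cmul (f g : C -> C) : continuous_on (square r) f -> continuous_on (square r) g ->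
    continuous_on (square r) (fun w => f w * g w).
  move=> cf cg w hw e e0; pose M := nrm (f w) + nrm (g w) + 1 + 1.
  have M0 : 0 < M by rewrite /M; have := nrm_ge0 (f w); have := nrm_ge0 (g w); lra.
  pose e' := Num.min 1 (e / M); have e'0 : 0 < e' by rewrite lt_min ltr01 divr_gt0.
  have e'1 : e' <= 1 by rewrite ge_min lexx.
  have e'M : e' * M <= e by rewrite -ler_pdivlMr // ge_min lexx orbT.
  have [d1 d10 h1] := cf w hw e' e'0; have [d2 d20 h2] := cg w hw e' e'0.
  exists (Num.min d1 d2); first by rewrite lt_min d10.
  move=> v hv; rewrite lt_min => /andP[/(h1 v hv) {}h1 /(h2 v hv) {}h2].
  have -> : f v * g v - f w * g w = (f v - f w) * (g v - g w) + (f v - f w) * g w +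
     f w * (g v - g w) by ring.
  apply: le_lt_trans (ler_nrmD _ _) _.
  have := ler_nrmD ((f v - f w) * (g v - g w)) ((f v - f w) * g w); rewrite !nrmM.
  have := nrm_ge0 (f w); have := nrm_ge0 (g w).
  have := nrm_ge0 (f v - f w); have := nrm_ge0 (g v - g w).
  move: h1 h2; rewrite /M in e'M.
  set a := nrm (f v - f w); set b := nrm (g v - g w); set A := nrm (f w); set B := nrm (g w).
  move=> h1 h2 b0 a0 B0 A0 h3.
  have : a * b <= e' * 1 by apply: ler_pM => //; lra.
  have : a * B <= e' * B by rewrite ler_wpM2r // ltW.
  have : A * b <= A * e' by rewrite ler_wpM2l // ltW.
  rewrite /M in e'M; lra.
have so j w : (j < 4)%N -> `|complex.Re w| < r -> `|complex.Im w| < r ->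
    second_order (fun u => P (z0 + rot j * u)) w.
  move=> j4 w1 w2; apply: second_order_rot; first exact: nrot.
  have [a [k2 h]] := P_second_order (interior w w1 w2 j j4).
  by exists a, (kk (z0 + rot j * w)), k2.
have : G 0 = 0.
  apply: (@square_maximum_principle _ G r r0).
  - exact: (cmul _ _ (cmul _ _ (Pj_cont 0%N isT) (Pj_cont 1%N isT))
      (cmul _ _ (Pj_cont 2%N isT) (Pj_cont 3%N isT))).
  - move=> w w1 w2.
    by apply: second_order_mul; apply: second_order_mul; exact: so.
  move=> w hw hb.
  (* On each side of the square, one of the four rotated points lies exactly at height [c], where
     [P] is known to vanish. *)
  have edge j : (j < 4)%N -> complex.Im (z0 + rot j * w) = c -> P (z0 + rot j * w) = 0.
    by move=> j4 hj; apply: hc; rewrite hj lexx c0.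
  have [i0 i1 i2 i3] := ims w; rewrite /G; case: hb => hb.
    have [h|h] := leP 0 (complex.Re w).
      rewrite (edge 3%N) ?mulr0 //; rewrite i3 -(ger0_norm h) hb /r; ring.
    rewrite (edge 1%N) ?mulr0 ?mul0r //.
    by rewrite i1 -[complex.Re w]opprK -(ltr0_norm h) hb /r; ring.
  have [h|h] := leP 0 (complex.Im w).
    by rewrite (edge 2%N) ?mul0r ?mulr0 //; rewrite i2 -(ger0_norm h) hb /r; ring.
  rewrite (edge 0%N) ?mulr0 ?mul0r //.
  by rewrite i0 -[complex.Im w]opprK -(ltr0_norm h) hb /r; ring.
(* At the centre the four factors coincide, so [G 0] is the fourth power of [P z0]. *)
rewrite /G !mulr0 !addr0 => /eqP; rewrite !mulf_eq0 !orbb => /eqP //.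
Qed.

(** One climb turns height [c] into [c + (1 - c) / 3], that is [1 - c] into [2 / 3 * (1 - c)]; the
    heights [1 - (2 / 3) ^+ n] exhaust the strip. *)
Let P_zero z : 0 <= complex.Im z < 1 -> P z = 0.
Proof.
have key n : forall z, 0 <= complex.Im z <= 1 - (2 / 3) ^+ n -> P z = 0.
  elim: n => [|n ih] w; first rewrite expr0 subrr -eq_le => /eqP h.
    by rewrite /P -h /vint /line_int subrr.
  have p0 : 0 < (2 / 3 : R) ^+ n by rewrite exprn_gt0 // divr_gt0.
  have p1 : (2 / 3 : R) ^+ n <= 1 by rewrite exprn_ile1 // ?divr_ge0 //; lra.
  move=> /andP[w0]; rewrite exprS => w1.
  have [h|h] := leP (complex.Im w) (1 - (2 / 3) ^+ n); first by apply: ih; rewrite w0.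
  by apply: (P_climb _ ih h); [rewrite subr_ge0 p1 ltrBlDr ltrDl p0 | lra].
move=> /andP[z0 z1]; have [n hn] : exists n, (2 / 3 : R) ^+ n < 1 - complex.Im z.
  have d0 : 0 < 1 - complex.Im z by rewrite subr_gt0.
  have [N _ hN] : \forall n \near \oo, (2 / 3 : R) ^+ n < 1 - complex.Im z.
    have := @cvg_expr R (2 / 3); rewrite ger0_norm ?divr_ge0 // => /(_ _)h.
    have /cvgrPdist_lt/(_ _ d0) : (fun n => (2 / 3 : R) ^+ n) @ \oo --> (0 : R).
      by apply: h; lra.
    apply: filterS => n; rewrite sub0r normrN; apply: le_lt_trans; exact: ler_norm.
  by exists N; apply: (hN N) => /=.
by apply: (key n); rewrite z0 /=; lra.
Qed.

(** [P] vanishes in the strip, hence so does the linear coefficient [kk z] of its expansion. Real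
    increments [s] are used, as they do not change the height. *)
Let k_interior z : 0 < complex.Im z < 1 -> k z = 0.
Proof.
move=> /andP[z0 z1]; have [|a [c hac]] := P_second_order (z := z); first by rewrite z0.
have aE : a = 0.
  apply: nrm_lt_all => e e0; have [d d0 hd] := hac 1 ltr01.
  have := hd 0; rewrite nrm0 => /(_ d0); rewrite addr0 P_zero ?(ltW z0) //.
  rewrite !mulr0 expr0n /= mulr0 !addr0 sub0r nrmN expr0n /= mulr0 => h.
  exact: le_lt_trans h e0.
have <- : kk z = k z by rewrite kkE // /strip /= !ltW.
apply: nrm_lt_all => e e0; have [d d0 hd] := hac 1 ltr01.
pose q := nrm c + 1 + 1; have q0 : 0 < q by rewrite /q; have := nrm_ge0 c; lra.
pose s := Num.min (Num.min (d / 2) (e / q)) (1 - complex.Im z).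
have s0 : 0 < s by rewrite !lt_min !divr_gt0 // subr_gt0.
have sd : s <= d / 2 by rewrite !ge_min lexx.
have se : s <= e / q by rewrite !ge_min lexx orbT.
rewrite ler_pdivlMr // in se.
have := hd s%:C; rewrite nrm_real gtr0_norm // P_zero; last first.
  by rewrite cImD /= addr0 (ltW z0).
rewrite sub0r nrmN aE add0r => h.
have {}h : nrm (kk z * s%:C + c * s%:C ^+ 2) <= s ^+ 2.
  by rewrite -[leRHS]mul1r; apply: h; lra.
have := ler_nrmB (kk z * s%:C + c * s%:C ^+ 2) (c * s%:C ^+ 2); rewrite addrK.
rewrite !nrmM nrm_real gtr0_norm //.
move=> h2; have : nrm (kk z) * s <= (nrm c + 1) * s * s by nra.
rewrite ler_pM2r // => h3; apply: le_lt_trans h3 _; rewrite /q in se; nra.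
Qed.

(** The point [i] lies on the upper edge; continuity carries the vanishing there from the interior
    points [i * (1 - s)]. *)
Lemma strip_uniqueness : k 'i%C = 0.
Proof.
apply: nrm_lt_all => e e0; have [|d d0 hd] := ck (z := 'i%C) _ e0.
  by rewrite /strip /= lexx ler01.
pose s := Num.min (d / 2) (1 / 2).
have s0 : 0 < s by rewrite lt_min !divr_gt0.
have sd : s <= d / 2 by rewrite ge_min lexx.
have s1 : s <= 1 / 2 by rewrite ge_min lexx orbT.
have h : 0 < complex.Im (0 +i* (1 - s) : C) < 1 by rewrite /=; lra.
have := hd (0 +i* (1 - s)); rewrite (k_interior h) sub0r nrmN; apply.
  by rewrite /strip /=; lra.
apply: le_lt_trans (nrm_le_ReIm _) _; rewrite /= subrr normr0 add0r.
by rewrite (_ : 1 - s - 1 = - s) ?normrN ?gtr0_norm //; lra.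
Qed.

End StripUniquenessProof.

(** * The multiplicative unitary as a multiplier *)

Section FiniteSums.
Variables (R : realType) (H : hilbert R) (S : set (H -> H)).

Lemma finite_sums_elim (P : (H -> H) -> Prop) :
  P 0 -> (forall X T, S X -> P T -> P (X + T)) -> forall T, finite_sums S T -> P T.
Proof.
move=> P0 PD T [n [X [SX ->]]]; elim: n X SX => [|n ih] X SX.
  by rewrite big_ord0.
by rewrite big_ord_recl; apply: PD => //; apply: ih => i; exact: SX.
Qed.

Lemma finite_sums0 : finite_sums S 0.
Proof. by exists 0%N, (fun=> 0); split=> [[]//|]; rewrite big_ord0. Qed.

Lemma finite_sums1 X : S X -> finite_sums S X.
Proof. by move=> SX; exists 1%N, (fun=> X); split=> //; rewrite big_ord1. Qed.

Lemma finite_sumsD X Y : finite_sums S X -> finite_sums S Y -> finite_sums S (X + Y).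
Proof.
move=> [n [f [Sf ->]]] [m [g [Sg ->]]].
exists (n + m)%N, (fun i => match fintype.split i with inl j => f j | inr j => g j end).
split=> [i|]; first by case: (fintype.split i).
rewrite big_split_ord /=; congr (_ + _); apply: eq_bigr => i _.
  by rewrite (unsplitK (inl i)).
by rewrite (unsplitK (inr i)).
Qed.

Lemma finite_sums_sum I (r : seq I) (F : I -> H -> H) :
  (forall i, finite_sums S (F i)) -> finite_sums S (\sum_(i <- r) F i).
Proof.
by move=> h; apply: big_ind => //; [exact: finite_sums0 | exact: finite_sumsD].
Qed.

Lemma finite_sums_blin : (forall X, S X -> blin X) -> forall T, finite_sums S T -> blin T.
Proof.
by move=> h; apply: finite_sums_elim; [exact: blin_0 | move=> X T /h; exact: blin_D].
Qed.

End FiniteSums.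

(** * Finite rank approximation of compact operators *)

Section CompactApproximation.
Variables (R : realType) (H : hilbert R).
Local Notation C := R[i].

Definition rank_one (eta xi z : H) : H := inner z xi *: eta.

Lemma rank_one_bound eta xi z : nrm (rank_one eta xi z) <= nrm eta * nrm xi * nrm z.
Proof.
rewrite nrmZ mulrC -mulrA ler_wpM2l ?nrm_ge0 // [leRHS]mulrC; exact: cauchy_schwarz.
Qed.

Lemma blin_rank_one eta xi : blin (rank_one eta xi).
Proof.
split=> [c x y|]; first by rewrite /rank_one innerDl innerZl scalerDl scalerA.
exists (nrm eta * nrm xi); first by rewrite mulr_ge0 ?nrm_ge0.
exact: rank_one_bound.
Qed.

Lemma compact_disc (v : H) (M : R) :
  compact [set c *: v | c in [set c : C | `|complex.Re c| <= M /\ `|complex.Im c| <= M]].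
Proof.
pose I : set R := `[(- M), M]%classic.
pose g (p : R * R) : H := (p.1 +i* p.2) *: v.
suff -> : [set c *: v | c in [set c : C | `|complex.Re c| <= M /\ `|complex.Im c| <= M]] =
    g @` (I `*` I).
  apply: continuous_compact; last by apply: compact_setX; exact: segment_compact.
  apply: continuous_subspaceT => -[x y]; apply/cvgrPdist_lt => e e0.
  have e0' : 0 < complex.Re e by move: e0; rewrite ltcE /= => /andP[].
  have eE : e = (complex.Re e)%:C by rewrite RRe_real // gtr0_real.
  have q0 : 0 < nrm v + 1 by rewrite ltr_wpDl ?nrm_ge0.
  pose d := complex.Re e / (2 * (nrm v + 1)).
  have d0 : 0 < d by rewrite divr_gt0 // mulr_gt0.
  exists (ball x d, ball y d); first by split; exact: nbhsx_ballx.
  move=> [x' y'] [/=]; rewrite /ball /= => bx by'.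
  rewrite eE nrmE ltcR /g /= -scalerBl nrmZ.
  have h : nrm ((x +i* y) - (x' +i* y') : C) < d + d.
    by apply: le_lt_trans (nrm_le_ReIm _) _; exact: ltrD.
  have dE : (d + d) * (nrm v + 1) = complex.Re e by rewrite /d; field; rewrite gt_eqF.
  rewrite -dE; apply: (@le_lt_trans _ _ (nrm ((x +i* y) - (x' +i* y') : C) * (nrm v + 1))).
    by rewrite ler_wpM2l ?nrm_ge0 // lerDl.
  by rewrite ltr_pM2r.
apply/seteqP; split=> [_ [[a b] /= [ha hb] <-]|_ [[a b] /= [ha hb] <-]].
  by exists (a, b) => //; split; rewrite /I /= in_itv /= -ler_norml.
exists (a +i* b) => //=; split; rewrite ler_norml.
  by move: ha; rewrite /I /= in_itv.
by move: hb; rewrite /I /= in_itv.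
Qed.

Lemma hilbert_hausdorff : hausdorff_space H.
Proof. exact: norm_hausdorff. Qed.

Lemma compact_rank_one eta xi : compact_op (rank_one eta xi).
Proof.
split; first by apply/bounded_opP; exact: blin_rank_one.
have cK := @compact_disc eta (nrm xi).
apply: (@precompact_subset _ _ [set c *: eta | c in [set c : C |
   `|complex.Re c| <= nrm xi /\ `|complex.Im c| <= nrm xi]]).
  move=> _ [x /= x1 <-]; exists (inner x xi) => //=.
  have h : nrm (inner x xi) <= nrm xi.
    apply: le_trans (cauchy_schwarz _ _) _; rewrite ler_piMl ?nrm_ge0 //.
    by rewrite -lecR -nrmE.
  by split; apply: le_trans h; [exact: Re_le_nrm | exact: Im_le_nrm].
by apply: compact_precompact => //; exact: hilbert_hausdorff.
Qed.

Lemma totally_bounded_compact (Y : H -> H) (e : R) : compact_op Y -> 0 < e ->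
  exists s : seq H, forall x, nrm x <= 1 -> exists2 y, y \in s & nrm (Y x - y) < e.
Proof.
move=> [_]; rewrite precompactE compact_cover => cY e0.
have [||D' _ hD'] := cY H setT (fun y => ball y e%:C).
- by move=> y _; exact: ball_open.
- by move=> y _; exists y => //; apply: ballxx; rewrite ltcR.
exists (finmap.enum_fset D') => x x1.
have : closure (Y @` [set x | `|x| <= 1]) (Y x).
  by apply: subset_closure; exists x => //=; rewrite nrmE lecR.
move=> /hD' [y /= yD]; rewrite -ball_normE /= nrmE ltcR nrmC => h.
by exists y.
Qed.

(* [Y] is approximated by [P Y], with [P] the projection onto the span of an
   orthonormal family of vectors of [D] approximating a finite net of the image
   of the unit ball. *)
Lemma compact_finite_rank (D : set H) (Y : H -> H) (e : R) :
  dense D -> D 0 -> (forall c x y, D x -> D y -> D (c *: x + y)) ->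
  compact_op Y -> 0 < e ->
  exists (n : nat) (u : nat -> H), (forall i, D (u i)) /\
    near_op e Y (\sum_(i < n) rank_one (u i) (hadj Y (u i))).
Proof.
move=> /denseP dD D0 hD cY e0; have bY : blin Y by case: cY => /bounded_opP.
have e2 : 0 < e / 2 by rewrite divr_gt0.
have [s hs] := totally_bounded_compact cY e2.
have /choice[g hg] y : exists y', D y' /\ nrm (y - y') < e / 2.
  by have [y' Dy' h] := dD y _ e2; exists y'.
have [|n [u [Du ou hu]]] := @gram_schmidt R H D (map g s) hD D0.
  by move=> _ /mapP[y _ ->]; exact: (hg y).1.
exists n, u; split=> //.
have sumE x : (\sum_(i < n) rank_one (u i) (hadj Y (u i))) x =
    \sum_(i < n) inner (Y x) (u i) *: u i.
  by rewrite fct_sumE; apply: eq_bigr => i _; rewrite /rank_one hadjP.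
have hunit x : nrm x <= 1 -> nrm (Y x - \sum_(i < n) inner (Y x) (u i) *: u i) <= e.
  move=> x1; have [y ys hy] := hs x x1; pose y' := g y.
  have y'E := hu y' (map_f g ys).
  (* The family spans [y'], so subtracting [y'] does not change the residue, and the residue of
     [Y x - y'] is bounded by its norm. *)
  have -> : Y x - \sum_(i < n) inner (Y x) (u i) *: u i =
      (Y x - y') - \sum_(i < n) inner (Y x - y') (u i) *: u i.
    have -> : \sum_(i < n) inner (Y x - y') (u i) *: u i =
       \sum_(i < n) inner (Y x) (u i) *: u i - y'.
      rewrite [in RHS]y'E -sumrB; apply: eq_bigr => i _.
      by rewrite innerBl scalerBl.
    by rewrite opprB addrA subrK.
  apply: le_trans (bessel_residue _ ou) _.
  apply: le_trans (nrm_triangle y _ _) _.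
  by apply: ltW; rewrite [ltRHS]splitr; apply: ltrD => //; exact: (hg y).2.
move=> x; rewrite sumE; have [x0|x0] := eqVneq (nrm x) 0.
  rewrite (nrm_eq0 x0) (blin0 bY) big1 ?subrr ?nrm0 ?mulr0 // => i _.
  by rewrite inner0l scale0r.
have n0 : 0 < nrm x by rewrite lt_neqAle eq_sym x0 nrm_ge0.
have := hunit ((nrm x)^-1%:C *: x).
rewrite nrmZ nrm_real ger0_norm ?invr_ge0 ?nrm_ge0 // mulVf // lexx => /(_ isT).
rewrite blinZ // (eq_bigr (fun i : 'I_n => (nrm x)^-1%:C *: (inner (Y x) (u i) *: u i))).
  rewrite -scaler_sumr -scalerBr nrmZ nrm_real ger0_norm ?invr_ge0 ?nrm_ge0 //.
  by rewrite ler_pdivrMl // mulrC.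
by move=> i _; rewrite innerZl scalerA.
Qed.

End CompactApproximation.

(** * Operators on the Hilbert space tensor product *)

Section HilbertTensorTheory.
Variables (R : realType) (H HH : hilbert R).
Local Notation C := R[i].

Lemma hilbert_tensor_swap (ten : H -> H -> HH) :
  hilbert_tensor ten -> hilbert_tensor (fun x y => ten y x).
Proof.
move=> [[b1 b2] i d]; split=> [|x y x' y'|]; first by split.
  by rewrite i mulrC.
apply/denseP => v e e0; have [_ [n [x [y ->]]] h] := (iffLR (denseP _) d) v e e0.
by exists (\sum_(j < n) ten (x j) (y j)) => //; exists n, y, x.
Qed.

Section Bounds.
Variable ten : H -> H -> HH.
Hypothesis hten : hilbert_tensor ten.

Let tenl y : linear (ten^~ y). Proof. by case: hten => -[]. Qed.
Let tenr x : linear (ten x). Proof. by case: hten => -[]. Qed.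

Lemma nrm_ten x y : nrm (ten x y) = nrm x * nrm y.
Proof.
apply/eqP; rewrite -(@eqrXn2 _ 2) ?mulr_ge0 ?nrm_ge0 //; apply/eqP.
case: hten => _ i _; apply: complexI; rewrite -innerxx i !innerxx -rmorphM /=.
by rewrite exprMn.
Qed.

Lemma nrm_ten_sum n (u : nat -> H) (w : nat -> H) : orthonormal_family n u ->
  nrm (\sum_(i < n) ten (u i) (w i)) ^+ 2 = \sum_(i < n) nrm (w i) ^+ 2.
Proof.
move=> ou; apply: complexI; rewrite -innerxx inner_suml rmorph_sum.
apply: eq_bigr => i _; rewrite inner_sumr (bigD1 i) //= big1 => [|j ji].
  by case: hten => _ -> _; rewrite ou // eqxx mul1r innerxx addr0.
by case: hten => _ -> _; rewrite ou // eq_sym -val_eqE in ji *; rewrite (negbTE ji) mul0r.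
Qed.

(** Rewriting the left legs in an orthonormal family makes the norm of the sum a sum of squares, on
    which [Z] acts term by term. *)
Lemma ten_bound_r n (x y : 'I_n -> H) (Z : H -> H) (M : R) : blin Z -> 0 <= M ->
  (forall v, nrm (Z v) <= M * nrm v) ->
  nrm (\sum_(i < n) ten (x i) (Z (y i))) <= M * nrm (\sum_(i < n) ten (x i) (y i)).
Proof.
move=> bZ M0 hM.
have [//|//|//|m [u [_ ou hu]]] := @gram_schmidt R H setT (map x (enum 'I_n)).
have xE i : x i = \sum_(k < m) inner (x i) (u k) *: u k.
  by apply: hu; apply: map_f; rewrite mem_enum.
have sumE (g : 'I_n -> H) : \sum_(i < n) ten (x i) (g i) =
    \sum_(k < m) ten (u k) (\sum_(i < n) inner (x i) (u k) *: g i).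
  rewrite (eq_bigr (fun i => \sum_(k < m) inner (x i) (u k) *: ten (u k) (g i))).
    rewrite exchange_big; apply: eq_bigr => k _ /=.
    by rewrite (linear_sum_fun _ _ (tenr (u k))); apply: eq_bigr => i _; rewrite (linearZZ _ _ (tenr _)).
  move=> i _; rewrite {1}(xE i) (linear_sum_fun _ _ (tenl (g i))).
  by apply: eq_bigr => k _; rewrite (linearZZ _ _ (tenl _)).
rewrite !sumE -ler_sqr ?nnegrE ?mulr_ge0 ?nrm_ge0 // exprMn.
rewrite (nrm_ten_sum (fun k => \sum_(i < n) inner (x i) (u k) *: Z (y i)) ou).
rewrite (nrm_ten_sum (fun k => \sum_(i < n) inner (x i) (u k) *: y i) ou).
rewrite mulr_sumr; apply: ler_sum => k _.
have -> : \sum_(i < n) inner (x i) (u k) *: Z (y i) =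
    Z (\sum_(i < n) inner (x i) (u k) *: y i).
  by rewrite blin_sum //; apply: eq_bigr => i _; rewrite blinZ.
by rewrite -exprMn ler_sqr ?nnegrE ?mulr_ge0 ?nrm_ge0.
Qed.

End Bounds.

Variable ten : H -> H -> HH.
Hypothesis hten : hilbert_tensor ten.

Let tenl y : linear (ten^~ y). Proof. by case: hten => -[]. Qed.
Let tenr x : linear (ten x). Proof. by case: hten => -[]. Qed.

(** On finite sums of elementary tensors, the bound is applied one leg at a time; density and
    boundedness of [T] give the rest. *)
Lemma op_tensor_bound (X Z : H -> H) T (M N : R) : is_op_tensor ten X Z T ->
  blin X -> blin Z -> 0 <= M -> 0 <= N ->
  (forall v, nrm (X v) <= M * nrm v) -> (forall v, nrm (Z v) <= N * nrm v) ->
  forall v, nrm (T v) <= N * M * nrm v.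
Proof.
move=> [/bounded_opP bT hT] bX bZ M0 N0 hM hN v.
have fin n (x y : 'I_n -> H) : nrm (T (\sum_(i < n) ten (x i) (y i))) <=
    N * M * nrm (\sum_(i < n) ten (x i) (y i)).
  rewrite blin_sum // (eq_bigr (fun i => ten (X (x i)) (Z (y i)))) //.
  apply: le_trans (ten_bound_r hten (fun i => X (x i)) y bZ N0 hN) _.
  rewrite -mulrA ler_wpM2l //.
  exact: (ten_bound_r (hilbert_tensor_swap hten) y x bX M0 hM).
case: (hten) => _ _ /denseP dD; case: (bT) => _ [K K0 hK].
apply/ler_addgt0Pl => e e0; have q0 : 0 < K + N * M + 1.
  by rewrite ltr_wpDl // addr_ge0 // mulr_ge0.
have [_ [n [x [y ->]]] h] := dD v _ (divr_gt0 e0 q0).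
set w := \sum_(i < n) _ in h; rewrite ltr_pdivlMr // in h.
have := fin n x y; rewrite -/w => hw.
have := hK (v - w); rewrite blinB // => h1.
have := ler_nrmD (T v - T w) (T w); rewrite subrK => h2.
have := ler_nrmB v (v - w); rewrite subKr => h3.
have NM : 0 <= N * M by rewrite mulr_ge0.
have h4 : N * M * nrm w <= N * M * (nrm v + nrm (v - w)) by rewrite ler_wpM2l.
have := nrm_ge0 (v - w); nra.
Qed.

Definition leg (y x : H) : HH := ten x y.

Lemma blin_leg y : blin (leg y).
Proof.
split=> [c u v|]; first exact: tenl.
by exists (nrm y) => [|x]; rewrite ?nrm_ge0 // /leg (nrm_ten hten) mulrC.
Qed.

Lemma hadj_leg y x z : hadj (leg y) (ten x z) = inner z y *: x.
Proof.
apply: inner_eqr => u; rewrite -hadjP; last exact: blin_leg.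
by case: hten => _ i _; rewrite /leg i innerZr inner_conj mulrC.
Qed.

(** The operator [X (x) |eta><xi|]; as a composite with legs, it is defined on all of [HH] without
    an extension by continuity. *)
Definition leg_op (X : H -> H) (eta xi : H) : HH -> HH := leg eta \o X \o hadj (leg xi).

Lemma blin_leg_op X eta xi : blin X -> blin (leg_op X eta xi).
Proof.
move=> bX; apply: blin_comp; last exact/blin_hadj/blin_leg.
by apply: blin_comp => //; exact: blin_leg.
Qed.

Lemma leg_op_tensor X eta xi : blin X -> is_op_tensor ten X (rank_one eta xi) (leg_op X eta xi).
Proof.
move=> bX; split; first by apply/bounded_opP; exact: blin_leg_op.
move=> x y; rewrite /leg_op /= hadj_leg blinZ // /leg /rank_one.
by rewrite (linearZZ _ _ (tenl _)) (linearZZ _ _ (tenr _)).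
Qed.

Lemma leg_op_bound X eta xi (M : R) : 0 <= M -> (forall v, nrm (X v) <= M * nrm v) ->
  forall v, nrm (leg_op X eta xi v) <= nrm eta * M * nrm xi * nrm v.
Proof.
move=> M0 hM v; rewrite /leg_op /= /leg (nrm_ten hten) mulrC -!mulrA.
rewrite ler_wpM2l ?nrm_ge0 //; apply: le_trans (hM _) _; rewrite ler_wpM2l //.
apply: hadj_bound; [exact: nrm_ge0 | exact: blin_leg|].
by move=> x; rewrite /leg (nrm_ten hten) mulrC.
Qed.

Lemma hadj_leg_op X eta xi : blin X -> hadj (leg_op X eta xi) = leg_op (hadj X) xi eta.
Proof.
move=> bX; have bl := blin_leg; have bh y := blin_hadj (bl y).
rewrite /leg_op (@hadj_comp _ _ _ _ (leg eta \o X) (hadj (leg xi))) //; last first.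
  exact: blin_comp.
by rewrite hadj_comp // hadjK.
Qed.

Lemma leg_opBl X X' eta xi v : leg_op X eta xi v - leg_op X' eta xi v =
  leg_op (X - X') eta xi v.
Proof.
by rewrite /leg_op /= -(blinB _ _ (blin_leg eta)).
Qed.

End HilbertTensorTheory.

(** * Multipliers of the minimal tensor product with the compact operators *)

Section Multipliers.
Variables (R : realType) (A : algType R[i]) (H HH : hilbert R).
Local Notation C := R[i].
Variables (star : A -> A) (Lambda : {linear A -> H}) (pi : A -> H -> H).
Variable ten : H -> H -> HH.
Hypothesis dL : dense (range Lambda).
Hypothesis hpi : gns_representation star Lambda pi.
Hypothesis hten : hilbert_tensor ten.

Local Notation Ar := (reduced_algebra pi).

Lemma blin_pi a : blin (pi a).
Proof. by apply/bounded_opP; case: hpi. Qed.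

Lemma pi_Lambda a b : pi a (Lambda b) = Lambda (a * b).
Proof. by case: hpi. Qed.

Lemma piM a b : pi (a * b) = pi a \o pi b.
Proof. by case: hpi => _ _ _ []. Qed.

Lemma pi_lin c a b : pi (c *: a + b) = c *: pi a + pi b.
Proof. by case: hpi. Qed.

Lemma pi_star a : hadj (pi a) = pi (star a).
Proof. by case: hpi => _ _ _ [_ ->]. Qed.

Lemma pi1 : pi 1 = id.
Proof.
apply: (blin_ext dL) (blin_pi 1) (@blin_id _ _) _ => _ [b _ <-].
by rewrite pi_Lambda mul1r.
Qed.

Lemma range_pi_blin X : range pi X -> blin X.
Proof. by move=> [a _ <-]; exact: blin_pi. Qed.

Lemma Ar_blin X : Ar X -> blin X.
Proof. exact: norm_closure_blin range_pi_blin _. Qed.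

Lemma Ar_pi a : Ar (pi a).
Proof. by apply: (sub_norm_closure range_pi_blin); exists a. Qed.

Lemma Ar_near X (e : R) : Ar X -> 0 < e -> exists a, near_op e X (pi a).
Proof.
move=> /(norm_closureP range_pi_blin)[_ h] /h[_ [a _ <-] hX]; by exists a.
Qed.

Lemma Ar_lin c X Y : Ar X -> Ar Y -> Ar (c *: X + Y).
Proof.
apply: (norm_closure_lin range_pi_blin) => d _ _ [a _ <-] [b _ <-].
by exists (d *: a + b) => //; rewrite pi_lin.
Qed.

Lemma Ar_comp X Y : Ar X -> Ar Y -> Ar (X \o Y).
Proof.
apply: (norm_closure_comp range_pi_blin) => _ _ [a _ <-] [b _ <-].
by exists (a * b) => //; rewrite piM.
Qed.

Lemma Ar_adj X : Ar X -> Ar (hadj X).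
Proof.
apply: (norm_closure_adj range_pi_blin) => _ [a _ <-].
by exists (star a) => //; rewrite pi_star.
Qed.

Lemma Ar_closed X : blin X ->
  (forall e : R, 0 < e -> exists2 Y, Ar Y & near_op e X Y) -> Ar X.
Proof. exact: norm_closure_closed range_pi_blin _. Qed.

(* The operators [pi a (x) |Lambda b><Lambda c|] span a dense subspace of the
   minimal tensor product with the compact operators. *)
Definition elem a b c : HH -> HH := leg_op ten (pi a) (Lambda b) (Lambda c).

Definition elems : set (HH -> HH) := [set T | exists a b c, T = elem a b c].

Local Notation N := (min_tensor ten Ar (@compact_op R H)).
Local Notation gens := [set T | exists X Y, [/\ Ar X, compact_op Y & is_op_tensor ten X Y T]].

Lemma blin_elems T : elems T -> blin T.
Proof. by move=> [a [b [c ->]]]; apply: blin_leg_op => //; exact: blin_pi. Qed.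

Lemma blin_gens T : gens T -> blin T.
Proof. by move=> [X [Y [_ _ [/bounded_opP]]]]. Qed.

Lemma blin_fs_gens T : finite_sums gens T -> blin T.
Proof. exact: finite_sums_blin blin_gens _. Qed.

Lemma blin_fs_elems T : finite_sums elems T -> blin T.
Proof. exact: finite_sums_blin blin_elems _. Qed.

Lemma elem_gen a b c : gens (elem a b c).
Proof.
exists (pi a), (rank_one (Lambda b) (Lambda c)); split; first exact: Ar_pi.
  exact: compact_rank_one.
by apply: leg_op_tensor => //; exact: blin_pi.
Qed.

Lemma elem_N a b c : N (elem a b c).
Proof.
apply: (sub_norm_closure blin_fs_gens); apply: finite_sums1; exact: elem_gen.
Qed.

Local Notation N' := (norm_closure (finite_sums elems)).

Lemma elems_scale c T : elems T -> elems (c *: T).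
Proof.
move=> [a [b [d ->]]]; exists a, (c *: b), d; apply/funext => v.
rewrite /elem /leg_op /leg fctE /= linearZ /=.
by case: hten => -[_ br] _ _; rewrite (linearZZ _ _ (br _)).
Qed.

Lemma fs_elems_lin c X Y : finite_sums elems X -> finite_sums elems Y ->
  finite_sums elems (c *: X + Y).
Proof.
move=> hX hY; apply: finite_sumsD => //; move: X hX.
apply: finite_sums_elim => [|X T eX hT]; first by rewrite scaler0; exact: finite_sums0.
by rewrite scalerDr; apply: finite_sumsD => //; apply/finite_sums1/elems_scale.
Qed.

Lemma N'_lin c X Y : N' X -> N' Y -> N' (c *: X + Y).
Proof. apply: (norm_closure_lin blin_fs_elems); exact: fs_elems_lin. Qed.

Lemma N'_0 : N' 0.
Proof. apply: (sub_norm_closure blin_fs_elems); exact: finite_sums0. Qed.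

Lemma N'_D X Y : N' X -> N' Y -> N' (X + Y).
Proof. by move=> hX hY; rewrite -[X]scale1r; exact: N'_lin. Qed.

Lemma N'_sum I (r : seq I) (F : I -> HH -> HH) :
  (forall i, N' (F i)) -> N' (\sum_(i <- r) F i).
Proof. by move=> h; apply: big_ind => //; [exact: N'_0 | exact: N'_D]. Qed.

Lemma leg_opBr X eta xi xi' v : blin X ->
  leg_op ten X eta xi v - leg_op ten X eta xi' v = leg_op ten X eta (xi - xi') v.
Proof.
move=> bX; have bl := blin_leg hten.
rewrite /leg_op /= -(blinB _ _ (bl eta)) -blinB //; congr (leg _ _ (X _)).
apply: inner_eqr => u; rewrite innerBr -!hadjP //.
case: hten => -[_ br] _ _; rewrite /leg -innerBl; congr inner.
have := linearPP (br u) (-1) xi' xi; rewrite scaleN1r addrC => ->.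
by rewrite scaleN1r addrC.
Qed.

Lemma leg_op_pi_N' a b xi : N' (leg_op ten (pi a) (Lambda b) xi).
Proof.
have bT := blin_leg_op hten (Lambda b) xi (blin_pi a).
apply: (norm_closure_closed blin_fs_elems bT) => e e0.
case: (blin_pi a) => _ [M M0 hM].
pose q := nrm (Lambda b) * M + 1; have q0 : 0 < q.
  by rewrite ltr_wpDl // mulr_ge0 ?nrm_ge0.
have [_ [c _ <-] h] := (iffLR (denseP _) dL) xi _ (divr_gt0 e0 q0).
exists (elem a b c).
  apply: (sub_norm_closure blin_fs_elems); apply: finite_sums1; by exists a, b, c.
move=> v; rewrite leg_opBr; last exact: blin_pi.
apply: le_trans (leg_op_bound hten _ _ M0 hM v) _; rewrite ler_wpM2r ?nrm_ge0 //.
move: h; rewrite ltr_pdivlMr // /q => h.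
have := nrm_ge0 (xi - Lambda c); have : 0 <= nrm (Lambda b) * M by rewrite mulr_ge0 ?nrm_ge0.
nra.
Qed.

Lemma leg_op_Ar_N' X b xi : Ar X -> N' (leg_op ten X (Lambda b) xi).
Proof.
move=> hX; have bX := Ar_blin hX.
apply: (norm_closure_closed blin_fs_elems (blin_leg_op hten _ _ bX)) => e e0.
pose q := nrm (Lambda b) * nrm xi + 1; have q0 : 0 < q.
  by rewrite ltr_wpDl // mulr_ge0 ?nrm_ge0.
have eq0 : 0 < e / q by rewrite divr_gt0.
have [a ha] := Ar_near hX eq0.
exists (leg_op ten (pi a) (Lambda b) xi); first exact: leg_op_pi_N'.
move=> v; rewrite (leg_opBl hten).
apply: le_trans (leg_op_bound hten _ _ (ltW eq0) _ v) _ => //.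
have E : nrm (Lambda b) * (e / q) * nrm xi = e / q * (q - 1) by rewrite /q; ring.
rewrite ler_wpM2r ?nrm_ge0 // E mulrBr mulfVK ?(lt0r_neq0 q0) // mulr1.
by rewrite lerBlDr lerDl ltW.
Qed.

Lemma range_Lambda_lin c x y : range Lambda x -> range Lambda y -> range Lambda (c *: x + y).
Proof. by move=> [a _ <-] [b _ <-]; exists (c *: a + b); rewrite // linearP. Qed.

(** [Y] is replaced by a finite rank operator with range in [range Lambda]. Each resulting term is a
    limit of [elems], the first leg being approximated by some [pi a] and the bra by some
    [Lambda c]. *)
Lemma gens_N' T : gens T -> N' T.
Proof.
move=> [X [Y [hX cY tT]]]; have bX := Ar_blin hX.
have bY : blin Y by case: cY => /bounded_opP.
have bT : blin T by case: tT => /bounded_opP.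
apply: (norm_closure_closed blin_fs_elems bT) => e e0.
case: (bX) => _ [M M0 hM].
have M1 : 0 < M + 1 by rewrite ltr_wpDl.
have e1 : 0 < e / (M + 1) by rewrite divr_gt0.
have L0 : range Lambda 0 by exists 0 => //; rewrite linear0.
have [n [u [Du hu]]] := compact_finite_rank dL L0 range_Lambda_lin cY e1.
pose S := \sum_(i < n) leg_op ten X (u i) (hadj Y (u i)).
have hS : N' S.
  apply: N'_sum => i; have [b _ <-] := Du i; exact: leg_op_Ar_N'.
exists S => // v.
pose Z := Y - \sum_(i < n) rank_one (u i) (hadj Y (u i)).
have bZ : blin Z.
  by apply: blin_B => //; apply: blin_bigsum => i _; exact: blin_rank_one.
have tZ : is_op_tensor ten X Z (T - S).
  split; first apply/bounded_opP.
    by apply: blin_B => //; exact: (norm_closure_blin blin_fs_elems hS).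
  move=> x y; rewrite /Z !fctE tT.2 /S !fct_sumE.
  rewrite (eq_bigr (fun i : 'I_n => ten (X x) (rank_one (u i) (hadj Y (u i)) y))); last first.
    by move=> i _; rewrite (leg_op_tensor hten (u i) (hadj Y (u i)) bX).2.
  case: hten => -[_ br] _ _; rewrite -(linear_sum_fun _ _ (br (X x))).
  by have := linearPP (br (X x)) (-1) (\sum_(i < n) rank_one (u i) (hadj Y (u i)) y) (Y y);
    rewrite !scaleN1r addrC => <-; rewrite addrC.
have hZ w : nrm (Z w) <= e / (M + 1) * nrm w by exact: hu.
have := op_tensor_bound hten tZ bX bZ M0 (ltW e1) hM hZ v; rewrite !fctE => h.
apply: le_trans h _; rewrite ler_wpM2r ?nrm_ge0 //.
rewrite mulrAC ler_pdivrMr //; apply: ler_wpM2l; first exact: ltW.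
by rewrite lerDl.
Qed.

Lemma min_tensorE T : N T <-> N' T.
Proof.
split=> [/(norm_closureP blin_fs_gens)[bT h]|/(norm_closureP blin_fs_elems)[bT h]].
  apply: (norm_closure_closed blin_fs_elems bT) => e /h[X hX TX]; exists X => //.
  move: X hX {TX}; apply: finite_sums_elim; first exact: N'_0.
  by move=> X T' /gens_N' hX; exact: N'_D.
apply: (norm_closure_closed blin_fs_gens bT) => e /h[X hX TX]; exists X => //.
apply: (sub_norm_closure blin_fs_gens).
move: X hX {TX}; apply: finite_sums_elim; first exact: finite_sums0.
move=> X T' [a [b [c ->]]]; apply: finite_sumsD; apply: finite_sums1; exact: elem_gen.
Qed.

Lemma hadj_elem a b c : hadj (elem a b c) = elem (star a) c b.
Proof. by rewrite /elem (hadj_leg_op hten) ?pi_star //; exact: blin_pi. Qed.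

Lemma N'_adj T : N' T -> N' (hadj T).
Proof.
apply: (norm_closure_adj blin_fs_elems) => {}T hT.
suff : finite_sums elems (hadj T) /\ blin T by case.
move: T hT; apply: finite_sums_elim.
  split; last exact: blin_0.
  rewrite (@hadj_uniq _ _ _ _ 0) => [|x y]; first exact: finite_sums0.
  by change (inner (0 : HH) y = inner x (0 : HH)); rewrite inner0l inner0r.
move=> X T [a [b [c ->]]] [h bT].
have bE : blin (elem a b c) by apply: blin_elems; exists a, b, c.
split; last exact: blin_D.
rewrite -[elem a b c]scale1r hadj_lin // conjC1 scale1r hadj_elem.
by apply: finite_sumsD => //; apply: finite_sums1; exists (star a), c, b.
Qed.

Lemma elem_comp a b c a' b' c' :
  elem a b c \o elem a' b' c' = inner (Lambda b') (Lambda c) *: elem (a * a') b c'.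
Proof.
apply/funext => v; rewrite /elem /leg_op !fctE /= {2}/leg (hadj_leg hten).
rewrite piM /= blinZ; last exact: blin_pi.
by rewrite (blinZ _ _ (blin_leg hten _)).
Qed.

Lemma left_multiplier U : blin U ->
  (forall a b c, N' (U \o elem a b c)) -> forall T, N' T -> N' (U \o T).
Proof.
move=> bU hU T hT; have bT := norm_closure_blin blin_fs_elems hT.
move: hT => /(norm_closureP blin_fs_elems)[_ h].
apply: (norm_closure_closed blin_fs_elems (blin_comp bU bT)) => e e0.
case: (bU) => _ [M M0 hM]; have M1 : 0 < M + 1 by rewrite ltr_wpDl.
have [X hX TX] := h _ (divr_gt0 e0 M1).
exists (U \o X).
  move: X hX {TX}; apply: finite_sums_elim.
    rewrite (_ : U \o 0 = 0); first exact: N'_0.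
    by apply/funext => v; rewrite /= (blin0 bU).
  move=> X T' [a [b [c ->]]] h'; rewrite (_ : U \o (_ + _) = (U \o elem a b c) + (U \o T')).
    exact: N'_D.
  by apply/funext => v; exact: (blinD _ _ bU).
move=> v; have := near_op_comp bU M0 hM TX v => h1; apply: le_trans h1 _.
rewrite ler_wpM2r ?nrm_ge0 // mulrCA; apply: ler_piMr; first exact: ltW.
by rewrite ler_pdivrMr // mul1r lerDl.
Qed.

(** Right multiplication by [U] is the adjoint of left multiplication by [hadj U], so two left
    conditions on the elementary operators suffice. *)
Lemma multiplierP U : blin U -> (forall a b c, N' (U \o elem a b c)) ->
  (forall a b c, N' (hadj U \o elem a b c)) -> multipliers N U.
Proof.
move=> bU h1 h2; split; first exact/bounded_opP.
move=> T /min_tensorE hT; split; apply/min_tensorE; first exact: left_multiplier.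
have bT := norm_closure_blin blin_fs_elems hT.
rewrite -[T \o U]hadjK; last exact: blin_comp.
rewrite hadj_comp //; apply: N'_adj; apply: left_multiplier => //.
  exact: blin_hadj.
exact: N'_adj.
Qed.

Lemma elem_N' a b c : N' (elem a b c).
Proof. by apply/min_tensorE; exact: elem_N. Qed.

Lemma multiplier_elem a b c : multipliers N (elem a b c).
Proof.
have bE a' b' c' : blin (elem a' b' c') by apply: blin_elems; exists a', b', c'.
apply: multiplierP => // a' b' c'; rewrite ?hadj_elem elem_comp -[_ *: _]addr0.
  by apply: N'_lin; [exact: elem_N' | exact: N'_0].
by apply: N'_lin; [exact: elem_N' | exact: N'_0].
Qed.

Lemma multiplier_id : multipliers N id.
Proof.
apply: multiplierP => [|a b c|a b c]; first exact: blin_id.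
  exact: elem_N'.
rewrite (@hadj_uniq _ _ _ id id) //; exact: elem_N'.
Qed.

Lemma multiplier_lin c X Y : multipliers N X -> multipliers N Y -> multipliers N (c *: X + Y).
Proof.
move=> [/bounded_opP bX hX] [/bounded_opP bY hY].
split; first by apply/bounded_opP; exact: blin_lin.
move=> d hd; have [/min_tensorE x1 /min_tensorE x2] := hX d hd.
have [/min_tensorE y1 /min_tensorE y2] := hY d hd.
split; apply/min_tensorE; first exact: (N'_lin c x1 y1).
have bd := norm_closure_blin blin_fs_elems (iffLR (min_tensorE _) hd).
rewrite (_ : d \o _ = c *: (d \o X) + (d \o Y)); first exact: N'_lin.
by apply/funext => v; rewrite /= !fctE bd.1.
Qed.

Lemma multiplier_0 : multipliers N 0.
Proof.
split=> [|d hd]; first by apply/bounded_opP; exact: blin_0.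
have bd := norm_closure_blin blin_fs_elems (iffLR (min_tensorE _) hd).
split; apply/min_tensorE.
  by rewrite (_ : 0 \o d = 0) //; exact: N'_0.
rewrite (_ : d \o 0 = 0); first exact: N'_0.
by apply/funext => v; rewrite /= (blin0 bd).
Qed.

(** * Slicing the multiplicative unitary by a character *)

Section Slice.
Variables (Delta : A -> tensor A A) (W : HH -> HH).
Hypothesis hD : bialgebra Delta.
Hypothesis hW : is_multiplicative_unitary ten Delta Lambda W.
Variables (chi : A -> C) (chi_r : (H -> H) -> C) (Phi : (HH -> HH) -> (H -> H)).
Hypothesis lchi : functional chi.
Hypothesis chi1 : chi 1 = 1.
Hypothesis hchi : forall a, chi_r (pi a) = chi a.
Hypothesis hPhi : is_slice_extension ten Ar chi_r Phi.
Hypothesis L1 : inner (Lambda 1) (Lambda 1) = 1.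

Let lD : linear Delta. Proof. by case: hD. Qed.
Let bW : blin W. Proof. by case: hW => -[/bounded_opP]. Qed.
Let WWs : W \o hadj W = id. Proof. by case: hW => -[]. Qed.
Let WsW : hadj W \o W = id. Proof. by case: hW => -[]. Qed.

Definition elem_map c (x : tensor A A) : HH -> HH := tlift (fun a b => elem a b c) x.

Lemma bilinear_elem c : is_bilinear (fun a b => elem a b c).
Proof.
split=> [b|a] d x y; apply/funext => v; rewrite /elem /leg_op /= !fctE.
  rewrite pi_lin !fctE /=; exact: (blin_leg hten _).1.
by rewrite linearP /leg; case: hten => -[_ br] _ _; rewrite (linearPP (br _)).
Qed.

Lemma linear_elem_map c : linear (elem_map c).
Proof. exact/linear_tlift/bilinear_elem. Qed.

Lemma elem_map_fs c x : finite_sums elems (elem_map c x).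
Proof.
rewrite /elem_map tlift_sum; apply: finite_sums_sum => p; apply: finite_sums1.
by exists p.1, p.2, c.
Qed.

Let LL (x : tensor A A) : HH := tlift (fun c d => ten (Lambda c) (Lambda d)) x.

Let bLL : is_bilinear (fun c d => ten (Lambda c) (Lambda d)).
Proof.
case: hten => -[bl br] _ _; split=> [v|u] c x y; rewrite linearP.
  exact: bl.
exact: br.
Qed.

Lemma hadj_W_ten a b : hadj W (ten (Lambda a) (Lambda b)) = LL (tmul (Delta b) (tens a 1)).
Proof.
case: (hW) => _ /(_ a b) <-; exact: (congr1 (fun f => f _) WsW).
Qed.

(** The bra [Lambda c] is carried along, and both sides are compared at [Lambda d], where
    [Delta b * (a d (x) 1)] equals [Delta b * (a (x) 1) * (d (x) 1)]. *)
Lemma hadj_W_elem a b c : hadj W \o elem a b c = elem_map c (tmul (Delta b) (tens a 1)).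
Proof.
pose K (y : tensor A A) (x : H) : HH := tlift (fun p q => ten (pi p x) (Lambda q)) y.
have mapE y v : elem_map c y v = K y (hadj (leg ten (Lambda c)) v).
  by rewrite /elem_map /K !tlift_sum fct_sumE.
have bK y : blin (K y).
  split=> [d u v|].
    rewrite /K; apply: tlift_paramP => p q.
    rewrite (blin_pi p).1; case: hten => -[bl _] _ _; exact: bl.
  have /choice[M hM] (p : A * A) : exists M : R, 0 <= M /\
      forall x, nrm (ten (pi p.1 x) (Lambda p.2)) <= M * nrm x.
    case: (blin_pi p.1) => _ [M M0 hM]; exists (M * nrm (Lambda p.2)).
    split=> [|x]; first by rewrite mulr_ge0 ?nrm_ge0.
    by rewrite (nrm_ten hten) mulrAC ler_wpM2r ?nrm_ge0.
  exists (\sum_(p <- repr y) M p); first by apply: sumr_ge0 => p _; exact: (hM p).1.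
  move=> x; rewrite /K tlift_sum mulr_suml; apply: le_trans (nrm_sum _ _ _) _.
  by apply: ler_sum => p _; exact: (hM p).2.
have KE y d : K y (Lambda d) = LL (tmul y (tens d 1)).
  rewrite /K; have bB : is_bilinear (fun p q => ten (pi p (Lambda d)) (Lambda q)).
    case: hten => -[bl br] _ _; split=> [v|u] e x x'.
      by rewrite pi_lin; exact: bl.
    by rewrite linearP; exact: br.
  move: y; apply: tensor_lin_ext; first exact: linear_tlift.
    by apply: (linear_comp_fun (linear_tlift bLL)); exact: linear_tmull.
  by move=> u v; rewrite tlift_tens // tmul_tens /LL tlift_tens // pi_Lambda mulr1.
have main : hadj W \o (leg ten (Lambda b) \o pi a) = K (tmul (Delta b) (tens a 1)).
  apply: (blin_ext dL) => [||_ [d _ <-]] //.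
    apply: blin_comp; first exact: blin_hadj.
    by apply: blin_comp; [exact: (blin_leg hten) | exact: blin_pi].
  rewrite /= /leg pi_Lambda hadj_W_ten KE; congr LL.
  move: (Delta b); apply: tensor_lin_ext; first exact: linear_tmull.
    exact: (linear_comp_fun (linear_tmull _) (linear_tmull _)).
  by move=> u v; rewrite !tmul_tens mulrA !mulr1.
by apply/funext => v; rewrite mapE -main.
Qed.

(** Surjectivity in [bialgebra] writes [a (x) b] as a sum of terms [Delta b_i * (a_i (x) 1)]; [W]
    sends each of the corresponding operators to [elem a_i b_i c]. *)
Lemma W_elem a b c : finite_sums elems (W \o elem a b c).
Proof.
case: (hD) => _ _ _ _ /(_ (tens a b))[x hx].
have -> : elem a b c = elem_map c (tens a b).
  by rewrite /elem_map tlift_tens //; exact: bilinear_elem.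
rewrite -hx (tlift_comp _ (linear_elem_map c) (bilinear_Tmap hD)) tlift_sum.
have -> : W \o (\sum_(p <- repr x) elem_map c (tmul (Delta p.2) (tens p.1 1))) =
    \sum_(p <- repr x) elem p.1 p.2 c.
  apply/funext => v; rewrite /= !fct_sumE blin_sum //; apply: eq_bigr => p _.
  by rewrite -hadj_W_elem /=; exact: (congr1 (fun f => f _) WWs).
by apply: finite_sums_sum => p; apply: finite_sums1; exists p.1, p.2, c.
Qed.

Lemma multiplier_W : multipliers N W /\ multipliers N (hadj W).
Proof.
have h1 a b c : N' (W \o elem a b c).
  exact: (sub_norm_closure blin_fs_elems (W_elem a b c)).
have h2 a b c : N' (hadj W \o elem a b c).
  by rewrite hadj_W_elem; apply: (sub_norm_closure blin_fs_elems); exact: elem_map_fs.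
split; apply: multiplierP => //; first exact: blin_hadj.
by rewrite hadjK.
Qed.

Lemma Phi_elem a b c : Phi (elem a b c) = chi a *: rank_one (Lambda b) (Lambda c).
Proof.
case: hPhi => _ h; rewrite (h (pi a) (rank_one (Lambda b) (Lambda c))) ?hchi //.
- exact: Ar_pi.
- exact: compact_rank_one.
- by apply: leg_op_tensor => //; exact: blin_pi.
Qed.

Lemma Phi_lin c X Y : multipliers N X -> multipliers N Y ->
  Phi (c *: X + Y) = c *: Phi X + Phi Y.
Proof. by case: hPhi => -[_ h _ _] _; exact: h. Qed.

Lemma Phi_comp X Y : multipliers N X -> multipliers N Y -> Phi (X \o Y) = Phi X \o Phi Y.
Proof. by case: hPhi => -[_ _ h _] _; exact: h. Qed.

Lemma Phi_adj X : multipliers N X -> Phi (hadj X) = hadj (Phi X).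
Proof. by case: hPhi => -[_ _ _ h] _; exact: h. Qed.

Lemma Phi_blin X : multipliers N X -> blin (Phi X).
Proof. by case: hPhi => -[h _ _ _] _ /h/bounded_opP. Qed.

Lemma Phi0 : Phi 0 = 0.
Proof.
have := Phi_lin (-1) multiplier_0 multiplier_0.
by rewrite scaler0 addr0 scaleN1r addNr.
Qed.

Lemma Phi_sum I (r : seq I) (F : I -> HH -> HH) : (forall i, multipliers N (F i)) ->
  Phi (\sum_(i <- r) F i) = \sum_(i <- r) Phi (F i) /\ multipliers N (\sum_(i <- r) F i).
Proof.
move=> hF; elim: r => [|i r [ih1 ih2]].
  by rewrite !big_nil Phi0; split=> //; exact: multiplier_0.
rewrite !big_cons -[F i]scale1r; split; last exact: multiplier_lin.
by rewrite Phi_lin // !scale1r ih1.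
Qed.

(** Multiplicativity alone gives only an idempotent. Its range contains every [Lambda b], as seen by
    slicing [elem 1 b 1], so it is the identity. *)
Lemma Phi_id : Phi id = id.
Proof.
apply: (blin_ext dL) (Phi_blin multiplier_id) (@blin_id _ _) _ => _ [b _ <-].
have := Phi_comp multiplier_id (multiplier_elem 1 b 1).
rewrite (_ : id \o elem 1 b 1 = elem 1 b 1) // Phi_elem => /(congr1 (fun f => f (Lambda 1))) /=.
by rewrite !fctE chi1 !scale1r /rank_one L1 scale1r => <-.
Qed.

(** [elem 1 a 1] slices to [|Lambda a><Lambda 1|], and [hadj W] sends it to the finite sum over
    [Delta a]. Evaluating both slices at the unit vector [Lambda 1] isolates the value at
    [Lambda a]. *)
Lemma Phi_hadj_W a : Phi (hadj W) (Lambda a) = Lambda (conv_r Delta a chi).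
Proof.
have := Phi_comp multiplier_W.2 (multiplier_elem 1 a 1).
rewrite hadj_W_elem Phi_elem => /(congr1 (fun f => f (Lambda 1))) /=.
rewrite !fctE chi1 !scale1r /rank_one L1 scale1r => <-.
have -> : tmul (Delta a) (tens 1 1) = Delta a.
  move: (Delta a); apply: tensor_lin_ext => //; first exact: linear_tmull.
  by move=> u v; rewrite tmul_tens !mulr1.
rewrite /elem_map tlift_sum (Phi_sum _ _).1; last by move=> p; exact: multiplier_elem.
rewrite fct_sumE convE linear_sum; apply: eq_bigr => p _.
by rewrite Phi_elem fctE /rank_one L1 scale1r linearZ.
Qed.

Lemma Phi_unitary : [/\ blin (Phi W), hadj (Phi W) \o Phi W = id,
  Phi W \o hadj (Phi W) = id
  & forall a, hadj (Phi W) (Lambda a) = Lambda (conv_r Delta a chi)].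
Proof.
have [m1 m2] := multiplier_W; have aE := Phi_adj m1.
split; first exact: Phi_blin.
- by rewrite -aE -Phi_comp // WsW Phi_id.
- by rewrite -aE -Phi_comp // WWs Phi_id.
- by move=> a; rewrite -aE Phi_hadj_W.
Qed.

End Slice.

End Multipliers.

(** * Diagonal self-adjoint operators *)

Section DiscreteMeasure.
Variable R : realType.

Lemma cvg_epsP (u : nat -> R) (L : R) : (u @ \oo --> L) <->
  forall e : R, 0 < e -> exists N, forall n, (N <= n)%N -> `|u n - L| < e.
Proof.
split=> [/cvgrPdist_lt h e /h[N _ hN]|h].
  by exists N => n Nn; rewrite distrC; exact: hN.
apply/cvgrPdist_lt => e /h[N hN]; exists N => // n /= Nn.
by rewrite distrC; exact: hN.
Qed.

Lemma seq_limit_unique (u v : nat -> R) (a b : R) : u =1 v ->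
  u @ \oo --> a -> v @ \oo --> b -> a = b.
Proof. by move=> /funext-> h1 h2; exact: (cvg_unique _ h1 h2). Qed.

Lemma nnseries_EFin (a : nat -> R) (L : R) :
  (fun N => \sum_(n < N) a n) @ \oo --> L ->
  (\sum_(n <oo) (a n)%:E)%E = L%:E.
Proof.
move=> cv; rewrite -lim_mkord.
rewrite (_ : (fun N => _) = EFin \o (fun N => \sum_(n < N) a n)).
  by rewrite EFin_lim ?(cvg_lim _ cv) //; apply/cvg_ex; exists L.
by apply/funext => N /=; rewrite sumEFin.
Qed.

Lemma nnseries_cvg (a : nat -> R) (K : R) : (forall n, 0 <= a n) ->
  (forall N, \sum_(n < N) a n <= K) -> exists L : R, (fun N => \sum_(n < N) a n) @ \oo --> L.
Proof.
move=> a0 hK; apply/cvg_ex/nondecreasing_is_cvgn; last by exists K => _ [N _ <-].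
move=> m n mn; rewrite -(subnKC mn); elim: (n - m)%N => [|k ih]; first by rewrite addn0.
by rewrite addnS big_ord_recr /= (le_trans ih) // lerDl.
Qed.

Variables (w l : nat -> R).
Hypothesis w0 : forall n, 0 <= w n.

Definition discrete_measure : {measure set (measurableTypeR R) -> \bar R} :=
  mseries (fun n => mscale (NngNum (w0 n)) (@dirac _ (measurableTypeR R) (l n) R)) 0.

Lemma discrete_measureE (B : set (measurableTypeR R)) :
  discrete_measure B = (\sum_(n <oo) (if l n \in B then w n else 0)%:E)%E.
Proof.
rewrite /discrete_measure /= /mseries; apply: eq_eseriesr => n _.
transitivity ((w n)%:E * ((l n \in B)%:R)%:E)%E; first by rewrite -diracE.
by case: (l n \in B); rewrite ?mule1 ?mule0.
Qed.

Lemma discrete_integral_ge0 (f : R -> R) : measurable_fun setT (f : measurableTypeR R -> R) ->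
  (forall x, 0 <= f x) ->
  (\int[discrete_measure]_x (f x)%:E)%E = (\sum_(n <oo) (w n * f (l n))%:E)%E.
Proof.
move=> mf f0; have mf' : measurable_fun (setT : set (measurableTypeR R)) (EFin \o f).
  exact/measurable_EFinP.
rewrite ge0_integral_measure_series //; last by move=> t _; rewrite lee_fin.
apply: eq_eseriesr => n _; rewrite ge0_integral_mscale //; last by move=> t _; rewrite lee_fin.
by rewrite integral_dirac // diracE in_setT mul1e.
Qed.

(** The bound [K] on the absolute sums makes the series of positive and negative parts converge
    separately, so the integral is a difference of two finite numbers. *)
Lemma discrete_Rintegral (f : R -> R) (K L : R) :
  measurable_fun setT (f : measurableTypeR R -> R) ->
  (forall N, \sum_(n < N) w n * `|f (l n)| <= K) ->
  (fun N => \sum_(n < N) w n * f (l n)) @ \oo --> L ->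
  \int[discrete_measure]_x f x = L.
Proof.
move=> mf hK hL; pose fp x := Num.max (f x) 0; pose fm x := Num.max (- f x) 0.
have mfp : measurable_fun setT (fp : measurableTypeR R -> R).
  exact: measurable_funrpos.
have mfm : measurable_fun setT (fm : measurableTypeR R -> R).
  exact: measurable_funrneg.
have fp0 x : 0 <= fp x by rewrite le_max lexx orbT.
have fm0 x : 0 <= fm x by rewrite le_max lexx orbT.
have fpa x : fp x <= `|f x| by rewrite ge_max ler_norm normr_ge0.
have fma x : fm x <= `|f x| by rewrite ge_max -normrN ler_norm normr_ge0.
have part (g : R -> R) : (forall x, 0 <= g x) -> (forall x, g x <= `|f x|) ->
    exists A : R, (fun N => \sum_(n < N) w n * g (l n)) @ \oo --> A.
  move=> g0 ga; apply: (@nnseries_cvg (fun n => w n * g (l n)) K) => [n|N]; first by rewrite mulr_ge0.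
  by apply: le_trans (hK N); apply: ler_sum => n _; rewrite ler_wpM2l.
have [A hA] := part fp fp0 fpa; have [B hB] := part fm fm0 fma.
have fE x : f x = fp x - fm x.
  by rewrite /fp /fm; case: (leP (f x) 0) => h; case: leP => h'; lra.
have LE : L = A - B.
  have hAB : (fun N => \sum_(n < N) w n * f (l n)) @ \oo --> A - B.
    rewrite (_ : (fun N => _) = (fun N => \sum_(n < N) w n * fp (l n)) -
       (fun N => \sum_(n < N) w n * fm (l n))); first exact: cvgB.
    apply/funext => N; rewrite !fctE -sumrB; apply: eq_bigr => n _.
    by rewrite -mulrBr -fE.
  exact: (cvg_unique _ hL hAB).
rewrite /Rintegral integralE.
rewrite (_ : (fun x => (f x)%:E)^\+%E = (fun x => (fp x)%:E)); last first.
  by apply/funext => x; rewrite funeposE /fp EFin_max.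
rewrite (_ : (fun x => (f x)%:E)^\-%E = (fun x => (fm x)%:E)); last first.
  by apply/funext => x; rewrite funenegE /fm EFin_max.
rewrite !discrete_integral_ge0 //.
by rewrite (nnseries_EFin hA) (nnseries_EFin hB) LE.
Qed.

End DiscreteMeasure.

(** * Spectral projections of a total orthogonal family of subspaces *)

Section Diagonal.
Variables (R : realType) (H : hilbert R) (I : choiceType) (k0 : I).
Local Notation C := R[i].
Variable E : I -> set H.
Hypothesis orthE : forall k k' v w, k <> k' -> E k v -> E k' w -> inner v w = 0.
Hypothesis totalE : forall x, (forall k v, E k v -> inner x v = 0) -> x = 0.

Lemma eigen_ext x y : (forall k v, E k v -> inner x v = inner y v) -> x = y.
Proof.
move=> h; apply/eqP; rewrite -subr_eq0; apply/eqP/totalE => k v kv.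
by rewrite innerBl (h k v kv) subrr.
Qed.

(* The closed span of the [E k] with [k] in [B], as the orthogonal complement of
   the other eigenspaces. *)
Definition spec_space (B : set I) : set H :=
  [set x | forall k v, ~ B k -> E k v -> inner x v = 0].

Lemma closed_spec_space B : closed_subspace (spec_space B).
Proof.
split=> [k v _ _|c x y hx hy k v Bk kv|x h k v Bk kv]; first by rewrite inner0l.
  by rewrite innerDl innerZl (hx k v) // (hy k v) // mulr0 addr0.
apply: nrm_lt_all => e e0; have q0 : 0 < nrm v + 1 by rewrite ltr_wpDl ?nrm_ge0.
have [y hy xy] := h _ (divr_gt0 e0 q0).
rewrite -[inner x v]subr0 -(hy k v Bk kv) -innerBl.
apply: le_lt_trans (cauchy_schwarz _ _) _.
move: xy; rewrite ltr_pdivlMr // => xy; apply: le_lt_trans xy.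
by rewrite ler_wpM2l ?nrm_ge0 // lerDl.
Qed.

Definition spec_proj (B : set I) : H -> H := proj (spec_space B).
Local Notation P := spec_proj.

Lemma blin_P B : blin (P B).
Proof. exact/blin_proj/closed_spec_space. Qed.

Lemma P_sym B x y : inner (P B x) y = inner x (P B y).
Proof. exact/proj_sym/closed_spec_space. Qed.

Lemma P_in (B : set I) k v : B k -> E k v -> P B v = v.
Proof.
move=> Bk kv; apply: proj_id; first exact: closed_spec_space.
by move=> k' v' Bk' kv'; apply: (orthE _ kv kv') => kk; apply: Bk'; rewrite -kk.
Qed.

Lemma P_out (B : set I) k v : ~ B k -> E k v -> P B v = 0.
Proof.
move=> Bk kv; apply: proj_uniq; first exact: closed_spec_space.
  by case: (closed_spec_space B).
by move=> x Mx; rewrite (Mx k v) // inner0r.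
Qed.

(** Together with [eigen_ext], this reduces identities between projections to case distinctions on
    membership of an index. *)
Lemma inner_P B x k v : E k v -> inner (P B x) v = if `[< B k >] then inner x v else 0.
Proof.
move=> kv; rewrite P_sym; case: asboolP => Bk; first by rewrite (P_in Bk kv).
by rewrite (P_out Bk kv) inner0r.
Qed.

Lemma P_setI B B' x : P B (P B' x) = P (B `&` B') x.
Proof.
apply: eigen_ext => k v kv; rewrite !(inner_P _ _ kv).
case: asboolP => h1; last by case: asboolP => // -[].
case: asboolP => h2; last by case: asboolP => // -[].
by case: asboolP => // -[]; split.
Qed.

Lemma P_setT x : P setT x = x.
Proof.
by apply: eigen_ext => k v kv; rewrite (inner_P _ _ kv); case: asboolP => // -[].
Qed.

Lemma P_set0 x : P set0 x = 0.
Proof.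
by apply: eigen_ext => k v kv; rewrite (inner_P _ _ kv) inner0l; case: asboolP.
Qed.

Lemma P_setU B B' x : (forall k, B k -> ~ B' k) -> P (B `|` B') x = P B x + P B' x.
Proof.
move=> dis; apply: eigen_ext => k v kv; rewrite innerDl !(inner_P _ _ kv).
case: (asboolP ((B `|` B') k)); case: (asboolP (B k)); case: (asboolP (B' k));
  rewrite ?addr0 ?add0r // => h1 h2 h3; exfalso; move: h1 h2 h3 (dis k);
  rewrite /setU /=; tauto.
Qed.

Lemma P_orth B B' x y : (forall k, B k -> ~ B' k) -> inner (P B x) (P B' y) = 0.
Proof.
move=> dis; rewrite P_sym P_setI (_ : B `&` B' = set0) ?P_set0 ?inner0r //.
by apply/seteqP; split=> k // -[/dis].
Qed.

Lemma nrm_P_le B x : nrm (P B x) <= nrm x.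
Proof. exact/nrm_proj_le/closed_spec_space. Qed.

Lemma P_best B B' x : B' `<=` B -> nrm (x - P B x) <= nrm (x - P B' x).
Proof.
move=> BB; apply: nrm_proj_best; first exact: closed_spec_space.
move=> k v Bk kv; rewrite (inner_P _ _ kv); case: asboolP => // /BB //.
Qed.

Definition listed (s : seq I) : set I := [set k | k \in s].

Lemma listed_cons k s : listed (k :: s) = [set k] `|` listed s.
Proof.
apply/seteqP; split=> i; rewrite /listed /= inE; first by case/orP=> [/eqP|]; [left|right].
by case=> [->|->]; rewrite ?eqxx ?orbT.
Qed.

(** The vectors approximable by finite spectral projections form a closed subspace containing every
    [E k]; totality makes it the whole space. *)
Lemma P_approx x (e : R) : 0 < e -> exists s, nrm (x - P (listed s) x) < e.
Proof.
pose M : set H := [set x | forall e : R, 0 < e -> exists s, nrm (x - P (listed s) x) < e].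
suff hM : closed_subspace M.
  suff : M x by apply.
  suff <- : proj M x = x by exact: (projP hM x).1.
  apply: eigen_ext => k v kv.
  have Mv : M v.
    by move=> e' e'0; exists [:: k]; rewrite (@P_in _ k) ?subrr ?nrm0 //= /listed /= inE.
  by rewrite -inner_conj -(projP hM x).2 // inner_conj.
split=> [e' e'0|c u v hu hv e' e'0|u h e' e'0].
- by exists [::]; rewrite (blin0 (blin_P _)) subrr nrm0.
- have q0 : 0 < 2 * (nrm c + 1) by rewrite mulr_gt0 // ltr_wpDl ?nrm_ge0.
  have [s1 h1] := hu _ (divr_gt0 e'0 q0).
  have [s2 h2] := hv _ (divr_gt0 e'0 (ltr0n R 2)).
  exists (s1 ++ s2); rewrite (blin_P _).1 opprD addrACA -scalerBr.
  apply: le_lt_trans (ler_nrmD _ _) _; rewrite nrmZ.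
  have b1 : nrm (u - P (listed (s1 ++ s2)) u) <= nrm (u - P (listed s1) u).
    by apply: P_best => k; rewrite /listed /= mem_cat => ->.
  have b2 : nrm (v - P (listed (s1 ++ s2)) v) <= nrm (v - P (listed s2) v).
    by apply: P_best => k; rewrite /listed /= mem_cat => ->; rewrite orbT.
  move: h1; rewrite ltr_pdivlMr // => h1.
  have := nrm_ge0 c; have := nrm_ge0 (u - P (listed (s1 ++ s2)) u).
  have := nrm_ge0 (u - P (listed s1) u); nra.
- have e2 : 0 < e' / 2 by rewrite divr_gt0.
  have [y hy uy] := h _ e2; have [s hs] := hy _ e2; exists s.
  apply: le_lt_trans (nrm_proj_best (closed_spec_space _) _ (projP (closed_spec_space _) y).1) _.
  apply: le_lt_trans (nrm_triangle y _ _) _; rewrite [ltRHS]splitr; exact: ltrD.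
Qed.

Section Expansion.
Variable x : H.

(* [x] has a non-zero component in countably many of the [E k] only; a value
   may be listed several times, and only its first occurrence is a [new_eig]. *)
Lemma enumeration : exists e : nat -> I, forall eps : R, 0 < eps ->
  exists N, forall n, (N <= n)%N -> nrm (x - P [set e i | i in [set i | (i < n)%N]] x) < eps.
Proof.
have /choice[s hs] (m : nat) : exists s, nrm (x - P (listed s) x) < m.+1%:R^-1.
  by apply: P_approx; rewrite invr_gt0.
(* [n] codes a pair [(m, i)], read as entry [i] of the list [s m]; [k0] is the default value. *)
pose e n := if @unpickle (nat * nat)%type n is Some mi then nth k0 (s mi.1) mi.2 else k0.
exists e => eps eps0.
have [m hm] : exists m, m.+1%:R^-1 < eps.
  exists (Num.trunc eps^-1); rewrite invf_plt ?posrE //; exact: truncnS_gt.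
(* [N] exceeds the codes of all entries of [s m], so from [N] on every element of [s m] has been
   enumerated. *)
pose N := (\max_(i < size (s m)) (pickle (m, nat_of_ord i))).+1.
exists N => n Nn; apply: le_lt_trans hm; apply: ltW.
apply: le_lt_trans (hs m); apply: P_best => k /= /(nthP k0)[i im <-].
exists (pickle (m, i)) => /=; last by rewrite /e pickleK.
apply: leq_trans Nn; rewrite /N ltnS.
exact: (@leq_bigmax _ (fun i : 'I_(size (s m)) => pickle (m, nat_of_ord i)) (Ordinal im)).
Qed.

Definition enum_eig : nat -> I := projT1 (cid enumeration).
Local Notation e := enum_eig.

Definition new_eig (n : nat) : set I := [set k | k = e n /\ forall i, (i < n)%N -> e i <> e n].

Definition component (n : nat) : H := P (new_eig n) x.

Lemma component_sum n :
  \sum_(i < n) component i = P [set e i | i in [set i | (i < n)%N]] x.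
Proof.
elim: n => [|n ih].
  rewrite big_ord0 (_ : [set _ | _ in _] = set0) ?P_set0 //.
  by apply/seteqP; split=> // k [].
rewrite big_ord_recr /= ih /component -P_setU; last first.
  by move=> _ [i /= hi <-] [ein /(_ i hi)].
congr (P _ x); apply/seteqP; split=> [k [[i /= hi <-]|[-> _]]|_ [i /= hi <-]].
- by exists i => //=; rewrite ltnS ltnW.
- by exists n => /=.
case: (pselect ([set e i | i in [set i | (i < n)%N]] (e i))) => h; first by left.
right; move: hi; rewrite ltnS leq_eqVlt => /orP[/eqP iE|hi]; last first.
  by exfalso; apply: h; exists i.
by subst i; split=> // j jn ej; apply: h; exists j.
Qed.

Lemma component_tends : tends (fun N => \sum_(i < N) component i) x.
Proof.
move=> eps /(projT2 (cid enumeration))[N hN]; exists N => n /hN.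
by rewrite component_sum nrmC.
Qed.

Lemma new_eig_disjoint m n : m <> n -> forall k, new_eig m k -> ~ new_eig n k.
Proof.
move=> mn k [-> h1] [en h2]; have [mlt|nlt|//] := ltngtP m n.
  exact: (h2 m mlt).
by apply: (h1 n nlt).
Qed.

Lemma nrm_components y N :
  \sum_(n < N) nrm (P (new_eig n) y) ^+ 2 = nrm (\sum_(n < N) P (new_eig n) y) ^+ 2.
Proof.
elim: N => [|N ih]; first by rewrite !big_ord0 nrm0 expr0n.
have z : inner (\sum_(n < N) P (new_eig n) y) (P (new_eig N) y) = 0.
  rewrite inner_suml big1 // => i _; rewrite P_orth // => k; apply: new_eig_disjoint => iN.
  by have := ltn_ord i; rewrite iN ltnn.
by rewrite !big_ord_recr /= nrmD_sqr ih z /= mulr0 addr0.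
Qed.

Lemma bessel_components y N : \sum_(n < N) nrm (P (new_eig n) y) ^+ 2 <= nrm y ^+ 2.
Proof.
rewrite nrm_components ler_sqr ?nnegrE ?nrm_ge0 //.
pose B m := [set k | exists2 i, (i < m)%N & new_eig i k].
suff -> : \sum_(n < N) P (new_eig n) y = P (B N) y by exact: nrm_P_le.
elim: N => [|N ih].
  by rewrite big_ord0 (_ : B 0%N = set0) ?P_set0 //; apply/seteqP; split=> k // [].
rewrite big_ord_recr /= ih -P_setU; last first.
  move=> k [i iN hi]; apply: new_eig_disjoint hi => iE; by rewrite iE ltnn in iN.
congr (P _ y); apply/seteqP; split=> k.
  move=> [[i iN hi]|hN]; last by exists N.
  by exists i => //; rewrite ltnS ltnW.
move=> [i + hi]; rewrite ltnS leq_eqVlt => /orP[/eqP iE|iN]; last by left; exists i.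
by right; rewrite -iE.
Qed.

Lemma inner_component n y : inner (component n) y = inner (component n) (P (new_eig n) y).
Proof. by rewrite /component -P_sym P_setI setIid. Qed.

Definition weight n : R := nrm (component n) ^+ 2.

Lemma weight_ge0 n : 0 <= weight n.
Proof. exact: sqr_ge0. Qed.

Lemma component_self n : inner (component n) x = (weight n)%:C.
Proof. by rewrite inner_component -/(component n) innerxx. Qed.

Lemma tends_inner (u : nat -> H) l y : tends u l ->
  (fun n => complex.Re (inner (u n) y)) @ \oo --> complex.Re (inner l y) /\
  (fun n => complex.Im (inner (u n) y)) @ \oo --> complex.Im (inner l y).
Proof.
move=> h; have q0 : 0 < nrm y + 1 by rewrite ltr_wpDl ?nrm_ge0.
have key (eps : R) : 0 < eps -> exists N, forall n, (N <= n)%N -> nrm (inner (u n) y - inner l y) < eps.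
  move=> e0; have [N hN] := h _ (divr_gt0 e0 q0); exists N => n /hN.
  rewrite ltr_pdivlMr // -innerBl => hh; apply: le_lt_trans hh.
  by apply: le_trans (cauchy_schwarz _ _) _; rewrite ler_wpM2l ?nrm_ge0 // lerDl.
split; apply/cvg_epsP => eps /key[N hN]; exists N => n /hN; apply: le_lt_trans.
  by rewrite -cReB; exact: Re_le_nrm.
by rewrite -cImB; exact: Im_le_nrm.
Qed.

Lemma component_series y :
  (fun N => \sum_(n < N) complex.Re (inner (component n) y)) @ \oo --> complex.Re (inner x y) /\
  (fun N => \sum_(n < N) complex.Im (inner (component n) y)) @ \oo --> complex.Im (inner x y).
Proof.
have [h1 h2] := tends_inner y component_tends; split.
  rewrite (_ : (fun N => _) = (fun N => complex.Re (inner (\sum_(i < N) component i) y))) //.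
  apply/funext => N; rewrite inner_suml.
  by rewrite (big_morph (@complex.Re R) (id1 := 0) (op1 := +%R)) // => a b; exact: cReD.
rewrite (_ : (fun N => _) = (fun N => complex.Im (inner (\sum_(i < N) component i) y))) //.
apply/funext => N; rewrite inner_suml.
by rewrite (big_morph (@complex.Im R) (id1 := 0) (op1 := +%R)) // => a b; exact: cImD.
Qed.

Lemma P_component B n : P B (component n) = if `[< B (e n) >] then component n else 0.
Proof.
rewrite /component P_setI; case: asboolP => h.
  by congr (P _ x); apply/seteqP; split=> k [] // ek hk; split=> //; rewrite ek.
by rewrite (_ : _ `&` _ = set0) ?P_set0 //; apply/seteqP; split=> k // -[Bk [ek _]]; apply: h; rewrite -ek.
Qed.

End Expansion.

(** * Spectral resolution and functional calculus of a diagonal operator *)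

Section Calculus.
Variable lam : I -> R.

(** The multiplication operator with maximal domain: [x] belongs to the domain as soon as some [y]
    has the prescribed components. *)
Definition diag_op : set (H * H) :=
  [set p | forall k v, E k v -> inner p.2 v = (lam k)%:C * inner p.1 v].

Definition diag_proj (B : set R) : H -> H := P (lam @^-1` B).

Definition diag_measure (x : H) : {measure set (measurableTypeR R) -> \bar R} :=
  discrete_measure (fun n => lam (enum_eig x n)) (weight_ge0 x).

Lemma diag_spectral_measure : spectral_measure diag_proj diag_measure.
Proof.
split=> [B _|||x B _].
- split; first by apply/bounded_opP; exact: blin_P.
    by apply/funext => x; rewrite /= /diag_proj P_setI setIid.
  by apply: hadj_uniq => x y; exact: P_sym.
- by apply/funext => x; exact: P_setT.
- by move=> B B' _ _; apply/funext => x; rewrite /= /diag_proj P_setI.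
rewrite discrete_measureE; apply: nnseries_EFin.
rewrite Re_innerC (_ : (fun N => _) =
    (fun N => \sum_(n < N) complex.Re (inner (component x n) (diag_proj B x)))).
  exact: (component_series x (diag_proj B x)).1.
apply/funext => N; apply: eq_bigr => n _.
rewrite /diag_proj -P_sym P_component.
case: asboolP => /= h; first by rewrite (mem_set h) component_self.
by rewrite (memNset h) inner0l.
Qed.

Lemma diag_op_component p x n : diag_op p ->
  P (new_eig x n) p.2 = (lam (enum_eig x n))%:C *: P (new_eig x n) p.1.
Proof.
move=> hp; apply: eigen_ext => k v kv; rewrite innerZl !(inner_P _ _ kv).
case: asboolP => [[kE _]|_]; last by rewrite mulr0.
by rewrite -kE; exact: hp.
Qed.

(** If [(x, y)] is in the graph, Bessel's inequality for [y] bounds the second moment. Conversely, a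
    finite second moment makes the series of rescaled components Cauchy, and its sum is the required
    [y]. *)
Lemma diag_resolution : spectral_resolution diag_op diag_measure.
Proof.
have msq : measurable_fun setT ((fun s => s ^+ 2) : measurableTypeR R -> R).
  by apply: continuous_measurable_fun => s; exact: exprn_continuous.
have mid : measurable_fun setT ((fun s => s) : measurableTypeR R -> R).
  by apply: continuous_measurable_fun => s; exact: cvg_id.
have bnd x y N : diag_op (x, y) ->
    \sum_(n < N) weight x n * lam (enum_eig x n) ^+ 2 <= nrm y ^+ 2.
  move=> hxy; apply: le_trans (bessel_components x y N).
  apply: ler_sum => n _; rewrite (diag_op_component x n hxy) /= nrmZ nrm_real exprMn.
  by rewrite real_normK ?num_real // mulrC.
split=> [x|x y hxy].
  rewrite discrete_integral_ge0 //; last by move=> s; exact: sqr_ge0.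
  split=> [[y hxy]|fin].
    have [|//|L hL] := @nnseries_cvg _ (fun n => weight x n * lam (enum_eig x n) ^+ 2) (nrm y ^+ 2).
    - by move=> n; rewrite mulr_ge0 ?sqr_ge0.
    - by move=> N; exact: bnd.
    by rewrite (nnseries_EFin hL) ltry.
  pose a n := weight x n * lam (enum_eig x n) ^+ 2.
  have a0 n : 0 <= a n by rewrite mulr_ge0 ?sqr_ge0.
  have [K hK] : exists K : R, forall N, \sum_(n < N) a n <= K.
    exists (fine (\sum_(n <oo) (a n)%:E)%E) => N.
    rewrite -lee_fin fineK; last first.
      by rewrite ge0_fin_numE //; apply: nneseries_ge0 => n _; rewrite lee_fin.
    by rewrite -sumEFin -(big_mkord xpredT (fun n => (a n)%:E)); apply: nneseries_lim_ge => n _; rewrite lee_fin.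
  have [L hL] := nnseries_cvg a0 hK.
  pose u N := \sum_(n < N) (lam (enum_eig x n))%:C *: component x n.
  have uE m k : nrm (u (m + k)%N - u m) ^+ 2 = \sum_(n < m + k) a n - \sum_(n < m) a n.
    elim: k => [|k ih]; first by rewrite addn0 !subrr nrm0 expr0n.
    rewrite addnS /u !big_ord_recr /= -/(u (m + k)%N) addrAC nrmD_sqr ih nrmZ nrm_real.
    have z j : (j <= m + k)%N -> inner (u j) (component x (m + k)) = 0.
      move=> jm; rewrite inner_suml big1 // => i _.
      rewrite innerZl /component P_orth ?mulr0 //; apply: new_eig_disjoint => ie.
      by have := leq_trans (ltn_ord i) jm; rewrite ie ltnn.
    rewrite innerZr innerBl !z ?leq_addr // subrr mulr0 /= mulr0 addr0 exprMn.
    by rewrite real_normK ?num_real // [in RHS]addrAC; congr (_ + _); rewrite /a /weight mulrC.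
  have [|y uy] := @hilbert_complete _ _ u.
    move=> eps e0; have e2 : 0 < (eps / 2) ^+ 2 / 2 by rewrite divr_gt0 ?exprn_gt0 ?divr_gt0.
    have [N hN] := (iffLR (cvg_epsP _ _) hL) _ e2; exists N => m n hm hn.
    have near j : (N <= j)%N -> nrm (u j - u N) < eps / 2.
      move=> Nj; rewrite -ltr_sqr ?nnegrE ?nrm_ge0 ?divr_ge0 ?ltW //.
      rewrite -(subnKC Nj) uE subnKC //.
      have := hN j Nj; have := hN N (leqnn N); rewrite !ltr_norml; lra.
    apply: le_lt_trans (nrm_triangle (u N) _ _) _; rewrite [ltRHS]splitr (nrmC (u N)).
    by apply: ltrD; exact: near.
  exists y => k v kv /=.
  have uc N : inner (u N) v = (lam k)%:C * inner (\sum_(n < N) component x n) v.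
    rewrite !inner_suml mulr_sumr; apply: eq_bigr => n _; rewrite innerZl (inner_P _ _ kv).
    by case: asboolP => [[-> _]|_]; rewrite ?mulr0.
  have [h1 h2] := tends_inner v uy; have [h3 h4] := tends_inner v (component_tends x).
  apply: eqC; rewrite ?cReM ?cImM /= ?mul0r ?subr0 ?addr0.
    apply: (seq_limit_unique _ h1 (cvgM (cvg_cst (lam k)) h3)) => n /=.
    by rewrite uc cReM /= mul0r subr0.
  apply: (seq_limit_unique _ h2 (cvgM (cvg_cst (lam k)) h4)) => n /=.
  by rewrite uc cImM /= mul0r addr0.
have comp n : inner (component x n) y = (lam (enum_eig x n) * weight x n)%:C.
  rewrite inner_component (diag_op_component x n hxy) /= innerZr innerxx.
  by rewrite conjCE conjc_real -rmorphM.
have [h1 h2] := component_series x y.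
rewrite -inner_conj; apply: eqC; rewrite ?Re_conj ?Im_conj /=.
  (* Absolute convergence follows from [|s| <= 1 + s ^+ 2], the two terms being controlled by [x]
     and [y]. *)
  apply/esym/(@discrete_Rintegral _ _ _ _ _ (nrm x ^+ 2 + nrm y ^+ 2)) => // [N|].
    apply: le_trans (lerD (bessel_components x x N) (bnd x y N hxy)).
    rewrite -big_split /=; apply: ler_sum => n _; rewrite -/(weight x n).
    rewrite -[X in _ <= X + _]mulr1 -mulrDr; apply: ler_wpM2l; first exact: weight_ge0.
    rewrite -[lam _ ^+ 2]real_normK ?num_real //; set s := `|_|; have := sqr_ge0 (s - 1).
    have : 0 <= s by exact: normr_ge0.
    nra.
  rewrite (_ : (fun N => _) = (fun N => \sum_(n < N) complex.Re (inner (component x n) y))) //.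
  by apply/funext => N; apply: eq_bigr => n _; rewrite comp /= mulrC.
rewrite (seq_limit_unique (v := cst 0) (b := 0) _ h2) ?oppr0 //; last exact: cvg_cst.
by move=> N; apply: big1 => n _; rewrite comp.
Qed.

Lemma diag_calculus (g : R -> C) (K : R) (U : H -> H) : blin U ->
  continuous (fun s => complex.Re (g s)) -> continuous (fun s => complex.Im (g s)) ->
  (forall s, nrm (g s) <= K) ->
  (forall k v x, E k v -> inner (U x) v = g (lam k) * inner x v) ->
  is_functional_calculus diag_op g U.
Proof.
move=> bU cR cI gK hU; split; first exact/bounded_opP.
exists diag_proj, diag_measure; split=> [||x].
- exact: diag_spectral_measure.
- exact: diag_resolution.
have comp n : inner (component x n) (U x) = Num.conj (g (lam (enum_eig x n))) * (weight x n)%:C.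
  rewrite inner_component (_ : P _ (U x) = g (lam (enum_eig x n)) *: component x n).
    by rewrite innerZr innerxx.
  apply: eigen_ext => k v kv; rewrite innerZl !(inner_P _ _ kv).
  case: asboolP => [[kE _]|_]; last by rewrite mulr0.
  by rewrite -kE; exact: hU.
have bnd (h : R -> R) : (forall s, `|h s| <= K) -> forall N,
    \sum_(n < N) weight x n * `|h (lam (enum_eig x n))| <= nrm x ^+ 2 * K.
  move=> hK N; have K0 : 0 <= K by apply: le_trans (hK 0); exact: normr_ge0.
  apply: le_trans (ler_wpM2r K0 (bessel_components x x N)).
  rewrite mulr_suml; apply: ler_sum => n _; apply: ler_wpM2l => //; exact: weight_ge0.
have [h1 h2] := component_series x (U x).
rewrite -inner_conj; apply: eqC; rewrite ?Re_conj ?Im_conj /=; apply/esym.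
  apply: (@discrete_Rintegral _ _ _ _ _ (nrm x ^+ 2 * K)).
  - exact: continuous_measurable_fun.
  - apply: (bnd (fun s => complex.Re (g s))) => s; exact: le_trans (Re_le_nrm _) (gK s).
  rewrite (_ : (fun N => _) = (fun N => \sum_(n < N) complex.Re (inner (component x n) (U x)))) //.
  by apply/funext => N; apply: eq_bigr => n _; rewrite comp cReM Re_conj /= mulr0 subr0 mulrC.
apply: (@discrete_Rintegral _ _ _ _ _ (nrm x ^+ 2 * K)).
- exact: continuous_measurable_fun.
- apply: (bnd (fun s => complex.Im (g s))) => s; exact: le_trans (Im_le_nrm _) (gK s).
rewrite (_ : (fun N => _) = - (fun N => \sum_(n < N) complex.Im (inner (component x n) (U x)))).
  exact: cvgN.
apply/funext => N; rewrite fctE -sumrN; apply: eq_bigr => n _.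
by rewrite comp cImM Im_conj /= mulr0 add0r mulNr opprK mulrC.
Qed.

Lemma diag_exp (t : R) (U : H -> H) : blin U ->
  (forall k v x, E k v -> inner (U x) v = (cos (t * lam k) +i* sin (t * lam k)) * inner x v) ->
  is_exp_i t diag_op U.
Proof.
move=> bU hU; have ct : continuous (fun s : R => t * s) by move=> s; exact: mulrl_continuous.
apply: (@diag_calculus _ 2) => //= [s|s|s].
- by apply: (continuous_comp (ct s)); exact: continuous_cos.
- by apply: (continuous_comp (ct s)); exact: continuous_sin.
apply: le_trans (nrm_le_ReIm _) _ => /=.
by rewrite -[2]/(1 + 1); apply: lerD; rewrite ler_norml ?cos_geN1 ?cos_le1 ?sin_geN1 ?sin_le1.
Qed.

Lemma diag_listed s x : exists y, diag_op (P (listed s) x, y).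
Proof.
elim: s => [|k s [y hy]].
  exists 0 => k v kv /=; rewrite (_ : listed [::] = set0) ?P_set0 ?inner0l ?mulr0 //.
  by apply/seteqP; split.
have [ks|ks] := boolP (k \in s).
  exists y; rewrite (_ : listed (k :: s) = listed s) //; apply/seteqP; split=> j; rewrite /listed /= inE.
    by case/orP => // /eqP->.
  by move=> ->; rewrite orbT.
exists ((lam k)%:C *: P [set k] x + y) => j v jv /=.
rewrite listed_cons.
rewrite P_setU => [|i -> /= ks']; last by rewrite ks' in ks.
rewrite !innerDl mulrDr innerZl (hy j v jv) /=; congr (_ + _).
by rewrite (inner_P _ _ jv); case: asboolP => [->|_]; rewrite ?mulr0.
Qed.

(** Symmetry truncated to finitely many eigenspaces, where both sides are finite sums;
    [diag_self_adjoint] passes to the limit. *)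
Lemma diag_sym_listed s p q : diag_op p -> diag_op q ->
  inner p.2 (P (listed s) q.1) = inner p.1 (P (listed s) q.2).
Proof.
move=> hp hq; elim: s => [|k s ih].
  by rewrite (_ : listed [::] = set0) ?P_set0 ?inner0r //; apply/seteqP; split.
have [ks|ks] := boolP (k \in s).
  rewrite (_ : listed (k :: s) = listed s) //; apply/seteqP; split=> j; rewrite /listed /= inE.
    by case/orP => // /eqP->.
  by move=> ->; rewrite orbT.
rewrite listed_cons.
rewrite !P_setU => [|i -> /= ks'|i -> /= ks']; try by rewrite ks' in ks.
rewrite !innerDr ih; congr (_ + _).
have part r : diag_op r -> P [set k] r.2 = (lam k)%:C *: P [set k] r.1.
  move=> hr; apply: eigen_ext => j v jv; rewrite innerZl !(inner_P _ _ jv).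
  by case: asboolP => [/= jk|_]; rewrite ?mulr0 //; rewrite -jk; exact: hr.
rewrite -[P [set k] q.1](_ : P [set k] (P [set k] q.1) = _); last by rewrite P_setI setIid.
rewrite -P_sym part // -[P [set k] q.2](_ : P [set k] (P [set k] q.2) = _); last by rewrite P_setI setIid.
by rewrite -[RHS]P_sym (part q) // innerZl innerZr conjCE conjc_real.
Qed.

(** Testing an element of the adjoint against the graph points [(v, lam k * v)] gives its
    components, so it lies in the maximal operator. The other inclusion is the limit of
    [diag_sym_listed]. *)
Lemma diag_self_adjoint : self_adjoint diag_op.
Proof.
split.
  apply/denseP => x e e0; have [s hs] := P_approx x e0.
  by exists (P (listed s) x) => //; exact: diag_listed.
apply/seteqP; split=> q hq.
  move=> k v kv; have G : diag_op (v, (lam k)%:C *: v).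
    move=> j w jw /=; rewrite innerZl; case: (pselect (k = j)) => [->//|kj].
    by rewrite (orthE kj kv jw) !mulr0.
  have := hq _ G; rewrite /= innerZl => h.
  by rewrite -inner_conj -h rmorphM /= inner_conj conjCE conjc_real.
move=> p hp; apply/eqP; rewrite -subr_eq0; apply/eqP/nrm_lt_all => e e0.
pose d := e / (nrm p.1 + nrm p.2 + 1).
have q0 : 0 < nrm p.1 + nrm p.2 + 1 by rewrite ltr_wpDl // addr_ge0 ?nrm_ge0.
have d0 : 0 < d by rewrite divr_gt0.
have [s1 h1] := P_approx q.1 d0; have [s2 h2] := P_approx q.2 d0.
pose s := s1 ++ s2.
have b1 : nrm (q.1 - P (listed s) q.1) < d.
  by apply: le_lt_trans h1; apply: P_best => k; rewrite /listed /= mem_cat => ->.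
have b2 : nrm (q.2 - P (listed s) q.2) < d.
  by apply: le_lt_trans h2; apply: P_best => k; rewrite /listed /= mem_cat => ->; rewrite orbT.
have -> : inner p.2 q.1 - inner p.1 q.2 =
    inner p.2 (q.1 - P (listed s) q.1) - inner p.1 (q.2 - P (listed s) q.2).
  by rewrite !innerBr (diag_sym_listed s hp hq) opprB addrA subrK.
apply: le_lt_trans (ler_nrmB _ _) _.
apply: le_lt_trans (lerD (cauchy_schwarz _ _) (cauchy_schwarz _ _)) _.
have -> : e = d * (nrm p.1 + nrm p.2 + 1) by rewrite divfK // gt_eqF.
have := nrm_ge0 p.1; have := nrm_ge0 p.2; nra.
Qed.

End Calculus.

Lemma closure_graphP (G : set (H * H)) (p : H * H) : op_closure G p <->
  forall e : R, 0 < e -> exists q, [/\ G q, nrm (p.1 - q.1) < e & nrm (p.2 - q.2) < e].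
Proof.
split=> [hp e e0|h B].
  have [|q [Gq]] := hp (ball p e%:C); first by apply: nbhsx_ballx; rewrite ltcR.
  move=> [] ; rewrite -!ball_normE /= !nrmE !ltcR => h1 h2; by exists q.
rewrite nbhs_ballP => -[/= e e0 pe].
have e0' : 0 < complex.Re e by move: e0; rewrite ltcE /= => /andP[].
have eE : e = (complex.Re e)%:C by rewrite RRe_real // gtr0_real.
have [q [Gq h1 h2]] := h _ e0'; exists q; split=> //; apply: pe.
by split; rewrite -ball_normE /= eE nrmE ltcR.
Qed.

(** The sum lives on the intersection of the domains, which contains all finite truncations;
    truncating both entries of a graph point of the sum approximates it. *)
Lemma diag_closure_sum (lam mu : I -> R) :
  op_closure (op_sum (diag_op lam) (diag_op mu)) = diag_op (fun k => lam k + mu k).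
Proof.
apply/seteqP; split=> p.
  move=> /closure_graphP h k v kv; apply/eqP; rewrite -subr_eq0; apply/eqP/nrm_lt_all => e e0.
  set c := (_ + _)%:C; have q0 : 0 < (nrm c + 1) * (nrm v + 1).
    by rewrite mulr_gt0 // ltr_wpDl ?nrm_ge0.
  have [q [[y [z [hy hz q2]]] h1 h2]] := h _ (divr_gt0 e0 q0).
  have qv : inner q.2 v = c * inner q.1 v.
    by rewrite q2 innerDl (hy k v kv) (hz k v kv) /= -mulrDl -rmorphD.
  have -> : inner p.2 v - c * inner p.1 v = inner (p.2 - q.2) v - c * inner (p.1 - q.1) v.
    by rewrite !innerBl qv mulrBr; ring.
  apply: le_lt_trans (ler_nrmB _ _) _; rewrite nrmM.
  apply: le_lt_trans (lerD (cauchy_schwarz _ _) (ler_wpM2l (nrm_ge0 c) (cauchy_schwarz _ _))) _.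
  have d0 := divr_gt0 e0 q0; have eE := divfK (lt0r_neq0 q0) e; rewrite -[ltRHS]eE.
  set d := e / _ in h1 h2 d0 *; have c0 := nrm_ge0 c; have v0 := nrm_ge0 v.
  have b1 := ler_wpM2r v0 (ltW h2); have b2 := ler_wpM2l c0 (ler_wpM2r v0 (ltW h1)).
  apply: le_lt_trans (lerD b1 b2) _; nra.
move=> hp; apply/closure_graphP => e e0.
have [s1 h1] := P_approx p.1 e0; have [s2 h2] := P_approx p.2 e0.
pose s := s1 ++ s2; exists (P (listed s) p.1, P (listed s) p.2); split=> /=.
- have [y hy] := diag_listed lam s p.1; have [z hz] := diag_listed mu s p.1.
  exists y, z; split=> //=; apply: eigen_ext => k v kv.
  rewrite innerDl (hy k v kv) (hz k v kv) /= -mulrDl -rmorphD !(inner_P _ _ kv).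
  by case: asboolP => _; rewrite ?mulr0 //; exact: hp.
- by apply: le_lt_trans h1; apply: P_best => k; rewrite /listed /= mem_cat => ->.
- by apply: le_lt_trans h2; apply: P_best => k; rewrite /listed /= mem_cat => ->; rewrite orbT.
Qed.

End Diagonal.

(** * Symmetric locally finite operators *)

Section LocallyFinite.
Variables (R : realType) (V : lmodType R[i]).
Local Notation C := R[i].

Definition sums (P : set V) : set V :=
  [set a | exists s : seq V, (forall v, v \in s -> P v) /\ a = \sum_(v <- s) v].

Lemma sums0 P : sums P 0.
Proof. by exists [::]; rewrite big_nil. Qed.

Lemma sumsD P a b : sums P a -> sums P b -> sums P (a + b).
Proof.
move=> [s [hs ->]] [s' [hs' ->]]; exists (s ++ s'); rewrite big_cat; split=> // v.
by rewrite mem_cat => /orP[/hs|/hs'].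
Qed.

Lemma sums1 (P : set V) v : P v -> sums P v.
Proof. by exists [:: v]; rewrite big_seq1; split=> // w; rewrite inE => /eqP->. Qed.

Lemma sums_sum P (s : seq V) : (forall v, v \in s -> sums P v) -> sums P (\sum_(v <- s) v).
Proof.
elim: s => [|v s ih] h; first by rewrite big_nil; exact: sums0.
rewrite big_cons; apply: sumsD; first by apply: h; rewrite mem_head.
by apply: ih => w ws; apply: h; rewrite inE ws orbT.
Qed.

Variable T : V -> V.
Hypothesis lT : linear T.

Definition shift (l : C) (a : V) : V := T a - l *: a.

(** The product of the factors [T - l], for [l] in [s], applied to [a]. *)
Definition kill (s : seq C) (a : V) : V := foldl (fun b l => shift l b) a s.

(** [p(T) a], provided that [N] bounds the size of [p]. *)
Definition poly_act N (p : {poly C}) (a : V) : V := \sum_(i < N) p`_i *: iter i T a.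

Lemma iterB_lin i l a : iter i T (shift l a) = iter i.+1 T a - l *: iter i T a.
Proof.
elim: i => [|i ih] //=; rewrite ih /=.
by rewrite addrC -scaleNr lT addrC scaleNr.
Qed.

Lemma poly_act_factor N (q : {poly C}) l a : (size q <= N)%N ->
  poly_act N.+1 (q * ('X - l%:P)) a = poly_act N q (shift l a).
Proof.
move=> qN; rewrite /poly_act.
under eq_bigr do rewrite mulrBr coefB coefMX coefMC scalerBl.
rewrite sumrB big_ord_recl /= scale0r add0r [X in _ - X]big_ord_recr /=.
rewrite [q`_N]nth_default // mul0r scale0r addr0 -sumrB; apply: eq_bigr => i _.
by rewrite iterB_lin scalerBr scalerA.
Qed.

Lemma kill_exists n (p : {poly C}) a : size p = n.+1 -> poly_act n.+1 p a = 0 ->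
  exists s, kill s a = 0.
Proof.
elim: n p a => [|n ih] p a sp ap.
  exists [::]; move: ap; rewrite /poly_act big_ord1 /= => /eqP; rewrite scaler_eq0.
  move=> /orP[/eqP p0|/eqP //]; have [c c0 pE] := size_poly1P _ (introT eqP sp).
  by move: p0; rewrite pE coefC /= => c0'; rewrite c0' eqxx in c0.
have [l pl] : exists l, root p l by apply: closed_rootP; rewrite sp.
have [q pE] := factor_theorem p l pl.
have q0 : q != 0 by apply: contra_eq_neq sp => q0; rewrite pE q0 mul0r size_poly0.
have sq : size q = n.+1.
  by move: sp; rewrite pE size_mul ?polyXsubC_eq0 // size_XsubC addn2 => -[].
have [|s hs] := ih q (shift l a) sq; first by rewrite -poly_act_factor ?sq // -pE.
by exists (l :: s).
Qed.

(** The first [m + 1] iterates lie in the span of [m] vectors. A dependency between them is an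
    annihilating polynomial, which splits into linear factors over the complex numbers. *)
Lemma kill_span m (v : 'I_m -> V) (c : nat -> 'I_m -> C) a :
  (forall i, iter i T a = \sum_j c i j *: v j) -> exists s, kill s a = 0.
Proof.
move=> hc; pose M := \matrix_(i < m.+1, j < m) c i j.
have /rowV0Pn[u /sub_kermxP uM u0] : kermx M != 0.
  rewrite kermx_eq0; apply/negP => /eqP rM.
  by have := rank_leq_col M; rewrite rM ltnn.
pose p := \poly_(i < m.+1) u 0 (inord i).
have p0 : p != 0.
  apply: contra_neq u0 => p0; apply/rowP => i; rewrite mxE.
  by have := congr1 (fun q : {poly C} => q`_i) p0; rewrite coef_poly coef0 ltn_ord inord_val.
have sp : (size p <= m.+1)%N by exact: size_poly.
have act0 : poly_act m.+1 p a = 0.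
  rewrite /poly_act; under eq_bigr => i _ do rewrite hc scaler_sumr.
  rewrite exchange_big big1 // => j _ /=.
  under eq_bigr do rewrite scalerA; rewrite -scaler_suml.
  have := congr1 (fun r : 'rV_m => r 0 j) uM; rewrite !mxE => h.
  rewrite (_ : \sum_i _ = 0) ?scale0r // -[RHS]h; apply: eq_bigr => i _.
  by rewrite mxE coef_poly ltn_ord inord_val.
case E: (size p) => [|n]; first by move/eqP: E; rewrite size_poly_eq0 (negbTE p0).
apply: (kill_exists E); rewrite -[RHS]act0 /poly_act.
rewrite (big_ord_widen m.+1 (fun i => p`_i *: iter i T a)) -?E // big_mkcond.
apply: eq_bigr => i _; rewrite E ltnS; case: ifP => // /negbT; rewrite -ltnNge => h.
by rewrite nth_default ?scale0r // E.
Qed.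

Section Symmetric.
Variables (H : hilbert R) (Lambda : {linear V -> H}).
Hypothesis iL : forall a, Lambda a = 0 -> a = 0.
Hypothesis sT : forall a b, inner (Lambda (T a)) (Lambda b) = inner (Lambda a) (Lambda (T b)).
Variable Q : set V.
Hypothesis Q_lin : forall c x y, Q x -> Q y -> Q (c *: x + y).
Hypothesis Q_T : forall x, Q x -> Q (T x).

(** The invariant subspace [Q] allows a second operator to be diagonalized inside an eigenspace of a
    first one. *)
Definition eigenvectors : set V := [set v | Q v /\ exists l : R, T v = l%:C *: v].

Let T_lin c x y : T (c *: x + y) = c *: T x + T y. Proof. exact: (linearPP lT). Qed.
Let T0 : T 0 = 0. Proof. by have := T_lin (-1) 0 0; rewrite scaler0 addr0 scaleN1r addNr. Qed.
Let TZ c x : T (c *: x) = c *: T x. Proof. by have := T_lin c x 0; rewrite T0 !addr0. Qed.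
Let TD x y : T (x + y) = T x + T y. Proof. by have := T_lin 1 x y; rewrite !scale1r. Qed.

(** [T - l] is invertible on eigenvectors of eigenvalue other than [l], which yield [a]; the others
    are collected in [b]. *)
Lemma shift_solve (l : C) (s : seq V) : (forall v, v \in s -> eigenvectors v) ->
  exists a b, [/\ sums eigenvectors a, Q b \/ b = 0, T b = l *: b & \sum_(v <- s) v = shift l a + b].
Proof.
elim: s => [|v s ih] hs.
  exists 0, 0; rewrite big_nil /shift T0 !scaler0 subrr addr0; split=> //; [exact: sums0 | by right].
have [|a [b [ha hb Tb sE]]] := ih; first by move=> w ws; apply: hs; rewrite inE ws orbT.
have [Qv [m Tv]] := hs v (mem_head _ _).
case: (eqVneq m%:C l) => [ml|ml].
  exists a, (v + b); rewrite big_cons sE TD Tb Tv ml scalerDr addrCA; split=> //; left.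
  by case: hb => [|->]; rewrite ?addr0 // => hb; rewrite -[v]scale1r; exact: Q_lin.
exists ((m%:C - l)^-1 *: v + a), b; split=> //; last first.
  rewrite big_cons sE addrA; congr (_ + _); rewrite /shift TD TZ Tv scalerDr opprD addrACA.
  congr (_ + _); rewrite !scalerA -scalerBl mulrC -mulrBl mulfV ?scale1r //.
  by rewrite subr_eq0.
apply: sumsD => //; apply: sums1; split.
  by have := Q_lin ((m%:C - l)^-1 - 1) Qv Qv; rewrite scalerBl scale1r subrK.
by exists m; rewrite TZ Tv !scalerA mulrC.
Qed.

(* By symmetry [(T - l)^2 d = 0] implies [(T - l) d = 0] if [l] is real, and
   [T d = l d] implies [d = 0] otherwise: there are no Jordan blocks. *)
Lemma kill_eigen (s : seq C) a : Q a -> kill s a = 0 -> sums eigenvectors a.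
Proof.
elim: s a => [|l s ih] a Qa /=; first by move=> ->; exact: sums0.
have Q0 : Q 0 by have := Q_lin (-1) Qa Qa; rewrite scaleN1r addNr.
have QS x : Q x -> Q (shift l x).
  by move=> Qx; rewrite /shift addrC -scaleNr; apply: Q_lin => //; exact: Q_T.
move=> /(ih _ (QS a Qa))[r [hr sE]]; have [a1 [b [ha1 hb Tb]]] := shift_solve l hr.
rewrite -sE => bE; pose d := a - a1.
have Qa1 : Q a1.
  case: ha1 => {hr sE} r' [hr ->]; elim: r' hr => [|v r' ih'] hr; first by rewrite big_nil.
  rewrite big_cons -[v]scale1r; apply: Q_lin; first by case: (hr v (mem_head _ _)).
  by apply: ih' => w ws; apply: hr; rewrite inE ws orbT.
(* For [d = a - a1], [shift l d = b] and [T b = l *: b]: [d] is a generalized eigenvector of order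
   at most two. *)
have Qd : Q d by rewrite /d addrC -scaleN1r; exact: Q_lin.
have db : shift l d = b.
  apply: (addrI (shift l a1)); rewrite -bE /shift /d TD -[- a1]scaleN1r TZ scalerDr.
  rewrite !scaleN1r scalerN opprD opprK [RHS](_ : _ = (T a1 + (T a - T a1)) +
    (- (l *: a1) + (- (l *: a) + l *: a1))); first exact: addrACA.
  by rewrite [T a1 + _]addrC subrK [- (l *: a) + _]addrC addKr.
have -> : a = d + a1 by rewrite subrK.
apply: sumsD => //.
pose ip x y := inner (Lambda x) (Lambda y).
have LS m x : Lambda (shift m x) = Lambda (T x) - m *: Lambda x.
  by rewrite /shift linearB linearZ.
have symS x y : ip (shift l x) y = ip x (shift (Num.conj l) y).
  by rewrite /ip !LS innerBl innerBr innerZl innerZr conjCK sT.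
case: (eqVneq (complex.Im l) 0) => [l0|l0].
  have lE : l = (complex.Re l)%:C by apply: eqC.
  have cl : Num.conj l = l by rewrite lE conjCE conjc_real.
  have b0 : b = 0.
    apply/iL/inner_eq0; rewrite -{1}db -/(ip _ _) symS cl.
    by rewrite /shift Tb subrr /ip linear0 inner0r.
  apply: sums1; split=> //; exists (complex.Re l); rewrite -lE.
  by apply/eqP; rewrite -subr_eq0 -/(shift l d) db b0.
have real_eig x : T x = l *: x -> x = 0.
  move=> Tx; apply/iL/inner_eq0; have := sT x x; rewrite Tx linearZ innerZl innerZr => h.
  have : (l - Num.conj l) * inner (Lambda x) (Lambda x) = 0 by rewrite mulrBl h subrr.
  move/eqP; rewrite mulf_eq0 => /orP[/eqP h'|/eqP //].
  have := congr1 (@complex.Im R) h'; rewrite cImB Im_conj /= => /eqP.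
  by rewrite opprK -mulr2n mulrn_eq0 /= (negbTE l0).
rewrite (real_eig d) ?linear0; first exact: sums0.
by apply/eqP; rewrite -subr_eq0 -/(shift l d) db (real_eig b Tb).
Qed.

End Symmetric.
End LocallyFinite.

(** An eigenspace of [T1] is invariant under [T2] by commutation, so each eigenvector of [T1] splits
    further into eigenvectors of [T2]. *)
Lemma joint_eigen (R : realType) (V : lmodType R[i]) (H : hilbert R) (Lambda : {linear V -> H})
    (T1 T2 : V -> V) : linear T1 -> linear T2 ->
  (forall a, Lambda a = 0 -> a = 0) ->
  (forall a b, inner (Lambda (T1 a)) (Lambda b) = inner (Lambda a) (Lambda (T1 b))) ->
  (forall a b, inner (Lambda (T2 a)) (Lambda b) = inner (Lambda a) (Lambda (T2 b))) ->
  (forall a, T1 (T2 a) = T2 (T1 a)) ->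
  (forall a, exists s, kill T1 s a = 0) -> (forall a, exists s, kill T2 s a = 0) ->
  forall a, sums [set v | exists l m : R, T1 v = l%:C *: v /\ T2 v = m%:C *: v] a.
Proof.
move=> l1 l2 iL s1 s2 T12 k1 k2 a; have [s hs] := k1 a.
have [r [hr ->]] := kill_eigen l1 iL s1 (Q := setT) (fun _ _ _ _ _ => I) (fun _ _ => I) I hs.
apply: sums_sum => v /hr[_ [l Tv]]; have [s' hs'] := k2 v.
have [||r' [hr' ->]] := kill_eigen l2 iL s2 (Q := [set x | T1 x = l%:C *: x]) _ _ Tv hs'.
- by move=> c x y /= hx hy; rewrite (linearPP l1) hx hy scalerDr !scalerA mulrC.
- by move=> x /= hx; rewrite T12 hx (linearZZ _ _ l2).
by exists r'; split=> // w /hr'[hw [m hm]]; exists l, m.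
Qed.

(** * One-parameter unitary groups *)

Section ComplexDerivative.
Variable R : realType.
Local Notation C := R[i].

Definition cderiv (k : C -> C) (z b : C) : Prop :=
  forall e : R, 0 < e -> exists2 d : R, 0 < d &
    forall w, nrm (w - z) < d -> nrm (k w - k z - b * (w - z)) <= e * nrm (w - z).

Lemma cderiv_cdiff k z b : cderiv k z b -> cdiff k z.
Proof. by exists b. Qed.

Lemma cderiv_uniq k z b b' : cderiv k z b -> cderiv k z b' -> b = b'.
Proof.
move=> h h'; apply/eqP; rewrite -subr_eq0; apply/eqP/nrm_lt_all => e e0.
have e4 : 0 < e / 4 by rewrite divr_gt0.
have [d d0 hd] := h _ e4; have [d' d'0 hd'] := h' _ e4.
pose r := Num.min d d' / 2; have r0 : 0 < r by rewrite divr_gt0 // lt_min d0.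
have rd : r < Num.min d d' by rewrite ltr_pdivrMr // mulr2n mulrDr mulr1 ltrDl lt_min d0.
have wE : z + r%:C - z = r%:C by rewrite addrAC subrr add0r.
have nr : nrm (r%:C : C) = r by rewrite nrm_real gtr0_norm.
move: rd; rewrite lt_min => /andP[rd rd'].
have := hd (z + r%:C); rewrite wE nr => /(_ rd) h1.
have := hd' (z + r%:C); rewrite wE nr => /(_ rd') h2.
have : nrm ((b - b') * r%:C) <= e / 4 * r + e / 4 * r.
  apply: le_trans (lerD h2 h1); apply: le_trans (ler_nrmB _ _).
  by rewrite le_eqVlt; apply/orP; left; apply/eqP; congr nrm; ring.
rewrite nrmM nr -mulrDl ler_pM2r // => /le_lt_trans; apply; lra.
Qed.

Lemma cderiv_lin c k1 k2 z b1 b2 : cderiv k1 z b1 -> cderiv k2 z b2 ->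
  cderiv (fun w => c * k1 w + k2 w) z (c * b1 + b2).
Proof.
move=> h1 h2 e e0; have c0 := nrm_ge0 c.
have q0 : 0 < nrm c + 1 by rewrite ltr_wpDl.
have e2 : 0 < e / 2 by rewrite divr_gt0.
have [d1 d10 hd1] := h1 _ (divr_gt0 e2 q0); have [d2 d20 hd2] := h2 _ e2.
exists (Num.min d1 d2) => [|w]; first by rewrite lt_min d10.
rewrite lt_min => /andP[/hd1 a1 /hd2 a2].
have -> : c * k1 w + k2 w - (c * k1 z + k2 z) - (c * b1 + b2) * (w - z) =
  c * (k1 w - k1 z - b1 * (w - z)) + (k2 w - k2 z - b2 * (w - z)) by ring.
apply: le_trans (ler_nrmD _ _) _; rewrite nrmM.
have n0 := nrm_ge0 (w - z); apply: le_trans (lerD (ler_wpM2l c0 a1) a2) _.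
rewrite mulrA -mulrDl; apply: ler_wpM2r => //.
have := divfK (lt0r_neq0 q0) (e / 2); have := divr_gt0 e2 q0.
set q := _ / (nrm c + 1) => p0 qE; nra.
Qed.

Lemma cderiv_cst c z : cderiv (fun=> c) z 0.
Proof.
by move=> e e0; exists 1 => // w _; rewrite subrr mul0r subrr nrm0 mulr_ge0 ?nrm_ge0 // ltW.
Qed.

Lemma cderiv_sum I (r : seq I) (c : I -> C) (k : I -> C -> C) z b :
  (forall i, cderiv (k i) z (b i)) ->
  cderiv (fun w => \sum_(i <- r) c i * k i w) z (\sum_(i <- r) c i * b i).
Proof.
move=> h; elim: r => [|i r ih].
  rewrite big_nil (_ : (fun w => _) = fun=> 0); first exact: cderiv_cst.
  by apply/funext => w; rewrite big_nil.
rewrite big_cons (_ : (fun w => _) = (fun w => c i * k i w + \sum_(j <- r) c j * k j w)).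
  exact: cderiv_lin.
by apply/funext => w; rewrite big_cons.
Qed.

Lemma cderiv_shift k z b : cderiv (fun h => k (z + h)) 0 b -> cderiv k z b.
Proof.
move=> h e /h[d d0 hd]; exists d => // w wz.
by have := hd (w - z); rewrite subr0 addr0 [z + _]addrC subrK; apply.
Qed.

Lemma cderiv_line k c (t : R) b : cderiv k (c * t%:C) b ->
  cis_derive t (fun s => k (c * s%:C)) (c * b).
Proof.
move=> h; have q0 : 0 < nrm c + 1 by rewrite ltr_wpDl ?nrm_ge0.
suff key (e : R) : 0 < e -> exists2 d : R, 0 < d & forall s, `|s - t| < d ->
    nrm (k (c * s%:C) - k (c * t%:C) - c * b * (s - t)%:C) <= e * `|s - t|.
  split; apply/is_derive_epsP => e /key[d d0 hd]; exists d => // s /hd; apply: le_trans.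
    by apply: le_trans (Re_le_nrm _); rewrite !cReB [complex.Re (c * b * _)]cReM /= mulr0 subr0.
  by apply: le_trans (Im_le_nrm _); rewrite !cImB [complex.Im (c * b * _)]cImM /= mulr0 add0r.
move=> e0; have [d d0 hd] := h _ (divr_gt0 e0 q0); exists (d / (nrm c + 1)).
  exact: divr_gt0.
move=> s; rewrite ltr_pdivlMr // => sd.
have wE : c * s%:C - c * t%:C = c * (s - t)%:C by rewrite rmorphB /= mulrBr.
have nE : nrm (c * s%:C - c * t%:C) = nrm c * `|s - t| by rewrite wE nrmM nrm_real.
have a0 := normr_ge0 (s - t); have c0 := nrm_ge0 c.
have /hd : nrm (c * s%:C - c * t%:C) < d by rewrite nE; apply: le_lt_trans sd; nra.
rewrite nE wE mulrA [b * c]mulrC => hb; apply: le_trans hb _; rewrite mulrA.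
apply: ler_wpM2r => //.
have := divfK (lt0r_neq0 q0) e; have := divr_gt0 e0 q0.
set q := e / (nrm c + 1) => p0 qE; nra.
Qed.

Definition cis (s : R) : C := cos s +i* sin s.

Lemma cisM s t : cis s * cis t = cis (s + t).
Proof.
apply: eqC; rewrite ?cReM ?cImM /= ?cosD ?sinD //.
by rewrite addrC.
Qed.

Lemma cis0 : cis 0 = 1.
Proof. by rewrite /cis cos0 sin0. Qed.

Lemma cisK s : cis s * cis (- s) = 1.
Proof. by rewrite cisM subrr cis0. Qed.

Lemma conj_cis s : Num.conj (cis s) = cis (- s).
Proof. by rewrite /cis cosN sinN. Qed.

(** [u t * cis (l * t)] has zero derivative; its real and imaginary parts are constant by the mean
    value bound. *)
Lemma linear_ode (l : R) (u : R -> C) :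
  (forall t, cis_derive t u (- 'i%C * (l%:C * u t))) ->
  forall t, u t = cis (t * - l) * u 0.
Proof.
move=> h t; pose p s := complex.Re (u s); pose q s := complex.Im (u s).
have dp (s : R) : is_derive s 1 p (l * q s).
  case: (h s) => + _; rewrite (_ : complex.Re (_ * _) = l * q s) //.
  by rewrite cReM cImM /= /q; ring.
have dq (s : R) : is_derive s 1 q (- (l * p s)).
  case: (h s) => _; rewrite (_ : complex.Im (_ * _) = - (l * p s)) //.
  by rewrite cImM cReM /= /p; ring.
have dl (s : R) : is_derive s 1 (fun s : R => l * s) l.
  by have := @is_derive_quadratic R 0 l 0 s; under eq_fun do rewrite add0r mul0r addr0; rewrite mulr0 mul0r addr0.
have dc (s : R) : is_derive s 1 (fun s : R => cos (l * s)) (- l * sin (l * s)).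
  have := @is_derive1_comp _ (@cos R) (fun s : R => l * s) s _ _ (is_derive_cos (l * s)) (dl s).
  by rewrite [- sin _ * l]mulrC mulrN -mulNr.
have ds (s : R) : is_derive s 1 (fun s : R => sin (l * s)) (l * cos (l * s)).
  have := @is_derive1_comp _ (@sin R) (fun s : R => l * s) s _ _ (is_derive_sin (l * s)) (dl s).
  by rewrite mulrC.
have const (g : R -> R) : (forall s : R, is_derive s 1 g 0) -> g t = g 0.
  move=> dg; have h0 s : Num.min 0 t <= s <= Num.max 0 t -> `|0 : R| <= 0 by rewrite normr0.
  have := @mean_value_bound R g (fun=> 0) 0 0 t dg h0.
  by rewrite mul0r normr_le0 subr_eq0 => /eqP.
have e1 : p t * cos (l * t) - q t * sin (l * t) = p 0.
  have d (s : R) : is_derive s 1 (fun s => p s * cos (l * s) - q s * sin (l * s)) 0.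
    have := is_derive_sub (is_deriveM (dp s) (dc s)) (is_deriveM (dq s) (ds s)).
    by congr is_derive; rewrite /GRing.scale /=; ring.
  by rewrite (const _ d) mulr0 cos0 sin0 mulr1 mulr0 subr0.
have e2 : p t * sin (l * t) + q t * cos (l * t) = q 0.
  have d (s : R) : is_derive s 1 (fun s => p s * sin (l * s) + q s * cos (l * s)) 0.
    have := is_derive_add (is_deriveM (dp s) (ds s)) (is_deriveM (dq s) (dc s)).
    by congr is_derive; rewrite /GRing.scale /=; ring.
  by rewrite (const _ d) mulr0 cos0 sin0 mulr1 mulr0 add0r.
have e3 : u t * cis (l * t) = u 0.
  apply: eqC; rewrite ?cReM ?cImM /=; first exact: e1.
  exact: e2.
by rewrite -e3 mulrC -mulrA mulrN [t * l]mulrC cisK mulr1.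
Qed.

End ComplexDerivative.

(** * The flow and its infinitesimal generator *)

Section Flow.
Variables (R : realType) (A : algType R[i]) (H : hilbert R) (Lambda : {linear A -> H}).
Local Notation C := R[i].
Variables (Delta : A -> tensor A A) (f : C -> {scalar A}) (F : R -> H -> H).
Hypothesis hD : bialgebra Delta.
Hypothesis f0 : forall a, conv_r Delta a (f 0) = a.
Hypothesis fD : forall z w a, f (z + w) a = fmul Delta (f z) (f w) a.
Hypothesis df : forall a, cdiff (fun z => f z a) 0.
Hypothesis hF : forall t, [/\ blin (F t), hadj (F t) \o F t = id, F t \o hadj (F t) = id
  & forall a, hadj (F t) (Lambda a) = Lambda (conv_r Delta a (f (0 +i* t)))].

Local Notation conv := (conv_r Delta).
Let ff z : functional (f z). Proof. exact: functional_scalar. Qed.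

Lemma convD a z w : conv a (f (z + w)) = conv (conv a (f z)) (f w).
Proof.
rewrite -conv_fmul //; congr conv_r; apply/funext => x; exact: fD.
Qed.

(** Slicing determines the adjoint of [F t]; the group law inverts the convolution and unitarity
    then gives [F t] itself. *)
Lemma flow_Lambda t a : F t (Lambda a) = Lambda (conv a (f (- (0 +i* t)))).
Proof.
have [_ _ h2 h3] := hF t; set b := conv _ _.
have -> : Lambda a = hadj (F t) (Lambda b) by rewrite h3 /b -convD addNr f0.
exact: (congr1 (fun g => g (Lambda b)) h2).
Qed.

Definition generator (a : A) : C := projT1 (cid (df a)).
Local Notation g := generator.

Lemma generatorP a : cderiv (fun z => f z a) 0 (g a).
Proof. exact: projT2 (cid (df a)). Qed.

Lemma functional_generator : functional g.
Proof.
move=> c a b; apply: (cderiv_uniq (generatorP _)).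
rewrite (_ : (fun z => _) = (fun z => c * f z a + f z b)).
  by apply: cderiv_lin; exact: generatorP.
by apply/funext => z; rewrite linearP.
Qed.

(** The group law [a * f_(z+h) = (a * f_h) * f_z] carries the derivative at 0 to every [z]; the
    coproduct of [a] makes it a finite sum of scalar derivatives. *)
Lemma cderiv_conv (L : A -> C) z a : functional L ->
  cderiv (fun w => L (conv a (f w))) z (L (conv (conv a g) (f z))).
Proof.
move=> fL; apply: cderiv_shift.
have LE (tau : A -> C) : functional tau ->
    L (conv (conv a tau) (f z)) = \sum_(p <- repr (Delta a)) L (conv p.2 (f z)) * tau p.1.
  move=> ft; have fL' : functional (fun b => L (conv b (f z))).
    exact: (linear_comp_fun fL (linear_conv hD (ff z))).
  rewrite convE (linear_sum_fun _ _ fL'); apply: eq_bigr => p _.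
  by rewrite (linearZZ _ _ fL') mulrC.
rewrite (LE g functional_generator) (_ : (fun h => _) =
  (fun h => \sum_(p <- repr (Delta a)) L (conv p.2 (f z)) * f h p.1)).
  by apply: cderiv_sum => p; exact: generatorP.
by apply/funext => h; rewrite addrC convD LE.
Qed.

Definition gen_op (a : A) : A := conv a g.

Lemma linear_gen_op : linear gen_op.
Proof. exact: linear_conv functional_generator. Qed.

Let fin c : functional (fun a => inner (Lambda a) c).
Proof. by move=> d x y; rewrite linearP innerDl innerZl. Qed.

(* Derivative at [t = 0] of [<F_t^* a, b> = <a, F_t b>]. *)
Lemma gen_op_sym a b :
  inner (Lambda (gen_op a)) (Lambda b) = inner (Lambda a) (Lambda (gen_op b)).
Proof.
have d1 := cderiv_conv 0 a (fin (Lambda b)).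
have d2 := cderiv_conv 0 b (fin (Lambda a)).
rewrite f0 in d1; rewrite f0 in d2.
have key t : inner (Lambda (conv a (f (0 +i* t)))) (Lambda b) =
    Num.conj (inner (Lambda (conv b (f (- (0 +i* t))))) (Lambda a)).
  by have [bF _ _ h3] := hF t; rewrite inner_conj -flow_Lambda -h3 -hadjPr // hadjK.
apply/eqP; rewrite -subr_eq0; apply/eqP/nrm_lt_all => e e0.
have e4 : 0 < e / 4 by rewrite divr_gt0.
have [r1 r10 h1] := d1 _ e4; have [r2 r20 h2] := d2 _ e4.
pose r := Num.min r1 r2 / 2; have r0 : 0 < r by rewrite divr_gt0 // lt_min r10.
have rr : r < Num.min r1 r2 by rewrite ltr_pdivrMr // mulr2n mulrDr mulr1 ltrDl lt_min r10.
move: rr; rewrite lt_min => /andP[rr1 rr2].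
have ni : nrm (0 +i* r : C) = r.
  by have := nrm_sqr (0 +i* r : C); rewrite /= expr0n add0r => /eqP; rewrite eqrXn2 ?nrm_ge0 ?ltW // => /eqP.
have := h1 (0 +i* r); rewrite subr0 ni => /(_ rr1) b1.
have := h2 (- (0 +i* r)); rewrite subr0 nrmN ni => /(_ rr2); rewrite -nrm_conj.
rewrite !rmorphB /= rmorphM /= -key !inner_conj f0 => b2.
move: b1; rewrite f0 => b1.
(* The second function is taken at the increment [- it], whose conjugate is [it]: after conjugation
   both expansions have the same increment. *)
have cE : Num.conj (- (0 +i* r : C)) = 0 +i* r by apply: eqC; rewrite /= ?oppr0 ?opprK.
move: b2; rewrite cE => b2.
have : nrm ((inner (Lambda (gen_op a)) (Lambda b) - inner (Lambda a) (Lambda (gen_op b))) *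
    (0 +i* r)) <= e / 4 * r + e / 4 * r.
  apply: le_trans (lerD b2 b1); apply: le_trans (ler_nrmB _ _).
  by rewrite le_eqVlt; apply/orP; left; apply/eqP; congr nrm; rewrite /gen_op; ring.
rewrite nrmM ni -mulrDl ler_pM2r // => /le_lt_trans; apply; lra.
Qed.

(* The iterates of [gen_op] at [a] stay in the span of the finitely many second
   legs of [Delta a]. *)
Lemma gen_op_kill a : exists s, kill gen_op s a = 0.
Proof.
pose gi := fix gi i := if i is j.+1 then fmul Delta (gi j) g else (f 0 : A -> C).
have fgi i : functional (gi i).
  by elim: i => [|i ih] /=; [exact: ff | apply: functional_fmul => //; exact: functional_generator].
have itE i : iter i gen_op a = conv a (gi i).
  elim: i => [|i ih] /=; first by rewrite f0.
  by rewrite ih conv_fmul //; exact: functional_generator.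
pose r := repr (Delta a).
apply: (@kill_span _ _ _ linear_gen_op (size r) (fun j => (nth 0 r j).2)
  (fun i j => gi i (nth 0 r j).1)) => i.
by rewrite itE convE (big_nth 0) big_mkord.
Qed.

(** Along [z = - is], the coefficient [<v * f_z, c>] solves [u' = - i l u], because convolution by
    [f_z] keeps the eigenvalue equation. *)
Lemma flow_eigen (l : R) v t : gen_op v = l%:C *: v ->
  F t (Lambda v) = cis (t * - l) *: Lambda v.
Proof.
move=> vl; apply: inner_eq => c; rewrite innerZl.
pose u s := inner (Lambda (conv v (f (- 'i%C * s%:C)))) c.
have -> : inner (F t (Lambda v)) c = u t.
  rewrite flow_Lambda /u; congr (inner (Lambda (conv _ (f _))) _).
  by apply: eqC; rewrite ?cReM ?cImM /=; ring.
have -> : inner (Lambda v) c = u 0 by rewrite /u mulr0 f0.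
apply: linear_ode => s.
have := cderiv_line (cderiv_conv (- 'i%C * s%:C) v (fin c)); congr cis_derive.
rewrite -/(gen_op v) vl (linearZZ _ _ (linear_conv hD (ff _))).
by rewrite linearZ innerZl.
Qed.

End Flow.

Lemma derivable_cdiff (R : realType) (k : R[i] -> R[i]) z :
  derivable (k : R[i]^o -> R[i]^o) z 1 -> cdiff k z.
Proof.
move=> /cvg_ex[L hL]; exists L => e e0.
have e0' : 0 < e%:C by rewrite ltcR.
move/cvgrPdist_le: hL => /(_ _ e0'); rewrite near_withinE => /nbhs_ballP[/= d d0 hd].
have dE : d = (complex.Re d)%:C by rewrite RRe_real // gtr0_real.
exists (complex.Re d); first by rewrite -ltcR -dE.
move=> w wd; case: (eqVneq w z) => [->|wz]; first by rewrite !subrr mulr0 subrr nrm0 mulr0.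
have h0 : w - z != 0 by rewrite subr_eq0.
have := hd (w - z); rewrite /ball /= sub0r normrN dE nrmE ltcR => /(_ wd h0).
rewrite /shift /= [(w - z)%R *: _](_ : _ = w - z) ?subrK; last exact: mulr1.
rewrite nrmE lecR => hh.
have -> : k w - k z - L * (w - z) = - ((L - (w - z)^-1 *: (k w - k z : R[i]^o)) * (w - z)).
  by rewrite mulrBl /GRing.scale /= [_^-1 * _ * _]mulrAC mulVf // mul1r opprB.
rewrite nrmN nrmM; apply: ler_wpM2r => //; exact: nrm_ge0.
Qed.

(** * Joint diagonalization of two unitary families *)

Section JointSpectrum.
Variables (R : realType) (H : hilbert R) (F E : R -> H -> H).
Local Notation C := R[i].

Definition unitary_family (U : R -> H -> H) : Prop :=
  forall t, [/\ blin (U t), hadj (U t) \o U t = id & U t \o hadj (U t) = id].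

Hypothesis hF : unitary_family F.
Hypothesis hE : unitary_family E.

(** An eigenvector of a unitary is one of its adjoint, for the conjugate eigenvalue; moving the
    operator to the other side gives the relation for every [x]. *)
Lemma unitary_eigen (U : R -> H -> H) t (l : R) v x : unitary_family U ->
  U t v = cis l *: v -> inner (U t x) v = cis l * inner x v.
Proof.
move=> hU Uv; have [bU h1 h2] := hU t.
have h3 : v = cis l *: hadj (U t) v.
  by rewrite -(blinZ _ _ (blin_hadj bU)) -Uv; exact/esym/(congr1 (fun g => g v) h1).
rewrite hadjP //; have -> : hadj (U t) v = cis (- l) *: v.
  by rewrite {2}h3 scalerA mulrC cisK scale1r.
by rewrite innerZr conj_cis opprK.
Qed.

Definition joint_space (k : R * R) : set H :=
  [set x | forall t, F t x = cis (t * k.1) *: x /\ E t x = cis (t * k.2) *: x].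

Lemma cis_separation (l m : R) (z : C) : l <> m ->
  (forall t, cis (t * l) * z = cis (t * m) * z) -> z = 0.
Proof.
move=> lm h; have lm0 : l - m != 0 by rewrite subr_eq0; apply/eqP.
(* At this time the two phases differ by [pi], hence by a sign. *)
have := h (pi / (l - m)); set t := _ / _ => ht.
have tE : t * l = t * m + pi by rewrite /t; field.
have cpi : cis (pi : R) = -1 by rewrite /cis cospi sinpi; apply: eqC; rewrite /= ?oppr0.
move: ht; rewrite tE -cisM cpi => /(congr1 ( *%R (cis (- (t * m))))).
rewrite mulrN1 mulNr mulrN !mulrA [cis (- _) * _]mulrC cisK mul1r => /eqP.
by rewrite eq_sym -subr_eq0 opprK -mulr2n mulrn_eq0 => /eqP.
Qed.

Lemma joint_orth k k' v w : k <> k' -> joint_space k v -> joint_space k' w -> inner v w = 0.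
Proof.
move=> kk hv hw; case: (pselect (k.1 = k'.1)) => [e1|ne1].
  have ne2 : k.2 <> k'.2 by move=> e2; apply: kk; case: k k' e1 e2 {hv hw} => ? ? [? ?] /= -> ->.
  apply: (cis_separation ne2) => t.
  by rewrite -(unitary_eigen v hE (hw t).2) (hv t).2 innerZl.
apply: (cis_separation ne1) => t.
by rewrite -(unitary_eigen v hF (hw t).1) (hv t).1 innerZl.
Qed.

Hypothesis total : forall x, (forall k v, joint_space k v -> inner x v = 0) -> x = 0.

Lemma joint_spectral : exists GF GE : set (H * H),
  [/\ self_adjoint GF /\ self_adjoint GE,
      forall t, is_exp_i t GF (F t), forall t, is_exp_i t GE (E t),
      self_adjoint (op_closure (op_sum GE GF))
    & forall t, is_exp_i t (op_closure (op_sum GE GF)) (F t \o E t)].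
Proof.
pose D := diag_op joint_space.
exists (D (fun k => k.1)), (D (fun k => k.2)).
have sum : op_closure (op_sum (D (fun k => k.2)) (D (fun k => k.1))) = D (fun k => k.2 + k.1).
  exact: diag_closure_sum joint_orth total _ _.
have exp lam t U : blin U -> (forall k v x, joint_space k v ->
    inner (U x) v = cis (t * lam k) * inner x v) -> is_exp_i t (D lam) U.
  (* [(0, 0)] is the default index of the enumeration. *)
  by move=> bU hU; exact: (@diag_exp _ _ _ (0, 0) _ joint_orth total).
rewrite sum; split.
- by split; exact: diag_self_adjoint joint_orth total _.
- move=> t; apply: exp => [|k v x kv]; first by case: (hF t).
  exact: unitary_eigen hF (kv t).1.
- move=> t; apply: exp => [|k v x kv]; first by case: (hE t).
  exact: unitary_eigen hE (kv t).2.
- exact: diag_self_adjoint joint_orth total _.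
move=> t; apply: exp => [|k v x kv].
  by apply: blin_comp; [case: (hF t) | case: (hE t)].
rewrite /= (unitary_eigen _ hF (kv t).1) (unitary_eigen _ hE (kv t).2) mulrA cisM.
by rewrite mulrDr addrC.
Qed.

End JointSpectrum.

Section TwoFlows.
Variables (R : realType) (A : algType R[i]) (H : hilbert R) (Lambda : {linear A -> H}).
Local Notation C := R[i].
Variables (Delta : A -> tensor A A) (f : C -> {scalar A}) (F E : R -> H -> H).
Local Notation Dop := (fun a => tflip (Delta a)).
Hypothesis hD : bialgebra Delta.
Hypothesis hDop : bialgebra Dop.
Hypothesis dL : dense (range Lambda).
Hypothesis iL : forall a, Lambda a = 0 -> a = 0.
Hypothesis f0 : forall a, conv_r Delta a (f 0) = a.
Hypothesis f0op : forall a, conv_r Dop a (f 0) = a.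
Hypothesis fD : forall z w a, f (z + w) a = fmul Delta (f z) (f w) a.
Hypothesis df : forall a, cdiff (fun z => f z a) 0.
Hypothesis hF : forall t, [/\ blin (F t), hadj (F t) \o F t = id, F t \o hadj (F t) = id
  & forall a, hadj (F t) (Lambda a) = Lambda (conv_r Delta a (f (0 +i* t)))].
Hypothesis hE : forall t, [/\ blin (E t), hadj (E t) \o E t = id, E t \o hadj (E t) = id
  & forall a, hadj (E t) (Lambda a) = Lambda (conv_r Dop a (f (0 +i* t)))].

Lemma fDop z w a : f (z + w) a = fmul Dop (f z) (f w) a.
Proof. by rewrite addrC fD; apply/esym/fmul_flip; exact: functional_scalar. Qed.

Lemma flows_unitary : unitary_family F /\ unitary_family E.
Proof. by split=> t; [case: (hF t) | case: (hE t)]. Qed.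

Lemma joint_total x :
  (forall k v, joint_space F E k v -> inner x v = 0) -> x = 0.
Proof.
move=> hx; have fg := functional_generator df.
have comm a : gen_op Delta df (gen_op Dop df a) = gen_op Dop df (gen_op Delta df a).
  by rewrite /gen_op -!conv_l_flip // conv_lr_comm.
have je := joint_eigen (linear_gen_op hD df) (linear_gen_op hDop df) iL
  (gen_op_sym hD f0 fD df hF) (gen_op_sym hDop f0op fDop df hE) comm
  (gen_op_kill hD f0 df) (gen_op_kill hDop f0op df).
have xL a : inner x (Lambda a) = 0.
  have [s [hs ->]] := je a; rewrite linear_sum inner_sumr big_seq big1 // => v /hs[l [m [vl vm]]].
  (* The sign comes from [flow_eigen]: an eigenvalue [l] of the generator gives the phase
     [cis (t * - l)]. *)
  apply: (hx (- l, - m)) => t; split.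
    exact: (flow_eigen hD f0 fD hF _ vl).
  exact: (flow_eigen hDop f0op fDop hE _ vm).
apply: nrm_lt_all => e e0; rewrite -(ltr_pXn2r (n := 2)) ?nnegrE ?nrm_ge0 ?ltW //.
have [_ [a _ <-] xa] := iffLR (denseP _) dL x _ e0.
(* Pythagoras for [x] and the nearby orthogonal vector [Lambda a]. *)
have : nrm x ^+ 2 + nrm (Lambda a) ^+ 2 < e ^+ 2.
  rewrite -[_ + _]subr0 -(mulr0 2) -[0 in X in X < _](_ : complex.Re (inner x (Lambda a)) = 0).
    by rewrite -nrmB_sqr ltr_sqr ?nnegrE ?nrm_ge0 // ltW.
  by rewrite xL.
by apply: le_lt_trans; rewrite lerDl sqr_ge0.
Qed.

Lemma flow_spectral : exists GF GE : set (H * H),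
  [/\ self_adjoint GF /\ self_adjoint GE,
      forall t, is_exp_i t GF (F t), forall t, is_exp_i t GE (E t),
      self_adjoint (op_closure (op_sum GE GF))
    & forall t, is_exp_i t (op_closure (op_sum GE GF)) (F t \o E t)].
Proof. by have [uF uE] := flows_unitary; exact: joint_spectral uF uE joint_total. Qed.

Lemma flows_Lambda t a :
  F t (Lambda a) = Lambda (conv_r Delta a (f (- (0 +i* t)))) /\
  E t (Lambda a) = Lambda (conv_l Delta (f (- (0 +i* t))) a).
Proof.
split; first exact: (flow_Lambda hD f0 fD hF).
rewrite (flow_Lambda hDop f0op fDop hE) conv_l_flip //; exact: functional_scalar.
Qed.

Lemma flows_commute t : F t \o E t = E t \o F t.
Proof.
have [bF _ _ _] := hF t; have [bE _ _ _] := hE t.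
apply: (blin_ext dL) (blin_comp bF bE) (blin_comp bE bF) _ => _ [a _ <-] /=.
rewrite (flows_Lambda t a).1 (flows_Lambda t a).2 (flows_Lambda _ _).1 (flows_Lambda _ _).2.
by rewrite conv_lr_comm //; exact: functional_scalar.
Qed.

End TwoFlows.

(** * Automorphisms of the reduced algebra *)

Section OperatorLimit.
Variables (R : realType) (H : hilbert R).

Lemma operator_complete (u : nat -> H -> H) : (forall n, blin (u n)) ->
  (forall e : R, 0 < e -> exists N, forall m n, (N <= m)%N -> (N <= n)%N -> near_op e (u m) (u n)) ->
  exists2 Y, blin Y & forall e : R, 0 < e -> exists N, forall n, (N <= n)%N -> near_op e Y (u n).
Proof.
move=> bu hu; have /choice[Y hY] x : exists l, tends (fun n => u n x) l.
  apply: hilbert_complete => e e0; have q0 : 0 < nrm x + 1 by rewrite ltr_wpDl ?nrm_ge0.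
  have [N hN] := hu _ (divr_gt0 e0 q0); exists N => m n Nm Nn.
  apply: le_lt_trans (hN m n Nm Nn x) _; rewrite mulrAC ltr_pdivrMr // ltr_pM2l //.
  by rewrite ltrDl.
have lim (e : R) : 0 < e -> exists N, forall n, (N <= n)%N -> near_op e Y (u n).
  move=> e0; have [N hN] := hu e e0; exists N => n Nn x.
  apply/ler_addgt0Pr => d d0; have [M hM] := hY x d d0.
  pose m := maxn N M; apply: le_trans (nrm_triangle (u m x) _ _) _.
  rewrite addrC [nrm (Y x - _)]nrmC; apply: lerD; first exact: (hN _ _ (leq_maxl _ _) Nn x).
  exact/ltW/hM/leq_maxr.
exists Y => //; split=> [c x y|].
  apply/eqP; rewrite -subr_eq0; apply/eqP/nrm_lt_all => e e0.
  pose q := nrm (c *: x + y) + nrm c * nrm x + nrm y + 1.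
  have q0 : 0 < q by rewrite ltr_wpDl // !addr_ge0 ?mulr_ge0 ?nrm_ge0.
  have [N hN] := lim _ (divr_gt0 e0 q0); have {}hN := hN N (leqnn N).
  have -> : Y (c *: x + y) - (c *: Y x + Y y) = (Y (c *: x + y) - u N (c *: x + y)) -
      (c *: (Y x - u N x) + (Y y - u N y)).
    by rewrite (bu N).1 scalerBr addrACA -opprD opprB addrA subrK.
  apply: le_lt_trans (ler_nrmB _ _) _; apply: le_lt_trans (lerD (hN _) (ler_nrmD _ _)) _.
  rewrite nrmZ; apply: le_lt_trans (lerD (lexx _) (lerD (ler_wpM2l (nrm_ge0 c) (hN _)) (hN _))) _.
  have eE := divfK (lt0r_neq0 q0) e; rewrite -[ltRHS]eE; move: (divr_gt0 e0 q0).
  set d := e / q => d0; rewrite /q; have := nrm_ge0 c; nra.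
have [N hN] := lim 1 ltr01; have [_ [M M0 hM]] := bu N; exists (M + 1).
  by rewrite addr_ge0.
move=> x; rewrite -[Y x](subrK (u N x)); apply: le_trans (ler_nrmD _ _) _.
by rewrite mulrDl addrC; apply: lerD; [exact: hM | exact: hN].
Qed.

End OperatorLimit.

Section Unitary.
Variables (R : realType) (H : hilbert R) (U : H -> H).
Hypotheses (bU : blin U) (UsU : hadj U \o U = id) (UUs : U \o hadj U = id).

Lemma unitary_K x : hadj U (U x) = x.
Proof. exact: (congr1 (fun g => g x) UsU). Qed.

Lemma unitary_Kr x : U (hadj U x) = x.
Proof. exact: (congr1 (fun g => g x) UUs). Qed.

Lemma nrm_unitary x : nrm (U x) = nrm x.
Proof.
apply/eqP; rewrite -(eqrXn2 (n := 2)) ?nrm_ge0 //; apply/eqP.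
by rewrite !nrm_sqrE hadjP // unitary_K.
Qed.

Lemma nrm_hadj_unitary x : nrm (hadj U x) = nrm x.
Proof. by rewrite -[in RHS](unitary_Kr x) nrm_unitary. Qed.

Definition conj_by (X : H -> H) : H -> H := U \o X \o hadj U.

Lemma blin_conj_by X : blin X -> blin (conj_by X).
Proof. by move=> bX; apply: blin_comp (blin_hadj bU); exact: blin_comp. Qed.

Lemma near_conj_by (e : R) X Y : near_op e X Y -> near_op e (conj_by X) (conj_by Y).
Proof.
move=> h x; rewrite /conj_by /= -blinB // nrm_unitary -[nrm x]nrm_hadj_unitary; exact: h.
Qed.

Lemma conj_by_hom (D : set (H -> H)) : (forall X, D X -> blin X) -> op_star_hom D conj_by.
Proof.
move=> hD; split=> [X hX|c X Y hX hY|X Y hX hY|X hX].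
- apply/bounded_opP/blin_conj_by; exact: hD.
- by apply/funext => x; rewrite /conj_by /= !fctE bU.1.
- by apply/funext => x; rewrite /conj_by /= unitary_K.
- have bX := hD X hX; have bUX := blin_comp bU bX.
  rewrite !adjE /conj_by (hadj_comp bUX (blin_hadj bU)) (hadjK bU) (hadj_comp bU bX).
  by apply/funext.
Qed.

End Unitary.

(** * Automatic continuity and implemented automorphisms *)

Section Automorphisms.
Variables (R : realType) (A : algType R[i]) (H : hilbert R).
Local Notation C := R[i].
Variables (star : A -> A) (Lambda : {linear A -> H}) (pi : A -> H -> H).
Hypothesis dL : dense (range Lambda).
Hypothesis hpi : gns_representation star Lambda pi.
Local Notation Ar := (reduced_algebra pi).

Lemma Ar_id : Ar id.
Proof. by rewrite -(pi1 dL hpi); exact: Ar_pi hpi 1. Qed.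

Lemma Ar_0 : Ar 0.
Proof. by have := Ar_lin hpi (-1) Ar_id Ar_id; rewrite scaleN1r addNr. Qed.

Lemma Ar_Z c X : Ar X -> Ar (c *: X).
Proof. by move=> hX; have := Ar_lin hpi c hX Ar_0; rewrite addr0. Qed.

Lemma Ar_D X Y : Ar X -> Ar Y -> Ar (X + Y).
Proof. by move=> hX hY; have := Ar_lin hpi 1 hX hY; rewrite scale1r. Qed.

Lemma Ar_B X Y : Ar X -> Ar Y -> Ar (X - Y).
Proof. by move=> hX hY; have := Ar_lin hpi (-1) hY hX; rewrite scaleN1r addrC. Qed.

Section Contraction.
Variable T : H -> H.
Hypothesis hT : Ar T.
Hypothesis nT : forall x, nrm (T x) <= 2^-1 * nrm x.

Let K : H -> H := hadj T \o T.
Let bT : blin T. Proof. exact: Ar_blin hpi _ hT. Qed.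
Let hK : Ar K. Proof. exact: (Ar_comp hpi (Ar_adj hpi hT) hT). Qed.
Let bK : blin K. Proof. exact: Ar_blin hpi _ hK. Qed.

Let nK x : nrm (K x) <= 4^-1 * nrm x.
Proof.
have h : 0 <= 2^-1 :> R by rewrite invr_ge0.
apply: le_trans (hadj_bound h bT nT _) _.
by have := nT x; have := nrm_ge0 x; lra.
Qed.

(** Fixed point iteration for [2 Y = K + Y^2]. As [K] has norm at most 1/4, so have all iterates,
    since [(1/4 + 1/16) / 2 <= 1/4], and one step contracts distances by 1/4. *)
Fixpoint sqrt_iter n : H -> H :=
  if n is m.+1 then 2^-1%:C *: (K + (sqrt_iter m \o sqrt_iter m)) else 0.
Local Notation Y := sqrt_iter.

Let YSE n x : Y n.+1 x = 2^-1%:C *: (K x + Y n (Y n x)). Proof. by []. Qed.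

Let Y_Ar n : Ar (Y n).
Proof.
elim: n => [|n ih]; first exact: Ar_0.
by apply/Ar_Z/Ar_D; [exact: hK | exact: (Ar_comp hpi)].
Qed.

Let bY n : blin (Y n). Proof. exact: Ar_blin hpi _ (Y_Ar n). Qed.

Let n2 (x : H) : nrm (2^-1%:C *: x) = 2^-1 * nrm x.
Proof. by rewrite nrmZ nrm_real ger0_norm ?invr_ge0. Qed.

Let nY n x : nrm (Y n x) <= 4^-1 * nrm x.
Proof.
elim: n x => [|n ih] x; first by rewrite nrm0 mulr_ge0 ?invr_ge0 ?nrm_ge0.
rewrite YSE n2; have := ler_nrmD (K x) (Y n (Y n x)).
have := nK x; have := ih x; have := ih (Y n x); have := nrm_ge0 x; lra.
Qed.

Let Y_step n m (e : R) : 0 <= e -> near_op e (Y n) (Y m) -> near_op (4^-1 * e) (Y n.+1) (Y m.+1).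
Proof.
move=> e0 h x; rewrite !YSE -scalerBr n2.
have -> : K x + Y n (Y n x) - (K x + Y m (Y m x)) =
    Y n (Y n x - Y m x) + (Y n (Y m x) - Y m (Y m x)).
  by rewrite opprD addrACA subrr add0r (blinB _ _ (bY n)) addrA subrK.
have := ler_nrmD (Y n (Y n x - Y m x)) (Y n (Y m x) - Y m (Y m x)).
have := nY n (Y n x - Y m x); have := h x; have := h (Y m x).
have := ler_wpM2l e0 (nY m x); lra.
Qed.

Let Y_cauchy n m : near_op ((4^-1 : R) ^+ n) (Y n) (Y (n + m)).
Proof.
elim: n => [|n ih].
  move=> x; rewrite /= add0n add0r nrmN expr0 mul1r; have := nY m x; have := nrm_ge0 x; lra.
rewrite addSn exprS; apply: Y_step => //; by rewrite exprn_ge0 // invr_ge0.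
Qed.

Let hadjY n : hadj (Y n) = Y n.
Proof.
elim: n => [|n ih].
  by apply: hadj_uniq => x y; rewrite inner0l inner0r.
have bYY := blin_comp (bY n) (bY n).
apply: hadj_uniq => x y; rewrite !YSE innerZl innerZr conjCE conjc_real; congr (_ * _).
rewrite innerDl innerDr; congr (_ + _); first by rewrite /K /= -hadjPr // -hadjP.
by rewrite hadjP // ih hadjP // ih.
Qed.

(* The limit [Y] of [sqrt_iter] solves [2 Y = T^* T + Y^2], that is
   [(1 - Y)^2 = 1 - T^* T]. *)
Lemma sqrt_one_minus : exists Z, [/\ Ar Z, hadj Z = Z & Z \o Z = id - (hadj T \o T)].
Proof.
have [|L bL hL] := operator_complete bY.
  move=> e e0; have [N hN] : exists N, (4^-1 : R) ^+ N < e / 2.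
    have q : `|4^-1 : R| < 1 by rewrite ger0_norm ?invr_ge0 // invf_lt1 // ltr1n.
    have /cvg_epsP/(_ (e / 2))[|N hN] := cvg_expr q; first by rewrite divr_gt0.
    exists N; have := hN N (leqnn N); rewrite subr0 ger0_norm // exprn_ge0 // invr_ge0 //.
  exists N => m n Nm Nn x.
  apply: le_trans (nrm_triangle (Y N x) _ _) _; rewrite [nrm (Y m x - _)]nrmC.
  have := Y_cauchy N (m - N) x; have := Y_cauchy N (n - N) x; rewrite !subnKC //.
  have := nrm_ge0 x; move: hN; set q := _ ^+ N => hN; nra.
have LE : L = 2^-1%:C *: (K + (L \o L)).
  apply: near_op_eq => e e0; have e2 : 0 < Num.min (e / 4) 1 by rewrite lt_min divr_gt0 /=.
  have [N hN] := hL _ e2; have h1 := hN N (leqnn N); have h2 := hN N.+1 (leqnSn N).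
  move=> x; apply: le_trans (nrm_triangle (Y N.+1 x) _ _) _.
  have b1 := h2 x; set q := Num.min _ _ in h1 h2 b1 e2.
  have qe : q * 4 <= e by rewrite -ler_pdivlMr // ge_min lexx.
  have q1 : q <= 1 by rewrite ge_min lexx orbT.
  rewrite YSE in b1; rewrite YSE -[(_ *: (K + _)) x]/(2^-1%:C *: (K x + L (L x))) -scalerBr n2.
  have -> : K x + Y N (Y N x) - (K x + L (L x)) = - ((L (L x) - Y N (L x)) + Y N (L x - Y N x)).
    by rewrite opprD addrACA subrr add0r (blinB _ _ (bY N)) addrA subrK opprB.
  rewrite nrmN.
  have nL : nrm (L x) <= 2 * nrm x.
    rewrite -[L x](subrK (Y N x)); apply: le_trans (ler_nrmD _ _) _.
    have := h1 x; have := nY N x; have := nrm_ge0 x; nra.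
  have := ler_nrmD (L (L x) - Y N (L x)) (Y N (L x - Y N x)).
  have := h1 (L x); have := nY N (L x - Y N x); have := h1 x; have := nrm_ge0 x.
  have := ler_wpM2l (ltW e2) nL; have := ler_wpM2r (nrm_ge0 x) qe; move: b1.
  clearbody q; move: (nrm (L x - _)) (nrm (L (L x) - _)) (nrm (L (L x) - _ + _)) => a b c.
  move: (nrm (L x - _)) (nrm (Y N _)) (nrm (L x)) (nrm x) => a' b' c' d' *; nra.
have hadjL : hadj L = L.
  apply: near_op_eq => e e0; have e2 : 0 < e / 2 by rewrite divr_gt0.
  have [N hN] := hL _ e2; have h1 := hN N (leqnn N).
  rewrite [e]splitr; apply: near_op_trans (near_op_sym h1).
  by rewrite -[Y N]hadjY; apply: near_op_adj => //; exact: ltW.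
have ArL : Ar L.
  apply: Ar_closed hpi _ bL _ => e /hL[N hN]; exists (Y N) => //; exact: hN.
exists (id - L); split.
- by apply: Ar_B => //; exact: Ar_id.
- apply: hadj_uniq => x y; rewrite !fctE innerBl innerBr; congr (_ - _).
  by rewrite hadjP // hadjL.
apply/funext => x; rewrite /= !fctE /= (blinB _ _ bL).
have := congr1 (fun g => g x) LE; rewrite !fctE /= => Lx.
have {}Lx : L x + L x = K x + L (L x).
  rewrite {1 2}Lx -scalerDl -rmorphD /= (_ : 2^-1 + 2^-1 = 1 :> R) ?scale1r //.
  by field.
by rewrite -addrA -opprD addrA Lx addrK.
Qed.

End Contraction.

Section StarHom.
Variable s : (H -> H) -> (H -> H).
Hypothesis hs : op_star_hom Ar s.
Hypothesis s1 : s id = id.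

Lemma star_hom0 : s 0 = 0.
Proof.
case: hs => _ lin _ _; have := lin (-1) 0 0 Ar_0 Ar_0.
by rewrite scaler0 addr0 scaleN1r addNr.
Qed.

Lemma star_homZ c X : Ar X -> s (c *: X) = c *: s X.
Proof.
by case: hs => _ lin _ _ hX; have := lin c X 0 hX Ar_0; rewrite star_hom0 !addr0.
Qed.

Lemma star_homB X Y : Ar X -> Ar Y -> s (X - Y) = s X - s Y.
Proof.
by case: hs => _ lin _ _ hX hY; rewrite addrC -scaleN1r lin // scaleN1r addrC.
Qed.

(* [1 - s(T)^* s(T) = s(Z)^2 >= 0]. *)
Lemma star_hom_half T : Ar T -> (forall x, nrm (T x) <= 2^-1 * nrm x) ->
  forall x, nrm (s T x) <= nrm x.
Proof.
move=> hT nT x; have [Z [hZ Zs ZZ]] := sqrt_one_minus hT nT.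
have [bs lin comp sadj] := hs; have hTs := Ar_adj hpi hT.
have bsT : blin (s T) by apply/bounded_opP; exact: bs.
have bsZ : blin (s Z) by apply/bounded_opP; exact: bs.
have := comp Z Z hZ hZ; rewrite ZZ star_homB ?s1; first last.
- exact: (Ar_comp hpi hTs hT).
- exact: Ar_id.
rewrite comp // -[hadj T]/(adj T) sadj // => /(congr1 (fun g => inner (g x) x)) /=.
have sZs : hadj (s Z) = s Z by rewrite -[in LHS]adjE -sadj // adjE Zs.
rewrite -[(id - _) x]/(x - hadj (s T) (s T x)) innerBl -hadjPr // (hadjP bsZ) sZs => h.
have : nrm x ^+ 2 - nrm (s T x) ^+ 2 = nrm (s Z x) ^+ 2 by rewrite !nrm_sqrE -h cReB.
move=> hh; rewrite -(ler_pXn2r (n := 2)) ?nnegrE ?nrm_ge0 //.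
by have := sqr_ge0 (nrm (s Z x)); lra.
Qed.

(** Rescaling by [2 * d] brings [X] into the range of [star_hom_half]; the lost factor 2 is harmless
    for continuity. *)
Lemma star_hom_bound X (d : R) : Ar X -> 0 < d -> (forall x, nrm (X x) <= d * nrm x) ->
  forall x, nrm (s X x) <= 2 * d * nrm x.
Proof.
move=> hX d0 nX x; have d2 : 0 < 2 * d by rewrite mulr_gt0.
have nd (y : H) : nrm ((2 * d)^-1%:C *: y) = (2 * d)^-1 * nrm y.
  by rewrite nrmZ nrm_real ger0_norm // invr_ge0 ltW.
have hT : Ar ((2 * d)^-1%:C *: X).
  exact: Ar_Z.
have := @star_hom_half _ hT ^~ x; rewrite star_homZ // -[(_ *: s X) x]/((2 * d)^-1%:C *: s X x) nd.
rewrite ler_pdivrMl //; apply => y; rewrite -[(_ *: X) y]/((2 * d)^-1%:C *: X y) nd ler_pdivrMl //.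
by apply: le_trans (nX y) _; rewrite mulrA [2 * d * _]mulrAC mulfV ?mul1r.
Qed.

Lemma star_hom_near X Y (e : R) : Ar X -> Ar Y -> 0 < e -> near_op e X Y ->
  near_op (2 * e) (s X) (s Y).
Proof.
move=> hX hY e0 h x; rewrite -[s X x - s Y x]/((s X - s Y) x) -star_homB //.
by apply: star_hom_bound => //; exact: Ar_B.
Qed.

End StarHom.

Section Implemented.
Variables (U : H -> H) (theta : A -> A).
Hypotheses (bU : blin U) (UsU : hadj U \o U = id) (UUs : U \o hadj U = id).
Hypothesis hU : forall a, U (Lambda a) = Lambda (theta a).
Hypothesis thetaM : forall a b, theta (a * b) = theta a * theta b.
Hypothesis theta_surj : forall a, exists b, theta b = a.
Hypothesis theta1 : theta 1 = 1.

(** Multiplicativity of [theta] says on [Lambda A] that [U] intertwines [pi a] and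
    [pi (theta a)]. *)
Lemma conj_pi a : conj_by U (pi a) = pi (theta a).
Proof.
have bp := blin_pi hpi; have h : U \o pi a = pi (theta a) \o U.
  apply: (blin_ext dL) (blin_comp bU (bp _)) (blin_comp (bp _) bU) _ => _ [b _ <-] /=.
  by rewrite hU !(pi_Lambda hpi) hU thetaM.
by rewrite /conj_by h; apply/funext => x /=; rewrite (unitary_Kr UUs).
Qed.

Lemma conj_by_Ar X : Ar X -> Ar (conj_by U X).
Proof.
move=> hX; apply: Ar_closed hpi _ _ _ => [|e e0].
  by apply: blin_conj_by => //; exact: Ar_blin hpi _ hX.
have [a ha] := Ar_near hpi hX e0; exists (pi (theta a)); first exact: (Ar_pi hpi).
by rewrite -conj_pi; apply: near_conj_by.
Qed.

Lemma conj_by_Ar_surj X : Ar X -> Ar (hadj U \o X \o U).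
Proof.
move=> hX; have bX := Ar_blin hpi hX.
apply: Ar_closed hpi _ _ _ => [|e e0].
  by apply: blin_comp bU; apply: blin_comp => //; exact: blin_hadj.
have [a ha] := Ar_near hpi hX e0; have [b ba] := theta_surj a.
exists (pi b); first exact: (Ar_pi hpi).
have -> : pi b = hadj U \o pi a \o U.
  by rewrite -ba -conj_pi /conj_by; apply/funext => x /=; rewrite !(unitary_K UsU).
move=> x; rewrite /= -blinB; last exact: blin_hadj.
by rewrite (nrm_hadj_unitary bU UsU UUs) -[nrm x](nrm_unitary bU UsU).
Qed.

Lemma conj_by_automorphism : star_automorphism Ar (conj_by U).
Proof.
split; first by apply: conj_by_hom => // X; exact: (Ar_blin hpi).
split=> [X hX|X Y hX hY h|X hX].
- exact: conj_by_Ar.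
- apply/funext => x; have := congr1 (fun g => hadj U (g (U x))) h.
  by rewrite /conj_by /= !(unitary_K UsU).
exists (hadj U \o X \o U); first exact: conj_by_Ar_surj.
by apply/funext => x; rewrite /conj_by /= !(unitary_Kr UUs).
Qed.

(** [s] and the conjugation agree on [pi A]; approximating [X] by some [pi a] costs [2 * (e / 3)]
    for [s] and [e / 3] for the isometric conjugation. *)
Lemma automorphism_uniq s : star_automorphism Ar s ->
  (forall a, s (pi a) = pi (theta a)) -> forall X, Ar X -> s X = conj_by U X.
Proof.
move=> [hs _] spi X hX; have s1 : s id = id by rewrite -(pi1 dL hpi) spi theta1.
apply: near_op_eq => e e0; have e3 : 0 < e / 3 by rewrite divr_gt0.
have [a ha] := Ar_near hpi hX e3; have hpa := Ar_pi hpi a.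
have h1 := star_hom_near hs s1 hX hpa e3 ha.
have h2 : near_op (e / 3) (conj_by U X) (s (pi a)).
  by rewrite spi -conj_pi; apply: near_conj_by.
have -> : e = 2 * (e / 3) + e / 3 by field.
exact: near_op_trans h1 (near_op_sym h2).
Qed.

End Implemented.
End Automorphisms.

(** * The KMS condition *)

Section ComplexDifferentiable.
Variable R : realType.
Local Notation C := R[i].

Lemma cdiff_sum I (r : seq I) (c : I -> C) (k : I -> C -> C) z :
  (forall i, cdiff (k i) z) -> cdiff (fun w => \sum_(i <- r) c i * k i w) z.
Proof.
by move=> /choice[b hb]; apply: cderiv_cdiff; apply: cderiv_sum => i; exact: hb.
Qed.

Lemma cdiff_rotate (k : C -> C) z : cdiff k ('i%C * z) -> cdiff (fun w => k ('i%C * w)) z.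
Proof.
move=> [b hb]; exists (b * 'i%C) => e /hb[d d0 hd]; exists d => // w wz.
have nE : nrm ('i%C * w - 'i%C * z) = nrm (w - z) by rewrite -mulrBr nrmM nrmi mul1r.
by have := hd ('i%C * w); rewrite nE => /(_ wz); rewrite -mulrBr mulrA.
Qed.

Lemma cdiff_continuous (k : C -> C) z : cdiff k z -> eps_continuous k z.
Proof.
move=> [b hb] e e0; have [d d0 hd] := hb 1 ltr01.
have q0 : 0 < nrm b + 2 by rewrite ltr_wpDl ?nrm_ge0.
exists (Num.min d (e / (nrm b + 2))); first by rewrite lt_min d0 divr_gt0.
move=> w; rewrite lt_min => /andP[/hd h]; rewrite ltr_pdivlMr // => we.
have -> : k w - k z = (k w - k z - b * (w - z)) + b * (w - z) by ring.
apply: le_lt_trans (ler_nrmD _ _) _; rewrite nrmM; apply: le_lt_trans we.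
move: h; have := nrm_ge0 (w - z); have := nrm_ge0 b.
move: (nrm (w - z)) (nrm b) (nrm _) => x y t; lra.
Qed.

End ComplexDifferentiable.

(** * The modular group at complex parameters *)

Section Twist.
Variables (R : realType) (A : algType R[i]).
Local Notation C := R[i].
Variables (Delta : A -> tensor A A) (f : C -> {scalar A}).
Local Notation Dop := (fun a => tflip (Delta a)).
Hypothesis hD : bialgebra Delta.
Hypothesis hDop : bialgebra Dop.
Hypothesis f0 : forall a, conv_r Delta a (f 0) = a.
Hypothesis f0op : forall a, conv_r Dop a (f 0) = a.
Hypothesis fD : forall z w a, f (z + w) a = fmul Delta (f z) (f w) a.
Hypothesis f1 : forall z, f z 1 = 1.
Hypothesis fM : forall z a b, f z (a * b) = f z a * f z b.
Hypothesis df : forall a z, cdiff (fun w => f w a) z.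

Let ff z : functional (f z). Proof. exact: functional_scalar. Qed.

(** [sigma_t] acts on [A] as the twist at [- it], and the modular property of [phi] involves the
    twist at 1. *)
Definition twist (z : C) (a : A) : A := conv_lr Delta (f z) a (f z).

Lemma twistE z a : twist z a = conv_r Delta (conv_r Dop a (f z)) (f z).
Proof. by rewrite /twist conv_lrE // conv_l_flip. Qed.

Lemma twist0 a : twist 0 a = a.
Proof. by rewrite twistE f0op f0. Qed.

Lemma twistD z w a : twist (z + w) a = twist w (twist z a).
Proof.
rewrite !twistE (convD hDop (fDop fD)) (convD hD fD).
by rewrite -!(conv_l_flip Delta _ (ff w)) conv_lr_comm.
Qed.

Lemma twistK z a : twist (- z) (twist z a) = a.
Proof. by rewrite -twistD subrr twist0. Qed.

Lemma twistM z a b : twist z (a * b) = twist z a * twist z b.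
Proof. by rewrite !twistE (convM hDop _ _ (ff z) (fM z)) (convM hD _ _ (ff z) (fM z)). Qed.

Lemma twist1 z : twist z 1 = 1.
Proof. by rewrite twistE (conv1 hDop (ff z) (f1 z)) (conv1 hD (ff z) (f1 z)). Qed.

(** Two slices produce products of two values of [f w]; multiplicativity merges them into one value
    at [p.2 * q.1], leaving a finite linear combination of differentiable functions. *)
Lemma twist_cdiff (M : A -> C) b z : functional M -> cdiff (fun w => M (twist w b)) z.
Proof.
move=> lM; rewrite (_ : (fun w => _) = (fun w => \sum_(p <- repr (Delta b)) 1 *
    (\sum_(q <- repr (Delta p.1)) M q.2 * f w (p.2 * q.1)))).
  by apply: cdiff_sum => p; exact: cdiff_sum.
apply/funext => w; rewrite /twist conv_lrE //.
have lM' : functional (fun a => M (conv_r Delta a (f w))).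
  exact: (linear_comp_fun lM (linear_conv hD (ff w))).
rewrite [conv_l _ _ _]tlift_sum (linear_sum_fun _ _ lM'); apply: eq_bigr => p _.
rewrite mul1r (linearZZ _ _ lM') convE (linear_sum_fun _ _ lM) [LHS]mulr_sumr.
apply: eq_bigr => q _; rewrite (linearZZ _ _ lM) fM.
by rewrite -[_ *: _]/(f w q.1 * M q.2) mulrA mulrC.
Qed.

End Twist.

Section KMS.
Variables (R : realType) (A : algType R[i]) (H : hilbert R).
Local Notation C := R[i].
Variables (star : A -> A) (Lambda : {linear A -> H}) (pi : A -> H -> H).
Hypothesis dL : dense (range Lambda).
Hypothesis hpi : gns_representation star Lambda pi.
Hypothesis L1 : inner (Lambda 1) (Lambda 1) = 1.
Local Notation Ar := (reduced_algebra pi).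
Local Notation psi := (reduced_state Lambda).
Local Notation xi := (Lambda 1).

Lemma Ar_inner_ext X u v u' v' : Ar X ->
  (forall a, inner (pi a u) v = inner (pi a u') v') -> inner (X u) v = inner (X u') v'.
Proof.
move=> hX h; apply/eqP; rewrite -subr_eq0; apply/eqP/nrm_lt_all => e e0.
pose q := nrm u * nrm v + nrm u' * nrm v' + 1.
have q0 : 0 < q by rewrite ltr_wpDl // addr_ge0 // mulr_ge0 // nrm_ge0.
have d0 := divr_gt0 e0 q0; have [a ha] := Ar_near hpi hX d0.
have -> : inner (X u) v - inner (X u') v' = inner (X u - pi a u) v - inner (X u' - pi a u') v'.
  by rewrite !innerBl h opprB addrA subrK.
apply: le_lt_trans (ler_nrmB _ _) _.
apply: le_lt_trans (lerD (cauchy_schwarz _ _) (cauchy_schwarz _ _)) _.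
have h1 := ler_wpM2r (nrm_ge0 v) (ha u); have h2 := ler_wpM2r (nrm_ge0 v') (ha u').
apply: le_lt_trans (lerD h1 h2) _; have eE := divfK (lt0r_neq0 q0) e.
rewrite -[ltRHS]eE -!(mulrA (e / q)) -mulrDr ltr_pM2l // /q ltrDl //.
Qed.

Lemma nrm_xi : nrm xi = 1.
Proof.
have h : nrm xi ^+ 2 = 1 by rewrite nrm_sqrE L1.
by apply/eqP; rewrite -(eqrXn2 (n := 2)) ?nrm_ge0 // h expr1n.
Qed.

Section Extension.
Variables (X : H -> H) (sigma : R -> (H -> H) -> H -> H) (g : C -> H -> H).
Hypothesis hg : analytic_extension Ar sigma 1 X g.
Variable B : H -> H.
Hypothesis bB : blin B.

(** A bounded functional on operators: it turns the operator-valued extension [g] into a scalar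
    function on the strip. *)
Let N (T : H -> H) : C := inner (B (T xi)) xi.

Let N_bound : exists2 M : R, 0 < M & forall T, blin T -> nrm (N T) <= M * opnorm T.
Proof.
have [_ [M M0 hM]] := bB; exists (M + 1) => [|T bT]; first by rewrite ltr_wpDl.
apply: le_trans (cauchy_schwarz _ _) _; rewrite nrm_xi mulr1; apply: le_trans (hM _) _.
have := opnormP xi bT; rewrite nrm_xi mulr1; have := nrm_ge0 (T xi); have := opnorm_ge0 bT; nra.
Qed.

Let NB S T : N (S - T) = N S - N T.
Proof. by rewrite /N -[(S - T) xi]/(S xi - T xi) (blinB _ _ bB) innerBl. Qed.

Lemma extension_continuous z : strip 1 z -> forall e : R, 0 < e -> exists2 d : R, 0 < d &
  forall w, strip 1 w -> nrm (w - z) < d -> nrm (N (g w) - N (g z)) < e.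
Proof.
move=> sz e e0; have [M M0 hM] := N_bound; case: hg => Dg _ cg _.
have [d d0 hd] := cg z sz _ (divr_gt0 e0 M0); exists d => // w sw wz.
have := hd w sw; rewrite nrmE ltcR => /(_ wz); rewrite ltr_pdivlMr // mulrC -NB.
by apply: le_lt_trans; apply: hM; apply: blin_B; exact: (Ar_blin hpi (Dg _ _)).
Qed.

Lemma extension_cdiff z : 0 < complex.Im z < 1 -> cdiff (fun w => N (g w)) z.
Proof.
move=> sz; have [M M0 hM] := N_bound; case: hg => Dg _ _ dg.
have [L DL hL] := dg z sz; exists (N L) => e e0.
have [d d0 hd] := hL _ (divr_gt0 e0 M0).
(* The radius keeps [w] in the strip, where [g w] is known to be a bounded operator. *)
exists (Num.min d (Num.min (complex.Im z) (1 - complex.Im z))).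
  by move/andP: sz => [z0 z1]; rewrite !lt_min d0 z0 subr_gt0.
move=> w; rewrite !lt_min => /and3P[wd w0 w1].
have [->|wz] := eqVneq w z; first by rewrite !subrr mulr0 subrr nrm0 mulr0.
have h0 : w - z != 0 by rewrite subr_eq0.
have sz' : strip 1 z by rewrite /strip /=; lra.
have sw : strip 1 w.
  have := Im_le_nrm (w - z); rewrite cImB ler_norml /strip /= => /andP[]; lra.
have := hd (w - z) h0; rewrite nrmE ltcR => /(_ wd); rewrite ltr_pdivlMr // [z + _]addrC subrK.
have bg := blin_B (Ar_blin hpi (Dg w sw)) (Ar_blin hpi (Dg z sz')).
set T := _ - L => hT; have bT : blin T.
  by apply: blin_B; [apply: blin_Z | exact: (Ar_blin hpi DL)].
have -> : N (g w) - N (g z) - N L * (w - z) = N T * (w - z).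
  rewrite /T NB mulrBl -NB; congr (_ - _); rewrite /N -[(_ *: _) xi]/((w - z)^-1 *: (g w - g z) xi).
  by rewrite (blinZ _ _ bB) innerZl mulrAC mulVf ?mul1r.
rewrite nrmM; apply: ler_wpM2r; first exact: nrm_ge0.
by apply: le_trans (hM T bT) _; rewrite mulrC ltW.
Qed.

End Extension.

Variables (Delta : A -> tensor A A) (f : C -> {scalar A}) (phi : A -> C) (V : R -> H -> H).
Local Notation Dop := (fun a => tflip (Delta a)).
Local Notation tw := (twist Delta f).
Hypothesis hD : bialgebra Delta.
Hypothesis hDop : bialgebra Dop.
Hypothesis f0 : forall a, conv_r Delta a (f 0) = a.
Hypothesis f0op : forall a, conv_r Dop a (f 0) = a.
Hypothesis fD : forall z w a, f (z + w) a = fmul Delta (f z) (f w) a.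
Hypothesis f1 : forall z, f z 1 = 1.
Hypothesis fM : forall z a b, f z (a * b) = f z a * f z b.
Hypothesis df : forall a z, cdiff (fun w => f w a) z.
Hypothesis phiE : forall a, inner (Lambda a) xi = phi a.
Hypothesis phi_twist : forall a b, phi (a * b) = phi (b * tw 1 a).
Hypothesis uV : unitary_family V.
Hypothesis hV : forall t a, V t (Lambda a) = Lambda (tw (- (0 +i* t)) a).

(* Both [z |-> psi(pi(b) g(z))] and the entire function
   [z |-> psi(pi(f_iz * b * f_iz) X)] extend [t |-> psi(pi(b) sigma_t(X))]. *)
Lemma kms_pi X b g : Ar X -> analytic_extension Ar (fun t => conj_by (V t)) 1 X g ->
  psi (X \o pi b) = psi (pi b \o g (0 +i* 1)).
Proof.
move=> hX hg; have bp := blin_pi hpi; have bX := Ar_blin hpi hX.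
pose M (c : A) : C := inner (pi c (X xi)) xi.
have lM : functional M.
  move=> c x y; rewrite /M (pi_lin hpi) -[(c *: pi x + pi y) _]/(c *: pi x (X xi) + pi y (X xi)).
  by rewrite innerDl innerZl.
pose h z := inner (pi b (g z xi)) xi; pose k z := h z - M (tw ('i%C * z) b).
have dM z : cdiff (fun w => M (tw ('i%C * w) b)) z 
  by apply: (@cdiff_rotate R (fun w => M (tw w b))); exact: twist_cdiff.
have : k 'i%C = 0.
  apply: (@strip_uniqueness R k) => [z sz e e0|z sz|t].
  - have e2 : 0 < e / 2 by rewrite divr_gt0.
    have [d1 d10 h1] := extension_continuous hg (bp b) sz e2.
    have [d2 d20 h2] := cdiff_continuous (dM z) e2.
    exists (Num.min d1 d2) => [|w sw]; first by rewrite lt_min d10.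
    rewrite lt_min => /andP[w1 w2].
    rewrite [k w - k z](_ : _ = (h w - h z) - (M (tw ('i%C * w) b) - M (tw ('i%C * z) b))); last first.
      by rewrite /k; ring.
    apply: le_lt_trans (ler_nrmB _ _) _; rewrite [ltRHS]splitr; apply: ltrD; first exact: h1.
    exact: h2.
  - have [b1 hb1] := extension_cdiff hg (bp b) sz; have [b2 hb2] := dM z.
    have := cderiv_lin (-1) hb2 hb1; rewrite (_ : (fun w => _) = k); first exact: cderiv_cdiff.
    by apply/funext => w; rewrite /k mulN1r addrC.
  (* On the real axis: [V t] fixes [Lambda 1] and conjugates the twist of [b] at [it] back to [b],
     so the unitaries cancel. *)
  have [bV VsV VVs] := uV t; case: hg => _ gt _ _.
  have Vxi : V t xi = xi by rewrite hV twist1.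
  have Vsxi : hadj (V t) xi = xi by rewrite -{1}Vxi (unitary_K VsV).
  have cE : pi b = conj_by (V t) (pi (tw ('i%C * t%:C) b)).
    rewrite (conj_pi dL hpi bV VVs (hV t)) => [|x y]; last exact: twistM.
    have -> : 'i%C * t%:C = 0 +i* t by apply: eqC; rewrite ?cReM ?cImM /=; ring.
    by rewrite twistK.
  apply/eqP; rewrite subr_eq0; apply/eqP; rewrite /h /M gt cE /conj_by /= Vsxi.
  by rewrite (unitary_K VsV) hadjP // Vsxi.
have -> : 'i%C = 0 +i* (1 : R) by [].
move/eqP; rewrite subr_eq0 /h => /eqP; rewrite /reduced_state /= => ->.
(* At [z = i] the twist parameter is -1; the modular property applied to the twist of [b] at -1
   restores [b] on the other side. *)
have -> : 'i%C * (0 +i* (1 : R)) = -1 by apply: eqC; rewrite ?cReM ?cImM /=; ring.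
rewrite /M [RHS]hadjP //; apply: Ar_inner_ext => // a.
rewrite -[RHS]hadjP // !(pi_Lambda hpi) !phiE mulr1 (phi_twist (tw (-1) b)) mulr1.
by have := twistK hD hDop f0 f0op fD (-1) b; rewrite opprK => ->.
Qed.

(** Only [Y] is approximated by elements [pi b]; [X] is kept, since the extension [g] belongs to
    it. *)
Lemma kms : kms_condition Ar psi (fun t => conj_by (V t)) 1.
Proof.
move=> X Y g hX hY hg; have bX := Ar_blin hpi hX; rewrite /reduced_state /= hadjP //.
apply: Ar_inner_ext => // b; rewrite -hadjP //; exact: kms_pi.
Qed.

End KMS.

(** * Faithfulness of the Haar state and the final assembly *)

Section GNS.
Variables (R : realType) (A : algType R[i]) (H : hilbert R).
Variables (star : A -> A) (phi : {scalar A}) (Lambda : {linear A -> H}) (pi : A -> H -> H).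
Hypothesis hstar : star_structure star.
Hypothesis hL : gns_pair star phi Lambda.
Hypothesis hpi : gns_representation star Lambda pi.

Lemma star1 : star 1 = 1.
Proof. by case: hstar => sK _ sM; have := sM (star 1) 1; rewrite mulr1 !sK mulr1. Qed.

Lemma inner_xi a : inner (Lambda a) (Lambda 1) = phi a.
Proof. by case: hL => _ ->; rewrite star1 mul1r. Qed.

(* A twisted trace has the same left and right kernel, and the kernel of
   [Lambda] is a left ideal, so [pi] vanishes on it. *)
Lemma Lambda_injective (theta : A -> A) :
  (forall a b, phi (a * b) = phi (b * theta a)) -> (forall b, exists a, theta a = b) ->
  forall a, Lambda a = 0 -> a = 0.
Proof.
case: hL => dL gns; case: hstar => sK _ _ tr surj.
have right_kernel c y : Lambda c = 0 -> phi (c * y) = 0.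
  move=> c0; have [x <-] := surj y; rewrite -tr.
  by have := gns c (star x); rewrite c0 inner0l sK.
move=> a a0; case: (hpi) => _ _ _ _; apply.
have -> : pi 0 = 0 by have := pi_lin hpi (-1) 0 0; rewrite scaler0 addr0 scaleN1r addNr.
apply: (blin_ext dL) (blin_pi hpi a) (blin_0 _ _) _ => _ [y _ <-].
rewrite (pi_Lambda hpi); apply: inner_eq0; rewrite gns mulrA; apply: right_kernel.
by rewrite -(pi_Lambda hpi) a0 (blin0 (blin_pi hpi _)).
Qed.

End GNS.

Theorem theorem5p1 (R : realType) (A : algType R[i]) (star : A -> A)
    (Delta : A -> tensor A A) (eps : {scalar A}) (S : {linear A -> A})
    (phi : {scalar A}) (f : R[i] -> {scalar A})
    (H : hilbert R) (Lambda : {linear A -> H}) (pi : A -> H -> H)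
    (HH : hilbert R) (ten : H -> H -> HH) (W Wop : HH -> HH)
    (f_r : R -> (H -> H) -> R[i]) (Phi : R -> (HH -> HH) -> (H -> H))
    (hA : compact_aqg star Delta)
    (heps : is_counit star Delta eps)
    (hS : is_antipode Delta eps S)
    (hphi : haar_state star Delta phi)
    (hf : modular_functionals star Delta eps S phi f)
    (hLambda : gns_pair star phi Lambda)
    (hpi : gns_representation star Lambda pi)
    (hco : co_amenable pi eps)
    (hten : hilbert_tensor ten)
    (hW : is_multiplicative_unitary ten Delta Lambda W)
    (hWop : is_multiplicative_unitary ten (fun a => tflip (Delta a)) Lambda Wop)
    (hf_r : forall t : R, is_reduced_character pi (f (0 +i* t)) (f_r t))
    (hPhi : forall t : R,
       is_slice_extension ten (reduced_algebra pi) (f_r t) (Phi t)) :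
  let Ar := reduced_algebra pi in
  let F_ := fun t : R => Phi t W in
  let E_ := fun t : R => Phi t Wop in
  let V_ := fun t : R => F_ t \o E_ t in
  [/\ forall t a, F_ t (Lambda a) = Lambda (conv_r Delta a (f (- (0 +i* t)))),
      forall t a, E_ t (Lambda a) = Lambda (conv_l Delta (f (- (0 +i* t))) a),
      forall t, F_ t \o E_ t = E_ t \o F_ t,
      exists F E : set (H * H),
        [/\ self_adjoint F /\ self_adjoint E,
            forall t, is_exp_i t F (F_ t),
            forall t, is_exp_i t E (E_ t),
            self_adjoint (op_closure (op_sum E F))
          & forall t, is_exp_i t (op_closure (op_sum E F)) (V_ t)]
    & exists sigma : R -> (H -> H) -> (H -> H),
        [/\ forall t, star_automorphism Ar (sigma t) /\
              (forall a, sigma t (pi a) =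
                 pi (conv_lr Delta (f (- (0 +i* t))) a (f (- (0 +i* t))))),
            forall t s, star_automorphism Ar s ->
              (forall a, s (pi a) =
                 pi (conv_lr Delta (f (- (0 +i* t))) a (f (- (0 +i* t))))) ->
              forall X, Ar X -> s X = sigma t X,
            forall t X, Ar X -> sigma t X = V_ t \o X \o adj (V_ t)
          & kms_condition Ar (reduced_state Lambda) sigma 1]].
Proof.
move=> Ar F_ E_ V_.
have [[hstar [lD D1 DM _]] coass bij1 bij2 _] := hA.
have [hD hDop] := bialgebra_flip lD D1 DM coass bij1 bij2.
have [dL gns] := hLambda; have [_ _ phi1] := hphi; have [_ _ _ epsl epsr] := heps.
have [f1M der [f0e fD] _ [_ phitw]] := hf.
have f1 z : f z 1 = 1 by case: (f1M z).
have fM z a b : f z (a * b) = f z a * f z b by case: (f1M z).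
have df a z : cdiff (fun w => f w a) z by apply: derivable_cdiff; exact: (der a).1.
have f0E : (f 0 : A -> R[i]) = eps by apply/funext.
have f0 a : conv_r Delta a (f 0) = a by rewrite f0E; exact: epsl.
have f0op a : conv_r (fun b => tflip (Delta b)) a (f 0) = a.
  by rewrite -conv_l_flip ?f0E; [exact: epsr | exact: functional_scalar].
have L1 : inner (Lambda 1) (Lambda 1) = 1 by rewrite (inner_xi hstar hLambda).
have hF t : [/\ blin (F_ t), hadj (F_ t) \o F_ t = id, F_ t \o hadj (F_ t) = id
    & forall a, hadj (F_ t) (Lambda a) = Lambda (conv_r Delta a (f (0 +i* t)))].
  by apply: (Phi_unitary dL hpi hten hD hW (f1 _) (hf_r t).2 (hPhi t)).
(* The same slicing result, for the opposite coproduct and [Wop]. *)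
have hE t : [/\ blin (E_ t), hadj (E_ t) \o E_ t = id, E_ t \o hadj (E_ t) = id
    & forall a, hadj (E_ t) (Lambda a) =
        Lambda (conv_r (fun b => tflip (Delta b)) a (f (0 +i* t)))].
  by apply: (Phi_unitary dL hpi hten hDop hWop (f1 _) (hf_r t).2 (hPhi t)).
have tw_inv z a : exists b, twist Delta f z b = a.
  by exists (twist Delta f (- z) a); rewrite -{1}(opprK z) (twistK hD hDop f0 f0op fD).
(* The modular property exhibits [phi] as a trace twisted by the bijection [twist Delta f 1]. *)
have iL := Lambda_injective hstar hLambda hpi phitw (tw_inv 1).
have FE := flows_Lambda hD hDop f0 f0op fD hF hE.
have uV : unitary_family V_.
  move=> t; have [bF F1 F2 _] := hF t; have [bE E1 E2 _] := hE t.
  have K1 x := congr1 (fun g => g x) F1; have K2 x := congr1 (fun g => g x) F2.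
  have K3 x := congr1 (fun g => g x) E1; have K4 x := congr1 (fun g => g x) E2.
  rewrite /V_ (hadj_comp bF bE); split; first exact: blin_comp.
    by apply/funext => x /=; have /= -> := K1 (E_ t x); exact: K3.
  by apply/funext => x /=; have /= -> := K4 (hadj (F_ t) x); exact: K2.
have hV t a : V_ t (Lambda a) = Lambda (twist Delta f (- (0 +i* t)) a).
  by rewrite /V_ /= (FE t a).2 (FE t _).1 /twist conv_lrE //; exact: functional_scalar.
have twM t := twistM hD hDop fM (- (0 +i* t)).
split.
- by move=> t a; exact: (FE t a).1.
- by move=> t a; exact: (FE t a).2.
- exact: flows_commute hD hDop dL f0 f0op fD hF hE.
- exact: flow_spectral hD hDop dL iL f0 f0op fD (fun a => df a 0) hF hE.
exists (fun t => conj_by (V_ t)); split=> [t|t s hs spi X hX|//|].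
- have [bV V1 V2] := uV t; split; last by move=> a; exact: (conj_pi dL hpi bV V2 (hV t) (twM t)).
  exact: (conj_by_automorphism dL hpi bV V1 V2 (hV t) (twM t) (tw_inv _)).
- have [bV V1 V2] := uV t.
  by apply: (automorphism_uniq dL hpi bV V1 V2 (hV t) (twM t) (twist1 hD hDop f1 _) hs).
- by apply: (kms dL hpi L1 hD hDop f0 f0op fD f1 fM df (inner_xi hstar hLambda) phitw uV hV).
Qed.
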